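(* Let $(\nabla_t,h)_{t\in]-\epsilon,\epsilon[}$ be a bounded variation of a $\Theta$-uniformly hyperbolic bundle $\rho=(\nabla,h)$, and let $\dot\nabla$ be the derivative of $\nabla_t$ at $t=0$. Let $G$ be a $\Theta$-ghost polygon. Then $$\mathrm d\mathsf T_G(\dot\nabla)=\oint_{\rho(G)}\dot\nabla\ ,$$ where the left-hand side is the derivative at $t=0$ of $t\mapsto\mathsf T_G(\nabla_t,h)$.
   Context: Uniformly hyperbolic bundles. $\mathsf U\mathbb H^2$ is the unit tangent bundle of the hyperbolic plane, $(\phi_t)$ its geodesic flow, generated by $\partial_s$; $V$ is a finite-dimensional vector space, $E=V\times\mathsf U\mathbb H^2$. A frame $h$ on $E$ defines the metric $g_h$ for which it is orthonormal, with norms $\|\cdot\|_x$, angles $\angle_x(F,G)$ (infimum of angles of nonzero vectors) and distances $d_x$ of diameter $1$ on Grassmannians of $E_x$. $\Phi^\nabla_t$ is the lift of $\phi_t$ to $E$ by $\nabla$-parallel transport. $(\nabla,h)$ ($\nabla$ a trivializable connection) is a rank $k$ uniformly hyperbolic bundle if $\|\Phi^\nabla_{\pm1}\|$ are uniformly bounded and there is a flow invariant decomposition $E_x=L_x\oplus P_x$ (not a priori continuous), $\dim L_x=k$, such that: (1) some volume form on $E$ is bounded with respect to $h$ and $\nabla$-parallel along flow orbits; (2) there are $B,b>0$ with $\|\Phi^\nabla_s(u)\|_{\phi_s(x)}/\|u\|_x\le Be^{-bs}\|\Phi^\nabla_s(v)\|_{\phi_s(x)}/\|v\|_x$ for $s>0$,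 nonzero $u\in L_x$, $v\in P_x$; (3) elements of the fibres over $x$ of the closures of (the images of) $L$ and $P$ make an angle $>2\epsilon_0$, $\epsilon_0>0$ independent of $x$; (4) when $\nabla$ is trivialized, there is a continuous decomposition $E=L^\infty\oplus P^\infty$ of the same type with $\angle_x(L^\infty_x,P^\infty_x)>\epsilon_1>0$ and $d_x(L^\infty_x,L^\infty_y)\le Hd(x,y)^\alpha$, and the same for $P^\infty$. $\Theta=(K_1<\dots<K_n)$, $1\le K_1$, $K_n<\dim V$. $(\nabla,h)$ is $\Theta$-uniformly hyperbolic if there is an invariant decomposition $E=E_1\oplus\dots\oplus E_{n+1}$ such that for each $a$ it is uniformly hyperbolic of rank $K_a$ for $F_a=E_1\oplus\dots\oplus E_a$, $F_a^\circ=E_{a+1}\oplus\dots\oplus E_{n+1}$. Identify $V$ with the space of $\nabla$-parallel sections. For an oriented geodesic $g=(g^-,g^+)$, $F_a$ and $F_a^\circ$ are constant along $g$ and $\mathrm p^a(g)\in\mathrm{End}(V)$ is the projection on $F_a$ parallel to $F_a^\circ$. Bounded variation (fixed frame): $\nabla_t=\nabla+B^t$ with $B^0=0$, $t\mapsto B^t(\partial_s)$ of class $C^k$ with values in $C^0(K,\mathrm{End}V)$ for each compact $K\subset\mathsf U\mathbb H^2$, and the derivatives $\dot\nabla_{\partial_s}$ uniformly bounded in $g_h$ for $t$ near $0$; here $k\geq 2$. For small $t$, $(\nabla_t,h)$ is again $\Theta$-uniformly hyperbolic. A $\Theta$-ghost polygon $G$ is given by a configuration $\lceil g_1,\dots,g_p\rceil$: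 oriented geodesics, up to cyclic permutation, with labels $a(i)\in\{1,\dots,n\}$; put $\mathrm p_i=\mathrm p^{a(i)}(g_i)$ and $\mathrm P_i=\mathrm p_{i-1}\mathrm p_{i-2}\cdots\mathrm p_{i+1}$ (cyclic, decreasing indices, all but $\mathrm p_i$). $\mathsf T_G(\rho)=\mathrm{Tr}(\mathrm p_p\cdots\mathrm p_1)$. Ghost integration. Let $\alpha$ be a closed $1$-form with values in $\mathrm{End}(E)$ (with respect to the flat connection $\nabla$; in the trivialization, an $\mathrm{End}(V)$-valued form), bounded in the sense that $\|\alpha_x(u)\|$ is uniformly bounded over $(x,u)\in\mathsf U\mathbb H^2$ (only values in directions of the flow are used). Let $\beta$ be a primitive, $\mathrm d\beta=\alpha$. For an oriented geodesic $g$ with projector $\mathrm p$, $x\in g$, $\mathrm Q\in\mathrm{End}(V)$, set $$\mathbf J_{g,\mathrm Q}(\beta)=\mathrm{Tr}([\beta(x),\mathrm p]\mathrm Q)+\int_{g^+}\mathrm{Tr}(\mathrm Q[\alpha,\mathrm p]\mathrm p)+\int_{g^-}\mathrm{Tr}(\mathrm Q\,\mathrm p[\alpha,\mathrm p])\ ,$$ where $g^\pm$ here denotes the arc oriented from $x$ to the endpoint $g^\pm$; this is independent of $x$. Then $\oint_{\rho(G)}\alpha=\sum_{i=1}^p\mathbf J_{g_i,\mathrm P_i}(\beta)$, which depends only on $\alpha$. *)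

(* Defs.v *)
From HB Require Import structures.
From mathcomp Require Import all_boot all_order all_algebra.
From mathcomp Require Import all_classical all_reals all_analysis.
From mathcomp Require Import ring lra.

Set Implicit Arguments.
Unset Strict Implicit.
Unset Printing Implicit Defensive.

Import Order.TTheory GRing.Theory Num.Theory.
Import numFieldNormedType.Exports.
Local Open Scope classical_set_scope.
Local Open Scope ring_scope.

Section UnitTangentBundle.
Variable R : realType.
Implicit Types (X Y W : 'rV[R]_3) (s : R).

Definition vec3 (a b c : R) : 'rV[R]_3 := \row_(i < 3) [:: a; b; c]`_i.

Definition c0 X := X 0 (@Ordinal 3 0 isT).
Definition c1 X := X 0 (@Ordinal 3 1 isT).
Definition c2 X := X 0 (@Ordinal 3 2 isT).

Definition lorentz X Y : R := c1 X * c1 Y + c2 X * c2 Y - c0 X * c0 Y.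

(** Hyperboloid model: a point [X] of the upper sheet of [<X,X> = -1] and a
    unit vector [W] tangent to it at [X]. *)
Definition uh2_set : set ('rV[R]_3 * 'rV[R]_3) :=
  [set x | [/\ lorentz x.1 x.1 = -1, 0 < c0 x.1,
               lorentz x.2 x.2 = 1 & lorentz x.1 x.2 = 0]].

Definition UH2 : topologicalType := set_type uh2_set.

(** Lorentzian cross product: [(W, unit_normal X W)] is an oriented
    orthonormal basis of the tangent plane at [X]. *)
Definition unit_normal X W : 'rV[R]_3 :=
  vec3 (c2 X * c1 W - c1 X * c2 W) (c2 X * c0 W - c0 X * c2 W)
       (c0 X * c1 W - c1 X * c0 W).

Definition coshR s : R := (expR s + expR (- s)) / 2.
Definition sinhR s : R := (expR s - expR (- s)) / 2.

Lemma c0Z a b X W : c0 (a *: X + b *: W) = a * c0 X + b * c0 W.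
Proof. by rewrite /c0 !mxE. Qed.
Lemma c1Z a b X W : c1 (a *: X + b *: W) = a * c1 X + b * c1 W.
Proof. by rewrite /c1 !mxE. Qed.
Lemma c2Z a b X W : c2 (a *: X + b *: W) = a * c2 X + b * c2 W.
Proof. by rewrite /c2 !mxE. Qed.
Lemma c0N X W : c0 (unit_normal X W) = c2 X * c1 W - c1 X * c2 W.
Proof. by rewrite {1}/c0 !mxE. Qed.
Lemma c1N X W : c1 (unit_normal X W) = c2 X * c0 W - c0 X * c2 W.
Proof. by rewrite {1}/c1 !mxE. Qed.
Lemma c2N X W : c2 (unit_normal X W) = c0 X * c1 W - c1 X * c0 W.
Proof. by rewrite {1}/c2 !mxE. Qed.

Definition coordE := (c0Z, c1Z, c2Z, c0N, c1N, c2N).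

Lemma coshR2 s : coshR s ^+ 2 - sinhR s ^+ 2 = 1.
Proof.
have e : expR s * expR (- s) = 1 by rewrite -expRD subrr expR0.
by rewrite /coshR /sinhR; lra.
Qed.

Lemma uh2_boost X W s : uh2_set (X, W) ->
  uh2_set (coshR s *: X + sinhR s *: W, sinhR s *: X + coshR s *: W).
Proof.
move=> -[] /=; rewrite /lorentz => XX X0 WW XW.
have cs := coshR2 s.
have cp : 0 < coshR s.
  by rewrite /coshR divr_gt0// addr_gt0// expR_gt0.
split; rewrite /= /lorentz ?coordE.
- transitivity ((coshR s) ^+ 2 * (c1 X * c1 X + c2 X * c2 X - c0 X * c0 X)
    + (sinhR s) ^+ 2 * (c1 W * c1 W + c2 W * c2 W - c0 W * c0 W)
    + 2 * coshR s * sinhR s * (c1 X * c1 W + c2 X * c2 W - c0 X * c0 W));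
    first by ring.
  by rewrite XX WW XW; lra.
- set c := coshR s in cs cp *; set t := sinhR s in cs *.
  have csx : (c0 X * c0 W) ^+ 2 <=
      (c1 X ^+ 2 + c2 X ^+ 2) * (c1 W ^+ 2 + c2 W ^+ 2).
    have -> : c0 X * c0 W = c1 X * c1 W + c2 X * c2 W by lra.
    rewrite -subr_ge0.
    rewrite [leRHS](_ : _ = (c1 X * c2 W - c2 X * c1 W) ^+ 2); last by ring.
    exact: sqr_ge0.
  have eX : c1 X ^+ 2 + c2 X ^+ 2 = c0 X ^+ 2 - 1 by lra.
  have eW : c1 W ^+ 2 + c2 W ^+ 2 = c0 W ^+ 2 + 1 by lra.
  have WX : c0 W ^+ 2 < c0 X ^+ 2 by move: csx; rewrite eX eW; nra.
  have tc : t ^+ 2 < c ^+ 2 by lra.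
  have WX' : `|c0 W| < c0 X.
    by rewrite -(gtr0_norm X0) -ltr_sqr ?nnegrE ?normr_ge0// !real_normK ?num_real.
  have tc' : `|t| < c.
    by rewrite -(gtr0_norm cp) -ltr_sqr ?nnegrE ?normr_ge0// !real_normK ?num_real.
  have : `|t * c0 W| < c * c0 X.
    by rewrite normrM ltr_pM.
  by rewrite ltr_norml => /andP[]; lra.
- transitivity ((sinhR s) ^+ 2 * (c1 X * c1 X + c2 X * c2 X - c0 X * c0 X)
    + (coshR s) ^+ 2 * (c1 W * c1 W + c2 W * c2 W - c0 W * c0 W)
    + 2 * coshR s * sinhR s * (c1 X * c1 W + c2 X * c2 W - c0 X * c0 W));
    first by ring.
  by rewrite XX WW XW; lra.
- transitivity (coshR s * sinhR s * (c1 X * c1 X + c2 X * c2 X - c0 X * c0 X)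
    + coshR s * sinhR s * (c1 W * c1 W + c2 W * c2 W - c0 W * c0 W)
    + ((coshR s) ^+ 2 + (sinhR s) ^+ 2)
      * (c1 X * c1 W + c2 X * c2 W - c0 X * c0 W));
    first by ring.
  by rewrite XX WW XW; lra.
Qed.

Lemma uh2_normal X W : uh2_set (X, W) ->
  uh2_set (X, unit_normal X W) /\ lorentz W (unit_normal X W) = 0.
Proof.
move=> -[] /=; rewrite /lorentz => XX X0 WW XW.
split; last by rewrite /lorentz !coordE; ring.
split; rewrite /= /lorentz ?coordE //; last by ring.
transitivity ((c1 X * c1 W + c2 X * c2 W - c0 X * c0 W) ^+ 2
  - (c1 X * c1 X + c2 X * c2 X - c0 X * c0 X)
    * (c1 W * c1 W + c2 W * c2 W - c0 W * c0 W)); first by ring.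
by rewrite XX WW XW; ring.
Qed.

Lemma uh2_slide X W s : uh2_set (X, W) ->
  uh2_set (coshR s *: X + sinhR s *: unit_normal X W, W).
Proof.
move=> xW; have [xN WN] := uh2_normal xW.
have [/= XX X0 _ _] := uh2_boost s xN.
case: xW => /= _ _ WW XW; split => //=.
move: WN XW; rewrite /lorentz !c0Z !c1Z !c2Z => WN XW.
transitivity (coshR s * (c1 X * c1 W + c2 X * c2 W - c0 X * c0 W)
  + sinhR s * (c1 W * c1 (unit_normal X W) + c2 W * c2 (unit_normal X W)
               - c0 W * c0 (unit_normal X W))); first by ring.
by rewrite WN XW; ring.
Qed.

Lemma uh2_rot X W s : uh2_set (X, W) ->
  uh2_set (X, cos s *: W + sin s *: unit_normal X W).
Proof.
move=> xW; have [[/= _ _ NN XN] WN] := uh2_normal xW.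
case: xW => /= XX X0 WW XW; have cs := cos2Dsin2 s.
split => //=; move: NN XN WN WW XW; rewrite /lorentz !c0Z !c1Z !c2Z.
- set N := unit_normal X W => NN XN WN WW XW.
  transitivity ((cos s) ^+ 2 * (c1 W * c1 W + c2 W * c2 W - c0 W * c0 W)
    + (sin s) ^+ 2 * (c1 N * c1 N + c2 N * c2 N - c0 N * c0 N)
    + 2 * cos s * sin s * (c1 W * c1 N + c2 W * c2 N - c0 W * c0 N));
    first by ring.
  by rewrite NN WW WN; lra.
- set N := unit_normal X W => NN XN WN WW XW.
  transitivity (cos s * (c1 X * c1 W + c2 X * c2 W - c0 X * c0 W)
    + sin s * (c1 X * c1 N + c2 X * c2 N - c0 X * c0 N)); first by ring.
  by rewrite XN XW; ring.
Qed.

Lemma uh2P (x : UH2) : uh2_set ((\val x).1, (\val x).2).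
Proof. by rewrite -surjective_pairing; exact: set_valP. Qed.

Definition mkUH2 (x : 'rV[R]_3 * 'rV[R]_3) (hx : uh2_set x) : UH2 :=
  exist _ x (mem_set hx).

(** The geodesic flow [phi_s], generated by [\partial_s]. *)
Definition gflow s (x : UH2) : UH2 := mkUH2 (uh2_boost s (uh2P x)).

(** Moving the base point along the geodesic orthogonal to the vector, the
    vector being parallel transported. *)
Definition nflow s (x : UH2) : UH2 := mkUH2 (uh2_slide s (uh2P x)).

Definition rflow s (x : UH2) : UH2 := mkUH2 (uh2_rot s (uh2P x)).

(** The generators of these three flows form a frame of the tangent bundle of
    [UH2] (left-invariant fields on PSL_2(R)). *)
Inductive dir := Ds | Dn | Dr.

Definition flow (i : dir) : R -> UH2 -> UH2 :=
  match i with Ds => gflow | Dn => nflow | Dr => rflow end.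

Definition arcosh (c : R) : R := ln (c + Num.sqrt (c ^+ 2 - 1)).

Definition distH (x y : UH2) : R := arcosh (- lorentz (\val x).1 (\val y).1).

(** [sup_(0 <= s <= 1) distH (phi_s x) (phi_s y)], attained at an endpoint by
    convexity; isometry invariant and locally bi-Lipschitz to the Sasaki
    distance. *)
Definition distUH (x y : UH2) : R :=
  Num.max (distH x y) (distH (gflow 1 x) (gflow 1 y)).

End UnitTangentBundle.

Section Metric.
Variables (R : realType) (d : nat).
Implicit Types (M : 'M[R]_d) (u v w : 'cV[R]_d) (F G : {vspace 'cV[R]_d}).

(** In this section the columns of the invertible matrix [M] form an
    orthonormal basis. *)
Definition dotM M u v : R :=
  \sum_(i < d) (invmx M *m u) i 0 * (invmx M *m v) i 0.

Definition normM M v : R := Num.sqrt (dotM M v v).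

Definition angleM M F G : R :=
  inf [set a | exists u v, [/\ u \in F, v \in G, u != 0, v != 0 &
                 a = acos (dotM M u v / (normM M u * normM M v))]].

Definition gapM M F G : R :=
  sup [set r | exists2 u, u \in F & normM M u = 1 /\
                 r = inf [set normM M (u - w) | w in [set` G]]].

Definition distM M F G : R := Num.max (gapM M F G) (gapM M G F).

Definition projector F G : 'M[R]_d :=
  \matrix_(i, j) (daddv_pi F G (delta_mx j 0)) i 0.

End Metric.

Section Connection.
Variables (R : realType) (d : nat).
Local Notation UH2 := (UH2 R).

(** An [End(E)]-valued 1-form on [UH2], given by its values on the frame; the
    connection form [A] stands for the connection [D + A], where [D] is the
    product connection. *)
Definition oneform := dir -> UH2 -> 'M[R]_d.

(** The columns of [tau] form a basis of the space of parallel sections. *)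
Definition parallel_basis (A : oneform) (tau : UH2 -> 'M[R]_d) : Prop :=
  (forall x, tau x \in unitmx) /\
  (forall i x, is_derive (0 : R) (1 : R)
     (fun s => tau (flow i s x)) (- (A i x *m tau x))).

Definition trivializable_connection (A : oneform) : Prop :=
  (forall i, continuous (A i)) /\ exists tau, parallel_basis A tau.

(** A trivialization of a trivializable connection: [v |-> triv A ^~ *m v]
    identifies [V = R^d] with the space of parallel sections. It is unique up
    to a constant change of basis. *)
Definition triv (A : oneform) : UH2 -> 'M[R]_d :=
  xget (fun=> 1%:M) [set tau | parallel_basis A tau].

(** The lift of [gflow s] by parallel transport, from [E_x] to
    [E_(gflow s x)]. *)
Definition transport (A : oneform) (s : R) (x : UH2) : 'M[R]_d :=
  triv A (gflow s x) *m invmx (triv A x).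

End Connection.

Section Hyperbolic.
Variables (R : realType) (d : nat).
Local Notation UH2 := (UH2 R).
Local Notation oneform := (oneform R d).
Implicit Types (A : oneform) (h : UH2 -> 'M[R]_d).

Definition subfield := UH2 -> {vspace 'cV[R]_d}.
Implicit Types L P : subfield.

(** The columns of [h x] are the vectors of the frame at [x], so that the
    metric [g_h] on [E_x] is [dotM (h x)]. *)
Definition is_frame h : Prop :=
  continuous h /\ forall x, h x \in unitmx.

Definition bounded_transport A h : Prop :=
  exists C : R, forall x v,
    normM (h (gflow 1 x)) (transport A 1 x *m v) <= C * normM (h x) v /\
    normM (h (gflow (- 1) x)) (transport A (- 1) x *m v) <= C * normM (h x) v.

Definition flow_invariant A L : Prop :=
  forall s x v, (transport A s x *m v \in L (gflow s x)) = (v \in L x).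

(** The volume form is [omega x] times the determinant on [E_x = R^d]. *)
Definition bounded_volume A h : Prop :=
  exists omega : UH2 -> R,
    [/\ continuous omega, forall x, omega x != 0,
        forall s x, omega (gflow s x) * \det (transport A s x) = omega x &
        exists C : R, forall x, `|omega x * \det (h x)| <= C].

Definition dominated A h L P : Prop :=
  exists B b : R, [/\ 0 < B, 0 < b &
    forall x s u v, 0 < s -> u \in L x -> u != 0 -> v \in P x -> v != 0 ->
      normM (h (gflow s x)) (transport A s x *m u) / normM (h x) u <=
      B * expR (- b * s) *
      (normM (h (gflow s x)) (transport A s x *m v) / normM (h x) v)].

(** [F] lies over [x] in the closure of the image of [L] in the Grassmannian
    bundle. *)
Definition section_closure h L x (F : {vspace 'cV[R]_d}) : Prop :=
  forall (U : set UH2) (e : R), nbhs x U -> 0 < e ->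
    exists2 y, U y & distM (h x) (L y) F < e.

Definition transverse_closures h L P : Prop :=
  exists e0 : R, 0 < e0 /\ forall x F G,
    section_closure h L x F -> section_closure h P x G ->
    2 * e0 < angleM (h x) F G.

(** For a field [Linf] of subspaces of the space [V] of parallel sections;
    [M x] is the basis of [V] that is orthonormal for [g_h] at [x]. *)
Definition continuous_subfield (M : UH2 -> 'M[R]_d) (Linf : subfield) : Prop :=
  forall x (e : R), 0 < e -> \forall y \near x, distM (M x) (Linf x) (Linf y) < e.

Definition hoelder_subfield (M : UH2 -> 'M[R]_d) (Linf : subfield)
    (H alpha : R) : Prop :=
  forall x y, distM (M x) (Linf x) (Linf y) <= H * distUH x y `^ alpha.

Definition hoelder_splitting A h (k : nat) : Prop :=
  let M x := invmx (triv A x) *m h x in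
  exists (Linf Pinf : subfield) (e1 H alpha : R),
    [/\ 0 < e1, 0 < alpha,
        forall x, [/\ (Linf x + Pinf x)%VS = fullv, (Linf x :&: Pinf x)%VS = 0%VS,
                      \dim (Linf x) = k & e1 < angleM (M x) (Linf x) (Pinf x)],
        continuous_subfield M Linf /\ continuous_subfield M Pinf &
        hoelder_subfield M Linf H alpha /\ hoelder_subfield M Pinf H alpha].

Definition dominated_splitting A h (k : nat) L P : Prop :=
  [/\ forall x, [/\ (L x + P x)%VS = fullv, (L x :&: P x)%VS = 0%VS &
                    \dim (L x) = k],
      flow_invariant A L, flow_invariant A P & dominated A h L P].

Definition uniformly_hyperbolic A h (k : nat) L P : Prop :=
  [/\ trivializable_connection A /\ is_frame h,
      bounded_transport A h,
      dominated_splitting A h k L P,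
      bounded_volume A h &
      transverse_closures h L P /\ hoelder_splitting A h k].

Variables (n : nat) (K : 'I_n -> nat).
Implicit Type E : UH2 -> 'I_n.+1 -> {vspace 'cV[R]_d}.

Definition is_theta : Prop :=
  (forall a b : 'I_n, (a < b)%N -> (K a < K b)%N) /\
  (forall a, (1 <= K a)%N /\ (K a < d)%N).

(** Indices are shifted by one: [E x] lists [E_1, ..., E_(n+1)] from [0] to
    [n], and [a : 'I_n] stands for the label [a + 1]. *)
Definition flagF E (a : 'I_n) : subfield :=
  fun x => (\sum_(i < n.+1 | (i <= a)%N) E x i)%VS.
Definition flagFo E (a : 'I_n) : subfield :=
  fun x => (\sum_(i < n.+1 | (a < i)%N) E x i)%VS.

Definition invariant_decomposition A E : Prop :=
  (forall x, (\sum_(i < n.+1) E x i)%VS = fullv /\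
             directv (\sum_(i < n.+1) E x i)) /\
  (forall i, flow_invariant A (fun x => E x i)).

Definition theta_uniformly_hyperbolic A h : Prop :=
  exists E, invariant_decomposition A E /\
    forall a, uniformly_hyperbolic A h (K a) (flagF E a) (flagFo E a).

(** The decomposition of a Theta-uniformly hyperbolic bundle is determined by
    its invariance, the ranks and the domination: at most one [E] satisfies
    the following. *)
Definition theta_splitting A h E : Prop :=
  invariant_decomposition A E /\
  forall a, dominated_splitting A h (K a) (flagF E a) (flagFo E a).

Definition the_splitting A h : UH2 -> 'I_n.+1 -> {vspace 'cV[R]_d} :=
  xget (fun _ _ => 0%VS) [set E | theta_splitting A h E].

(** The projector [p^a(g)] in [End(V)], for the geodesic [g] through [x]. *)
Definition proj A h (a : 'I_n) (x : UH2) : 'M[R]_d :=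
  let E := the_splitting A h in
  invmx (triv A x) *m projector (flagF E a x) (flagFo E a x) *m triv A x.

End Hyperbolic.

Section Variation.
Variables (R : realType) (d : nat).
Local Notation UH2 := (UH2 R).
Local Notation oneform := (oneform R d).

(** [t |-> f t] is of class [C^k] on [`]-eps, eps[] with values in
    [C^0(K, End V)] for every compact [K]; [D j] is the [j]-th derivative. *)
Definition Ck_family (k : nat) (eps : R) (f : R -> UH2 -> 'M[R]_d) : Prop :=
  exists D : nat -> R -> UH2 -> 'M[R]_d,
    [/\ forall t, `|t| < eps -> D 0%N t = f t,
        forall j t, (j <= k)%N -> `|t| < eps -> continuous (D j t),
        forall j t, (j < k)%N -> `|t| < eps ->
          {family compact, (fun x => s^-1 *: (D j (t + s) x - D j t x))
             @[s --> (0 : R)^'] --> D j.+1 t} &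
        forall t, `|t| < eps ->
          {family compact, D k s @[s --> t] --> D k t}].

Definition bounded_variation_of (k : nat) (eps : R) (A : R -> oneform)
    (h : UH2 -> 'M[R]_d) : Prop :=
  let B (t : R) (i : dir) (x : UH2) := A t i x - A 0 i x in
  [/\ 0 < eps,
      forall t, `|t| < eps -> trivializable_connection (A t),
      Ck_family k eps (fun t => B t Ds) &
      exists C : R, \forall t \near (0 : R), forall x v,
        normM (h x) (derive1 (fun s => B s Ds x) t *m v) <= C * normM (h x) v].

(** [A'] is the derivative at [0] of [t |-> A t], uniformly on compact sets. *)
Definition derivative_at0 (A : R -> oneform) (A' : oneform) : Prop :=
  forall i, {family compact, (fun x => t^-1 *: (A t i x - A 0 i x))
               @[t --> (0 : R)^'] --> A' i}.

End Variation.

Section Ghost.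
Variables (R : realType) (d n : nat) (K : 'I_n -> nat).
Local Notation UH2 := (UH2 R).
Local Notation oneform := (oneform R d).

(** A configuration of [p = sides.+1] labelled oriented geodesics; an oriented
    geodesic is an orbit of [gflow], given by a point on it. *)
Record ghost_polygon := GhostPolygon {
  sides : nat;
  geod : 'I_sides.+1 -> UH2;
  label : 'I_sides.+1 -> 'I_n }.

Definition commM (a b : 'M[R]_d) := a *m b - b *m a.

Variables (A : oneform) (h : UH2 -> 'M[R]_d) (G : ghost_polygon).

Definition gproj (i : 'I_(sides G).+1) : 'M[R]_d :=
  proj K A h (label i) (geod i).

(** [p_(i-1) p_(i-2) ... p_(i+1)]; the index [i - inZp j] is cyclic. *)
Definition gcoproj (i : 'I_(sides G).+1) : 'M[R]_d :=
  \big[mulmx/1%:M]_(1 <= j < (sides G).+1) gproj (i - inZp j).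

Definition ghost_trace : R :=
  \tr (\big[mulmx/1%:M]_(j < (sides G).+1) gproj (rev_ord j)).

(** The form [alpha] in the trivialization of [End(E)] given by [A]. *)
Definition trivialized (alpha : oneform) : oneform :=
  fun i x => invmx (triv A x) *m alpha i x *m triv A x.

Definition primitive (alpha : oneform) (beta : UH2 -> 'M[R]_d) : Prop :=
  forall i x, is_derive (0 : R) (1 : R)
    (fun s => beta (flow i s x)) (trivialized alpha i x).

(** [J_(g,Q)(beta)] for the geodesic [g] through [x] with projector [p]; the
    arc from [x] to [g^-] is traversed against the flow, whence the minus
    sign. *)
Definition Jint (alpha : oneform) (beta : UH2 -> 'M[R]_d)
    (x : UH2) (p Q : 'M[R]_d) : R :=
  let a s := trivialized alpha Ds (gflow s x) in
  \tr (commM (beta x) p *m Q)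
  + \int[lebesgue_measure]_(s in `[0, +oo[) \tr (Q *m (commM (a s) p *m p))
  - \int[lebesgue_measure]_(s in `]-oo, 0]) \tr (Q *m (p *m commM (a s) p)).

Definition ghost_integral (alpha : oneform) : R :=
  let beta := xget (fun=> 0) [set beta | primitive alpha beta] in
  \sum_(i < (sides G).+1)
    Jint alpha beta (geod i) (gproj i) (gcoproj i).

End Ghost.

(* Main.v *)
(* In the space [V] of parallel sections the splitting of [nabla 0] is constant
   along geodesics, and [nabla t] is the perturbation of the flat connection by
   [b_t = T0^-1 (nabla_t - nabla_0) T0], of norm [O(t)]. Domination makes the
   off-diagonal blocks of a bounded matrix field integrable along geodesics, the
   lower ones towards [g^+], the upper ones towards [g^-]; a Picard iteration
   then yields [Z_t = 1 + O(t)] carrying the splitting of [nabla 0] to an invariant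
   dominated splitting for [nabla t], which is the only one of the given ranks.
   The quotient of the trivializations of [nabla t] and [nabla 0] has derivative
   [- beta] with [beta] primitive, so up to a constant conjugation the projector
   [p] on a geodesic has derivative [[beta + Z', p]], where [Z'] is the integral of
   the off-diagonal blocks of the variation. Its lower and upper parts are the two
   improper integrals of [J]; the trace does not see the constant conjugation,
   nor the choice of [beta]. *)
From HB Require Import structures.
From mathcomp Require Import all_boot all_order all_algebra.
From mathcomp Require Import all_classical all_reals all_analysis.
From mathcomp Require Import measurable_realfun ring lra zify.
Require Import Defs.

Set Implicit Arguments.
Unset Strict Implicit.
Unset Printing Implicit Defensive.

Import Order.TTheory GRing.Theory Num.Theory.
Import numFieldNormedType.Exports.
Local Open Scope classical_set_scope.
Local Open Scope ring_scope.

(** * Matrix calculus *)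

Section MatrixCalculus.
Variable R : realType.

(** In [t] the variation is controlled only locally uniformly, orbits are infinite, and the
    splitting is not known to be continuous across orbits. What is uniform in [x] is the bound in
    the flow direction, measured in the frame at [x]. Hence the estimates that must hold on whole
    orbits use the norm of the moving frame, not a fixed norm of [V], and the perturbed splitting is
    built on all orbits at once from fields that are merely continuous along orbits. The diagonal
    blocks of the variation need not decay and cannot be integrated. The unknown [Z] therefore
    conjugates the perturbed flow not to the old one but to a block diagonal one, for which
    domination has to be reproved, with half the rate. The fixed points, [triv] and the splitting
    are chosen separately for each [t], without any regularity in [t]. Differentiability at 0 comes
    from estimates instead: a remainder of order [t ^+ 2] for [Z], and convergence of the difference
    quotients on bounded orbit segments combined with the decay of the tails. *)

Lemma invmx_mulmx n (A B : 'M[R]_n) : A \in unitmx -> B \in unitmx ->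
  invmx (A *m B) = invmx B *m invmx A.
Proof.
move=> Au Bu; have ABu : A *m B \in unitmx by rewrite unitmx_mul Au.
by rewrite -[RHS](mulmxK ABu) !mulmxA mulmxKV// mulVmx// mul1mx.
Qed.

Lemma entry_le_norm m n (A : 'M[R]_(m, n)) i j : `|A i j| <= `|A|.
Proof.
rewrite [leRHS]/Num.Def.normr/= mx_normrE.
exact: (le_bigmax _ (fun ij => `|A ij.1 ij.2|) (i, j)).
Qed.

Lemma mx_norm_le m n (A : 'M[R]_(m, n)) (c : R) :
  0 <= c -> (forall i j, `|A i j| <= c) -> `|A| <= c.
Proof.
move=> c0 Ac; rewrite [leLHS]/Num.Def.normr/= mx_normrE.
by apply: bigmax_le => // -[i j] _ /=.
Qed.

Lemma mx_norm_mul m n p (A : 'M[R]_(m, n)) (B : 'M[R]_(n, p)) :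
  `|A *m B| <= n%:R * `|A| * `|B|.
Proof.
apply: mx_norm_le => [|i j]; first by rewrite !mulr_ge0.
rewrite mxE (le_trans (ler_norm_sum _ _ _))//.
apply: (@le_trans _ _ (\sum_(k < n) `|A| * `|B|)).
  by apply: ler_sum => k _; rewrite normrM ler_pM// entry_le_norm.
by rewrite sumr_const card_ord -mulrA mulr_natl.
Qed.

Lemma mx_norm1 n : `|1%:M : 'M[R]_n| <= 1.
Proof.
apply: mx_norm_le => // i j; rewrite mxE.
by case: (i == j) => /=; rewrite ?normr1 ?normr0.
Qed.

Lemma is_derive_mxP m n (F : R -> 'M[R]_(m, n)) (s : R) (D : 'M[R]_(m, n)) :
  is_derive (s : R) (1 : R) F D <-> forall i j, is_derive (s : R) (1 : R) (fun t => F t i j) (D i j).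
Proof.
split=> [FD i j|FD].
- have F' := @ex_derive _ _ _ _ _ _ _ FD.
  apply: DeriveDef; first by move/derivable_mxP: F'.
  have := derive_mx F'; rewrite (@derive_val _ _ _ _ _ _ _ FD) => ->.
  by rewrite mxE.
- have F' : derivable F s (1 : R).
    by apply/derivable_mxP => i j; exact: (@ex_derive _ _ _ _ _ _ _ (FD i j)).
  apply: DeriveDef => //; rewrite derive_mx//.
  by apply/matrixP => i j; rewrite mxE; exact: derive_val.
Qed.

Lemma is_derive_cstfun (V : normedModType R) (c : V) (s : R) :
  is_derive s (1 : R) (fun=> c) 0.
Proof. exact: (is_derive_cst c s (1 : R)). Qed.

Lemma is_derive_addfun (V : normedModType R) (F G : R -> V) (s : R) (f g : V) :
  is_derive s (1 : R) F f -> is_derive s (1 : R) G g ->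
  is_derive s (1 : R) (fun t => F t + G t) (f + g).
Proof. by move=> Ff Gg; exact: (is_deriveD Ff Gg). Qed.

Lemma is_derive_subfun (V : normedModType R) (F G : R -> V) (s : R) (f g : V) :
  is_derive s (1 : R) F f -> is_derive s (1 : R) G g ->
  is_derive s (1 : R) (fun t => F t - G t) (f - g).
Proof. by move=> Ff Gg; exact: (is_deriveB Ff Gg). Qed.

Lemma is_derive_addc (V : normedModType R) (F : R -> V) (c : V) (s : R) (f : V) :
  is_derive s (1 : R) F f -> is_derive s (1 : R) (fun t => F t + c) f.
Proof.
move=> Ff; refine (is_derive_eq (is_derive_addfun Ff (is_derive_cstfun c s)) _).
by rewrite addr0.
Qed.

Lemma is_derive_scalefun (V : normedModType R) (a : R) (F : R -> V) (s : R) (f : V) :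
  is_derive s (1 : R) F f -> is_derive s (1 : R) (fun t => a *: F t) (a *: f).
Proof. by move=> Ff; exact: (is_deriveZ a Ff). Qed.

Lemma is_derive_sumfun (V : normedModType R) n (F : 'I_n -> R -> V) (s : R) (f : 'I_n -> V) :
  (forall k, is_derive s (1 : R) (F k) (f k)) ->
  is_derive s (1 : R) (fun t => \sum_(k < n) F k t) (\sum_(k < n) f k).
Proof.
move=> Ff; have := is_derive_sum Ff.
by rewrite [X in is_derive _ _ X _](_ : _ = fun t => \sum_(k < n) F k t)// -fct_sumE.
Qed.

Lemma is_derive_mulfun (F G : R -> R) (s f g : R) :
  is_derive s (1 : R) F f -> is_derive s (1 : R) G g ->
  is_derive s (1 : R) (fun t => F t * G t) (f * G s + F s * g).
Proof.
move=> Ff Gg; refine (is_derive_eq (is_deriveM Ff Gg) _).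
by rewrite addrC -[X in X + _]/(G s * f) mulrC.
Qed.

Lemma is_derive_mxtrace n (F : R -> 'M[R]_n) (s : R) f :
  is_derive s (1 : R) F f -> is_derive s (1 : R) (fun t => \tr (F t)) (\tr f).
Proof. by move=> /is_derive_mxP Ff; apply: is_derive_sumfun => k; exact: Ff. Qed.

Lemma cvg_mxP (T : Type) (FF : set_system T) {FFilter : Filter FF} m n (F : T -> 'M[R]_(m, n))
    (A : 'M[R]_(m, n)) :
  F x @[x --> FF] --> A <-> forall i j, F x i j @[x --> FF] --> A i j.
Proof.
split=> [FA i j|FA].
  apply/cvgrPdist_le => e e0; move/cvgrPdist_le : FA => /(_ e e0).
  apply: filterS => x; apply: le_trans.
  by have := entry_le_norm (A - F x) i j; rewrite !mxE.
apply/cvgrPdist_le => e e0.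
have : \forall x \near FF, forall ij : 'I_m * 'I_n, `|A ij.1 ij.2 - F x ij.1 ij.2| <= e.
  by apply: filter_forall => -[i j] /=; move/cvgrPdist_le: (FA i j); exact.
apply: filterS => x Ax; apply: mx_norm_le; first exact: ltW.
by move=> i j; have := Ax (i, j); rewrite !mxE.
Qed.

Lemma continuous_mxP (T : topologicalType) m n (F : T -> 'M[R]_(m, n)) :
  continuous F <-> forall i j, continuous (fun x => F x i j).
Proof.
split=> [FC i j x|FC x]; first by move/cvg_mxP: (FC x); exact.
by apply/cvg_mxP => i j; exact: FC.
Qed.

Lemma is_derive_continuous (V : normedModType R) (F f : R -> V) :
  (forall s, is_derive (s : R) (1 : R) F (f s)) -> continuous F.
Proof.
move=> Ff s; apply/differentiable_continuous/derivable1_diffP.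
exact: (@ex_derive _ _ _ _ _ _ _ (Ff s)).
Qed.

Lemma is_derive_at_cvg (V : normedModType R) (F : R -> V) s f :
  is_derive (s : R) (1 : R) F f -> F x @[x --> s] --> F s.
Proof.
move=> Ff; apply/differentiable_continuous/derivable1_diffP.
exact: (@ex_derive _ _ _ _ _ _ _ Ff).
Qed.

Lemma cvg_mulmx (T : Type) (FF : set_system T) {FFilter : Filter FF} m n p
    (F : T -> 'M[R]_(m, n)) (G : T -> 'M[R]_(n, p)) (A : 'M[R]_(m, n)) (B : 'M[R]_(n, p)) :
  F x @[x --> FF] --> A -> G x @[x --> FF] --> B ->
  F x *m G x @[x --> FF] --> A *m B.
Proof.
move=> /cvg_mxP FA /cvg_mxP GB; apply/cvg_mxP => i j.
under eq_fun do rewrite mxE; rewrite mxE.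
by apply: cvg_big => [|k _]; [exact: add_continuous|exact: cvgM].
Qed.

Lemma cvg_det (T : Type) (FF : set_system T) {FFilter : Filter FF} n
    (F : T -> 'M[R]_n) (A : 'M[R]_n) : F x @[x --> FF] --> A -> \det (F x) @[x --> FF] --> \det A.
Proof.
move=> /cvg_mxP FA; rewrite /determinant.
apply: cvg_big => [|s _]; first exact: add_continuous.
apply: cvgM; first exact: cvg_cst.
by apply: cvg_big => [|i _]; [exact: mul_continuous|exact: FA].
Qed.

Lemma cvg_mxtrace (T : Type) (FF : set_system T) {FFilter : Filter FF} n
    (F : T -> 'M[R]_n) (A : 'M[R]_n) :
  F x @[x --> FF] --> A -> \tr (F x) @[x --> FF] --> \tr A.
Proof.
move=> /cvg_mxP FA; rewrite /mxtrace.
by apply: cvg_big => [|i _]; [exact: add_continuous|exact: FA].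
Qed.

(** By Cramer's rule: the adjugate is polynomial in the entries and the determinant has a nonzero
    limit. *)
Lemma cvg_invmx (T : Type) (FF : set_system T) {FFilter : Filter FF} n
    (F : T -> 'M[R]_n) (A : 'M[R]_n) : (forall x, F x \in unitmx) -> A \in unitmx ->
  F x @[x --> FF] --> A -> invmx (F x) @[x --> FF] --> invmx A.
Proof.
move=> Fu Au FA; rewrite /invmx Au; under eq_fun do rewrite Fu.
have detA0 : \det A != 0 by rewrite -unitfE -unitmxE.
have dF : \det (F x) @[x --> FF] --> \det A by exact: cvg_det.
apply: cvgZ; first exact: (cvgV detA0 dF).
apply/cvg_mxP => i j; rewrite mxE; under eq_fun do rewrite mxE.
rewrite /cofactor; apply: cvgM; first exact: cvg_cst.
apply: cvg_det; apply/cvg_mxP => k l; rewrite !mxE; under eq_fun do rewrite !mxE.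
by move/cvg_mxP: FA; exact.
Qed.

Lemma is_derive_mulmx m n p (F : R -> 'M[R]_(m, n)) (G : R -> 'M[R]_(n, p)) s f g :
  is_derive (s : R) (1 : R) F f -> is_derive (s : R) (1 : R) G g ->
  is_derive (s : R) (1 : R) (fun t => F t *m G t) (f *m G s + F s *m g).
Proof.
move=> /is_derive_mxP Ff /is_derive_mxP Gg; apply/is_derive_mxP => i j.
rewrite !mxE -big_split /=; under eq_fun do rewrite mxE.
by apply: is_derive_sumfun => k; exact: is_derive_mulfun.
Qed.

Lemma is_derive_mulmxl m n p (A : 'M[R]_(m, n)) (G : R -> 'M[R]_(n, p)) s g :
  is_derive (s : R) (1 : R) G g -> is_derive (s : R) (1 : R) (fun t => A *m G t) (A *m g).
Proof.
move=> Gg; refine (is_derive_eq (is_derive_mulmx (is_derive_cst A s (1 : R)) Gg) _).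
by rewrite mul0mx add0r.
Qed.

Lemma is_derive_mulmxr m n p (F : R -> 'M[R]_(m, n)) (A : 'M[R]_(n, p)) s f :
  is_derive (s : R) (1 : R) F f -> is_derive (s : R) (1 : R) (fun t => F t *m A) (f *m A).
Proof.
move=> Ff; refine (is_derive_eq (is_derive_mulmx Ff (is_derive_cst A s (1 : R))) _).
by rewrite mulmx0 addr0.
Qed.

Lemma is_deriveP (V : normedModType R) (F : R -> V) s f :
  is_derive (s : R) (1 : R) F f <-> (h^-1 *: (F (h + s) - F s)) @[h --> (0 : R)^'] --> f.
Proof.
split=> [Ff|Ff].
  have := @ex_derive _ _ _ _ _ _ _ Ff; rewrite /derivable.
  have := @derive_val _ _ _ _ _ _ _ Ff; rewrite /derive => <-.
  by under eq_fun do rewrite scaler1.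
have Ff' : (h^-1 *: (F (h *: (1:R) + s) - F s)) @[h --> (0 : R)^'] --> f.
  by under eq_fun do rewrite scaler1.
apply: DeriveDef; first by apply/cvg_ex; exists f.
exact: cvg_lim.
Qed.

(** The resolvent identity turns the difference quotient of the inverse into a product of convergent
    factors. *)
Lemma is_derive_invmx n (F : R -> 'M[R]_n) s f :
  (forall t, F t \in unitmx) -> is_derive (s : R) (1 : R) F f ->
  is_derive (s : R) (1 : R) (fun t => invmx (F t)) (- (invmx (F s) *m f *m invmx (F s))).
Proof.
move=> Fu Ff; apply/is_deriveP.
have FC : F (h + s) @[h --> (0 : R)^'] --> F s.
  have := is_derive_at_cvg Ff => /cvgrPdist_lt Fs.
  apply/cvgrPdist_lt => e /Fs /nbhs0P; rewrite near_withinE => H.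
  by move: H; apply: filterS => x H _; rewrite (addrC x).
have -> : (fun h => h^-1 *: (invmx (F (h + s)) - invmx (F s))) =
  (fun h => - (invmx (F (h + s)) *m (h^-1 *: (F (h + s) - F s)) *m invmx (F s))).
  apply/funext => h; rewrite -scalemxAr -scalemxAl -scalerN; congr (_ *: _).
  by rewrite mulmxBr mulmxBl mulVmx// mul1mx mulmxK// opprB.
apply: cvgN; apply: cvg_mulmx; last exact: cvg_cst.
apply: cvg_mulmx; first exact: cvg_invmx.
by move/is_deriveP: Ff.
Unshelve. all: by end_near. Qed.

(** Monotonicity of [G - F] and of [G + F]. A variable majorant [g], rather than a constant, allows
    exponential bounds to be integrated later. *)
Lemma ler_derive_norm (F f G g : R -> R) (a b : R) : a <= b ->
  (forall s, a <= s <= b -> is_derive (s : R) (1 : R) F (f s)) ->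
  (forall s, a <= s <= b -> is_derive (s : R) (1 : R) G (g s)) ->
  (forall s, a <= s <= b -> `|f s| <= g s) -> `|F b - F a| <= G b - G a.
Proof.
move=> ab Ff Gg fg.
have key (e : R) : `|e| = 1 -> e * (F b - F a) <= G b - G a.
  move=> e1.
  have D s : a <= s <= b -> is_derive (s : R) (1 : R) (G - e *: F) (g s - e * f s).
    by move=> /[dup] /Ff ? /Gg ?; exact: is_deriveB.
  have D' x : x \in `]a, b[ -> is_derive (x : R) (1 : R) (G - e *: F) (g x - e * f x).
    by rewrite in_itv => /andP[ax xb]; apply: D; rewrite !ltW.
  have C : {within `[a, b], continuous (G - e *: F)}.
    apply: derivable_within_continuous => x; rewrite in_itv => xab.
    exact: (@ex_derive _ _ _ _ _ _ _ (D x xab)).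
  have [c cab E] := MVT_segment ab D' C.
  have : 0 <= (G - e *: F) b - (G - e *: F) a.
    rewrite E mulr_ge0 ?subr_ge0// (le_trans (ler_norm _))// normrM e1 mul1r.
    by apply: fg; move: cab; rewrite in_itv.
  by rewrite -![(G - e *: F) _]/(G _ - e * F _); lra.
have := key 1; have := key (-1); rewrite normrN normr1 ler_norml => k1 k2.
by have := k1 erefl; have := k2 erefl; lra.
Qed.

Lemma mx_derive_norm m n (F f : R -> 'M[R]_(m, n)) (G g : R -> R) (a b : R) : a <= b ->
  (forall s, a <= s <= b -> is_derive (s : R) (1 : R) F (f s)) ->
  (forall s, a <= s <= b -> is_derive (s : R) (1 : R) G (g s)) ->
  (forall s, a <= s <= b -> `|f s| <= g s) -> `|F b - F a| <= G b - G a.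
Proof.
move=> ab Ff Gg fg; apply: mx_norm_le => [|i j].
  have := @ler_derive_norm (cst 0) (fun=> 0) G g a b ab
    (fun s _ => is_derive_cst 0 s 1) Gg.
  by rewrite /cst !subrr !normr0; apply=> s /fg; apply: le_trans.
rewrite !mxE; apply: (@ler_derive_norm (fun s => F s i j) (fun s => f s i j) G g) => //.
  by move=> s /Ff /is_derive_mxP.
by move=> s /fg; apply: le_trans; exact: entry_le_norm.
Qed.

Lemma derive0_cst m n (F : R -> 'M[R]_(m, n)) :
  (forall s, is_derive (s : R) (1 : R) F 0) -> forall a b, F a = F b.
Proof.
move=> F0; have key a b : a <= b -> F a = F b.
  move=> ab; apply/eqP; rewrite eq_sym -subr_eq0 -normr_le0.
  have := @mx_derive_norm m n F (fun=> 0) (cst 0) (fun=> 0) a b ab (fun s _ => F0 s)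
    (fun s _ => is_derive_cst 0 s 1).
  by rewrite /cst !subrr normr0; apply.
by move=> a b; have [/key//|/ltW/key] := leP a b.
Qed.

End MatrixCalculus.

(** * Exponentially decaying integrals *)

Section Integrals.
Variable R : realType.
Notation mu := lebesgue_measure.

Lemma antiderivative_right (f : R -> R) (a : R) : continuous f ->
  let F x := \int[mu]_(t in `[a, x]) f t in
  forall x, a < x -> is_derive (x : R) (1 : R) F (f x).
Proof.
move=> fC F x ax.
have fi : mu.-integrable `[a, x + 1] (EFin \o f).
  apply: continuous_compact_integrable; first exact: segment_compact.
  exact: continuous_subspaceT.
have xx : x < x + 1 by rewrite ltrDl.
have [dF <-] := continuous_FTC1_closed xx fi ax (fC x).
apply: DeriveDef; first exact: dF.
by rewrite derive1E.
Qed.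

(** The integral from [a] is known to have derivative [f] only beyond [a], so the lower bound is
    moved to the left with the argument; increments do not depend on it ([HB']). *)
Lemma antiderivative (f : R -> R) : continuous f ->
  exists F : R -> R, F 0 = 0 /\ forall x, is_derive (x : R) (1 : R) F (f x).
Proof.
move=> fC.
pose H a x := \int[mu]_(t in `[a, x]) f t.
have HD a x : a < x -> is_derive (x : R) (1 : R) (H a) (f x).
  by move=> ax; exact: (@antiderivative_right f a fC).
have HB a b x y : a <= b -> b < x -> x <= y -> H a y - H a x = H b y - H b x.
  move=> ab bx xy; apply/eqP; rewrite -subr_eq0 -normr_le0.
  have -> : H a y - H a x - (H b y - H b x) = (H a - H b) y - (H a - H b) x.
    by rewrite -![(H a - H b) _]/(H a _ - H b _); ring.
  have -> : 0 = (cst 0 : R -> R) y - (cst 0 : R -> R) x by rewrite /cst subrr.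
  apply: (@ler_derive_norm _ _ (fun=> 0) _ (fun=> 0)) => // [s /andP[xs _]|s _].
  - rewrite -(subrr (f s)); apply: is_deriveB; apply: HD.
      by rewrite (le_lt_trans ab)// (lt_le_trans bx).
    by rewrite (lt_le_trans bx).
  - by rewrite normr0.
have HB' a b x y : a <= b -> b < x -> b < y -> H a y - H a x = H b y - H b x.
  move=> ab bx by_; have [xy|/ltW yx] := leP x y; first exact: HB.
  by have := HB a b y x ab by_ yx; lra.
pose F x := H (- `|x| - 1) x - H (- `|x| - 1) 0.
have b0 (x : R) : - `|x| - 1 < 0 by have := normr_ge0 x; lra.
have bx (x : R) : - `|x| - 1 < x by have := ler_norm (- x); rewrite normrN; lra.
exists F; split; first by rewrite /F subrr.
(* For [y] within 1 of [x] the moving bound -|y| - 1 stays above -|x| - 3, so near [x] it can be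
   frozen at this value. *)
move=> x; pose a := - `|x| - 3.
have ax : a < x by have := bx x; rewrite /a; lra.
have a0 : a < 0 by have := normr_ge0 x; rewrite /a; lra.
apply: (@near_eq_is_derive _ _ _ (fun y => H a y - H a 0)).
  near=> y; rewrite /F; apply: HB' => //.
  have : `|x - y| < 1 by near: y; exact: (nbhsx_ballx x (1 : R) ltr01).
  by have := ler_distD x y 0; rewrite !subr0 distrC /a; lra.
by apply: is_derive_addc; exact: HD.
Unshelve. all: by end_near. Qed.

Definition iint (g : R -> R) : R := \int[mu]_(s in `[0, +oo[) g s.

Definition mint m n (f : R -> 'M[R]_(m, n)) : 'M[R]_(m, n) :=
  \matrix_(i, j) iint (fun s => f s i j).

Lemma is_derive_expRM (a x : R) :
  is_derive x (1 : R) (fun s => expR (a * s)) (a * expR (a * x)).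
Proof.
have D : is_derive x (1 : R) (fun s => a * s) a.
  by refine (is_derive_eq (is_deriveZ a (is_derive_id x (1:R))) _); rewrite scaler1.
have := is_derive1_comp (is_derive_expR (a * x)) D.
by move=> E; refine (is_derive_eq E _); rewrite mulrC.
Qed.

Lemma cvg_expRN (b : R) : 0 < b -> expR (- b * s) @[s --> +oo] --> (0 : R).
Proof.
move=> b0; under eq_fun do rewrite mulNr.
have by_ : b * s @[s --> +oo] --> +oo by apply: gt0_cvgMry => //; exact: cvg_id.
exact: (cvg_comp _ (fun z => expR (- z)) by_ (@cvgr_expR R)).
Qed.

Lemma nondecreasing_cvg_pinfty (F : R -> R) (M : R) :
  (forall x y, 0 <= x -> x <= y -> F x <= F y) -> (forall x, 0 <= x -> F x <= M) ->
  exists l : R, F x @[x --> +oo] --> l.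
Proof.
move=> Fnd FM; pose G x := F (Num.max 0 x).
have Gnd : nondecreasing_fun G.
  by move=> x y xy; apply: Fnd; rewrite ?ge_max !le_max ?lexx ?xy ?orbT.
have Gub : has_ubound (range G).
  by exists M => _ [x _ <-]; apply: FM; rewrite le_max lexx.
exists (sup (range G)); have := nondecreasing_cvgr Gnd Gub.
apply: cvg_trans; apply: near_eq_cvg; near=> x.
by rewrite /G max_r//; near: x; exact: nbhs_pinfty_ge.
Unshelve. all: by end_near. Qed.

Lemma iint_ge0 (g F : R -> R) (l : R) : continuous g ->
  (forall s, 0 <= s -> 0 <= g s) -> (forall s, is_derive (s : R) (1 : R) F (g s)) ->
  F T @[T --> +oo] --> l ->
  mu.-integrable `[0, +oo[ (EFin \o g) /\ iint g = l - F 0.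
Proof.
move=> gC g0 Fg Fl.
have gW : {within `[0, +oo[, continuous g} by exact: continuous_subspaceT.
have dF s : 0 < s -> derivable F s 1 by move=> _; exact: (@ex_derive _ _ _ _ _ _ _ (Fg s)).
have F0 : F x @[x --> 0^'+] --> F 0.
  by apply: cvg_at_right_filter; exact: is_derive_continuous.
have FE : {in `]0, +oo[, (F^`())%classic =1 g}.
  by move=> s _; rewrite derive1E; exact: (@derive_val _ _ _ _ _ _ _ (Fg s)).
have E := ge0_continuous_FTC2y g0 gW Fl dF F0 FE.
split; last by rewrite /iint /Rintegral E.
apply/integrableP; split.
  by apply/measurable_EFinP; apply: measurable_funTS; exact: continuous_measurable_fun.
under eq_integral => s.
  rewrite inE /= in_itv /= andbT => s0.
  rewrite ger0_norm ?g0//.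
  over.
by rewrite E ltry.
Qed.

Lemma is_derive_expRN (b x : R) : b != 0 ->
  is_derive x (1 : R) (fun s => - b^-1 * expR (- b * s)) (expR (- b * x)).
Proof.
move=> b0; refine (is_derive_eq (is_deriveZ (- b^-1) (is_derive_expRM (- b) x)) _).
by rewrite -[LHS]/(- b^-1 * (- b * expR (- b * x))) mulrA mulrNN mulVf// mul1r.
Qed.

(** The sum of [g] and its exponential majorant is nonnegative, so its primitive is nondecreasing;
    being bounded, it converges. Subtracting the majorant, whose integral is explicit, yields the
    statement for [g]. *)
Lemma iint_cvg (g F : R -> R) (b C : R) : 0 < b -> continuous g ->
  (forall s, 0 <= s -> `|g s| <= C * expR (- b * s)) ->
  (forall s, is_derive (s : R) (1 : R) F (g s)) ->
  [/\ mu.-integrable `[0, +oo[ (EFin \o g) & F T @[T --> +oo] --> F 0 + iint g].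
Proof.
move=> b0 gC gb Fg.
pose e s := C * expR (- b * s).
pose E s := C * (- b^-1 * expR (- b * s)).
have ED s : is_derive (s : R) (1 : R) E (e s).
  by apply: is_deriveZ; apply: is_derive_expRN; exact: lt0r_neq0.
have C0 : 0 <= C.
  by have := gb 0 (lexx _); rewrite mulr0 expR0 mulr1; exact: le_trans.
have e0 s : 0 <= s -> 0 <= e s by move=> _; rewrite mulr_ge0// expR_ge0.
have eC : continuous e.
  by apply: (@is_derive_continuous _ _ _ (fun s => C * (- b * expR (- b * s)))) => s; exact: (is_deriveZ C (is_derive_expRM (- b) s)).
have El : E T @[T --> +oo] --> (0 : R).
  rewrite -(mulr0 C); apply: cvgM; first exact: cvg_cst.
  by rewrite -(mulr0 (- b^-1)); apply: cvgM; [exact: cvg_cst|exact: cvg_expRN].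
have [ei eE] := iint_ge0 eC e0 ED El.
have hC : continuous (g \+ e) by move=> s; apply: cvgD; [exact: gC|exact: eC].
have h0 s : 0 <= s -> 0 <= (g \+ e) s.
  by move=> /gb; rewrite /= -/(e s) ler_norml => /andP[]; lra.
have hD s : is_derive (s : R) (1 : R) (F + E) ((g \+ e) s) by exact: is_deriveD.
have [l hl] : exists l : R, (F + E) x @[x --> +oo] --> l.
  (* As [E] is nonpositive, F x + E x <= F 0 - E 0 + 2 E x <= F 0 - E 0, which is the bound given
     here. *)
  apply: (@nondecreasing_cvg_pinfty _ ((F + E) 0 - 2 * E 0)) => [x y x0 xy|x x0].
    rewrite -subr_ge0; have := @ler_derive_norm _ (cst 0) (fun=> 0) (F + E) (g \+ e) x y xy
      (fun s _ => is_derive_cst 0 s 1) (fun s _ => hD s).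
    rewrite /cst subrr !normr0; apply=> s /andP[xs _]; apply: h0.
    exact: le_trans xs.
  have := @ler_derive_norm _ F g E e 0 x x0 (fun s _ => Fg s) (fun s _ => ED s).
  have Ex : E x <= 0.
    by rewrite /E mulrA mulrN !mulNr oppr_le0 mulr_ge0 ?expR_ge0// divr_ge0// ltW.
  move/(_ (fun s xs => gb s (proj1 (andP xs)))).
  rewrite ler_norml => /andP[_]; rewrite -![(F + E) _]/(F _ + E _); lra.
have [hi hE] := iint_ge0 hC h0 hD hl.
have mI : measurable (`[0, +oo[%classic : set R) by exact: measurable_itv.
have gE : g = (g \+ e) \- e by apply/funext => s /=; rewrite addrK.
have gI : iint g = l - (F + E) 0 + E 0.
  rewrite {1}gE /iint RintegralB//.
  by rewrite -/(iint _) hE -/(iint e) eE sub0r opprK.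
split.
  by rewrite gE; exact: (@integrableB _ _ _ mu _ mI (EFin \o (g \+ e)) (EFin \o e) hi ei).
rewrite gI -![(F + E) _]/(F _ + E _).
rewrite (_ : F 0 + _ = l - 0); last by ring.
have FE : (fun x => (F + E) x - E x) = F.
  by apply/funext => x; rewrite -![(F + E) _]/(F _ + E _) addrK.
by rewrite -[X in X @ _]FE; exact: cvgB.
Qed.

Definition expdec m n (b C : R) (f : R -> 'M[R]_(m, n)) :=
  continuous f /\ forall s, 0 <= s -> `|f s| <= C * expR (- b * s).

Lemma mint_cvg m n (f F : R -> 'M[R]_(m, n)) (b C : R) : 0 < b -> expdec b C f ->
  (forall s, is_derive (s : R) (1 : R) F (f s)) ->
  F T @[T --> +oo] --> F 0 + mint f.
Proof.
move=> b0 [fC fb] Ff; apply/cvg_mxP => i j; rewrite !mxE.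
have [] // := @iint_cvg (fun s => f s i j) (fun s => F s i j) b C b0.
- by move/continuous_mxP: fC.
- by move=> s /fb; apply: le_trans; exact: entry_le_norm.
- by move=> s; have /is_derive_mxP := Ff s.
Qed.

Lemma mx_antiderivative m n (f : R -> 'M[R]_(m, n)) : continuous f ->
  exists F : R -> 'M[R]_(m, n), F 0 = 0 /\ forall s, is_derive (s : R) (1 : R) F (f s).
Proof.
move=> /continuous_mxP fC.
have /choice [F FP] (ij : 'I_m * 'I_n) := antiderivative (fC ij.1 ij.2).
exists (fun s => \matrix_(i, j) F (i, j) s); split.
  by apply/matrixP => i j; rewrite !mxE; have [] := FP (i, j).
move=> s; apply/is_derive_mxP => i j; under eq_fun do rewrite mxE.
by have [_] := FP (i, j).
Qed.

Lemma mint_unique m n (f F : R -> 'M[R]_(m, n)) (b C : R) (l : 'M[R]_(m, n)) : 0 < b -> expdec b C f ->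
  (forall s, is_derive (s : R) (1 : R) F (f s)) ->
  F T @[T --> +oo] --> l -> mint f = l - F 0.
Proof.
move=> b0 fb Ff Fl; have Fm := mint_cvg b0 fb Ff.
by rewrite (cvg_unique _ Fl Fm)// addrAC subrr add0r.
Qed.

Lemma iint_unique (g F : R -> R) (b C l : R) : 0 < b -> continuous g ->
  (forall s, 0 <= s -> `|g s| <= C * expR (- b * s)) ->
  (forall s, is_derive (s : R) (1 : R) F (g s)) ->
  F T @[T --> +oo] --> l -> iint g = l - F 0.
Proof.
move=> b0 gC gb Fg Fl; have [_ Fm] := iint_cvg b0 gC gb Fg.
by rewrite (cvg_unique _ Fl Fm)// addrAC subrr add0r.
Qed.

Lemma expdec_sandwich m n p q (A : 'M[R]_(p, m)) (B : 'M[R]_(n, q))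
    (f : R -> 'M[R]_(m, n)) (b C : R) : expdec b C f ->
  expdec b (m%:R * `|A| * n%:R * `|B| * C) (fun s => A *m f s *m B).
Proof.
move=> [fC fb]; split=> [s|s /fb fs].
  apply: cvg_mulmx; last exact: cvg_cst.
  by apply: cvg_mulmx; [exact: cvg_cst|exact: fC].
apply: le_trans (mx_norm_mul _ _) _.
rewrite -!mulrA [leRHS](_ : _ = n%:R * ((m%:R * `|A| * (C * expR (- b * s))) * `|B|)); last by ring.
rewrite ler_wpM2l//ler_wpM2r//.
by apply: le_trans (mx_norm_mul _ _) _; rewrite ler_wpM2l// mulr_ge0.
Qed.

Lemma mint_sandwich m n p q (A : 'M[R]_(p, m)) (B : 'M[R]_(n, q))
    (f : R -> 'M[R]_(m, n)) (b C : R) : 0 < b -> expdec b C f ->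
  mint (fun s => A *m f s *m B) = A *m mint f *m B.
Proof.
move=> b0 fb; have [F [F0 Ff]] := mx_antiderivative (proj1 fb).
have -> : A *m mint f *m B = A *m (F 0 + mint f) *m B - A *m F 0 *m B.
  by rewrite mulmxDr mulmxDl addrAC subrr add0r.
apply: (@mint_unique _ _ _ (fun s => A *m F s *m B) _ _ _ b0 (expdec_sandwich A B fb)).
  by move=> s; apply: is_derive_mulmxr; exact: is_derive_mulmxl.
apply: cvg_mulmx; last exact: cvg_cst.
by apply: cvg_mulmx; [exact: cvg_cst|exact: mint_cvg b0 fb Ff].
Qed.

Lemma mintZ m n (f : R -> 'M[R]_(m, n)) (a b C : R) : 0 < b -> expdec b C f ->
  mint (fun s => a *: f s) = a *: mint f.
Proof.
move=> b0 fb; rewrite -[RHS]mulmx1 -[X in X *m _]mul_scalar_mx -(mint_sandwich _ _ b0 fb).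
by congr mint; apply/funext => s; rewrite mul_scalar_mx mulmx1.
Qed.

Lemma expdecD m n (f g : R -> 'M[R]_(m, n)) (b C C' : R) : expdec b C f -> expdec b C' g ->
  expdec b (C + C') (fun s => f s + g s).
Proof.
move=> [fC fb] [gC gb]; split=> [s|s s0].
  by apply: cvgD; [exact: fC|exact: gC].
by rewrite (le_trans (ler_normD _ _))// mulrDl lerD ?fb ?gb.
Qed.

Lemma mintD m n (f g : R -> 'M[R]_(m, n)) (b C C' : R) : 0 < b ->
  expdec b C f -> expdec b C' g -> mint (fun s => f s + g s) = mint f + mint g.
Proof.
move=> b0 fb gb; have [F [F0 Ff]] := mx_antiderivative (proj1 fb).
have [G [G0 Gg]] := mx_antiderivative (proj1 gb).
rewrite (@mint_unique _ _ _ (fun s => F s + G s) b (C + C')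
  ((F 0 + mint f) + (G 0 + mint g)) b0); first by rewrite F0 G0 !add0r subr0.
- exact: expdecD.
- by apply: cvgD; [exact: mint_cvg b0 fb Ff|exact: mint_cvg b0 gb Gg].
Qed.

Lemma mint_norm m n (f : R -> 'M[R]_(m, n)) (b C : R) : 0 < b -> expdec b C f ->
  `|mint f| <= C / b.
Proof.
move=> b0 fb; have [F [F0 Ff]] := mx_antiderivative (proj1 fb).
have C0 : 0 <= C.
  by have := proj2 fb 0 (lexx _); rewrite mulr0 expR0 mulr1; exact: le_trans.
have := mint_cvg b0 fb Ff; rewrite F0 add0r => Fl.
have {}Fl : `|F T| @[T --> +oo] --> `|mint f| by exact: cvg_norm.
apply: (closed_cvg (fun y => y <= C / b)) Fl; first exact: closed_le.
near=> T; have T0 : 0 <= T by near: T; exact: nbhs_pinfty_ge.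
have := @mx_derive_norm _ _ _ F f (fun s => C *: (- b^-1 * expR (- b * s)))
  (fun s => C * expR (- b * s)) 0 T T0 (fun s _ => Ff s).
rewrite F0 subr0 => /(_ (fun s _ => is_derive_scalefun C (is_derive_expRN s (lt0r_neq0 b0)))).
move=> /(_ (fun s sT => proj2 fb s (proj1 (andP sT)))) /le_trans; apply.
rewrite mulr0 expR0 mulr1 -scalerBr -[leLHS]/(C * _) ler_wpM2l//.
by rewrite opprK mulNr addrC gerBl mulr_ge0 ?expR_ge0// invr_ge0 ltW.
Unshelve. all: by end_near. Qed.

(** The integral of the translate by [r] is the tail of the integral of [f] beyond [r], that is
    [mint f - F r] for a primitive [F] vanishing at 0. The decay constant may depend on the
    translation, as [r] can be very negative. *)
Lemma mint_shift_derive m n (f : R -> 'M[R]_(m, n)) (b : R) r : 0 < b ->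
  (forall r, exists C, expdec b C (fun s => f (s + r))) ->
  is_derive (r : R) (1 : R) (fun r => mint (fun s => f (s + r))) (- f r).
Proof.
move=> b0 fb.
have f0 : (fun s => f (s + 0)) = f by apply/funext => s; rewrite addr0.
have fC : continuous f by have [C [fC _]] := fb 0; rewrite f0 in fC.
have [F [F0 Ff]] := mx_antiderivative fC.
have [C0 fb0] := fb 0; rewrite f0 in fb0.
have Fl := mint_cvg b0 fb0 Ff; rewrite F0 add0r in Fl.
rewrite (_ : (fun r => _) = (fun r => - F r + mint f)); last first.
  apply/funext => u; have [C fbu] := fb u.
  have DFu s : is_derive s (1 : R) (fun s => F (s + u)) (f (s + u)).
    have := Ff (s + u) => /is_deriveP H; apply/is_deriveP.
    by under eq_fun do rewrite -addrA.
  have su : s + u @[s --> +oo] --> +oo.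
    by apply/cvgryPge => A; near=> s; rewrite -lerBlDr; near: s; apply: nbhs_pinfty_ge; exact: num_real.
  by rewrite (mint_unique b0 fbu DFu (cvg_comp _ F su Fl)) add0r addrC.
by apply: is_derive_addc; exact: (is_deriveN (Ff r)).
Unshelve. all: by end_near. Qed.

Lemma iint_trace m n (f : R -> 'M[R]_(m, n)) (A : 'M[R]_(n, m)) (b C : R) : 0 < b ->
  expdec b C f -> iint (fun s => \tr (A *m f s)) = \tr (A *m mint f).
Proof.
move=> b0 fb; have [F [F0 Ff]] := mx_antiderivative (proj1 fb).
have trN (M : 'M[R]_n) : `|\tr M| <= n%:R * `|M|.
  rewrite (le_trans (ler_norm_sum _ _ _))//.
  apply: (@le_trans _ _ (\sum_(i < n) `|M|)); last by rewrite sumr_const card_ord mulr_natl.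
  by apply: ler_sum => i _; exact: entry_le_norm.
have -> : \tr (A *m mint f) = \tr (A *m mint f) - \tr (A *m F 0).
  by rewrite F0 mulmx0 mxtrace0 subr0.
apply: (@iint_unique _ (fun s => \tr (A *m F s)) b (n%:R * (m%:R * `|A| * C)) (\tr (A *m mint f)) b0).
- by move=> s; apply: cvg_mxtrace; apply: cvg_mulmx; [exact: cvg_cst|exact: (proj1 fb)].
- move=> s s0; apply: (le_trans (trN _)); rewrite -!mulrA ler_wpM2l//.
  apply: le_trans (mx_norm_mul _ _) _; rewrite -mulrA !ler_wpM2l//.
  exact: (proj2 fb).
- by move=> s; exact: is_derive_mxtrace (is_derive_mulmxl A (Ff s)).
- apply: cvg_mxtrace; apply: cvg_mulmx; first exact: cvg_cst.
  by have := mint_cvg b0 fb Ff; rewrite F0 add0r.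
Qed.

Lemma iintN_ge0 (g F : R -> R) (l : R) : continuous g ->
  (forall s, s <= 0 -> 0 <= g s) -> (forall s, is_derive (s : R) (1 : R) F (g (- s))) ->
  F T @[T --> +oo] --> l ->
  mu.-integrable `]-oo, 0] (EFin \o g) /\
  \int[mu]_(s in `]-oo, 0]) g s = iint (g \o -%R).
Proof.
move=> gC g0 Fg Fl.
have gNC : continuous (g \o -%R).
  by move=> s; apply: continuous_comp; [exact: oppr_continuous|exact: gC].
have gN0 s : 0 <= s -> 0 <= (g \o -%R) s by move=> s0; apply: g0; rewrite oppr_le0.
have [gi gE] := iint_ge0 gNC gN0 Fg Fl.
have E : (\int[mu]_(s in `]-oo, 0%R]) (g s)%:E =
    \int[mu]_(s in `[0%R, +oo[) ((g \o (@GRing.opp R)) s)%:E)%E.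
  have := @ge0_integration_by_substitutionNy R g 0; rewrite oppr0; apply.
    exact: continuous_subspaceT.
  by move=> s; rewrite in_itv /= => s0; apply: g0; exact: ltW.
split; last by rewrite /iint /Rintegral E.
apply/integrableP; split.
  by apply/measurable_EFinP; apply: measurable_funTS; exact: continuous_measurable_fun.
under eq_integral => s.
  rewrite inE /= in_itv /= => s0.
  rewrite ger0_norm ?g0//.
  over.
rewrite E; have /integrableP[_] := gi; apply: le_lt_trans.
rewrite le_eqVlt; apply/orP; left; apply/eqP; apply: eq_integral => s.
by rewrite inE /= in_itv /= andbT => s0; rewrite ger0_norm//; exact: gN0.
Qed.

(** The change of variable to [- s] is made for the nonnegative functions [g + e] and [e], with [e]
    the exponential majorant, and the results are subtracted. *)
Lemma iint_opp (g : R -> R) (b C : R) : 0 < b -> continuous g ->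
  (forall s, 0 <= s -> `|g (- s)| <= C * expR (- b * s)) ->
  \int[mu]_(s in `]-oo, 0]) g s = iint (g \o -%R).
Proof.
move=> b0 gC gb.
pose e s := C * expR (b * s).
have NC (k : R -> R) : continuous k -> continuous (k \o -%R).
  by move=> kC s; apply: continuous_comp; [exact: oppr_continuous|exact: kC].
have C0 : 0 <= C.
  by have := gb 0 (lexx _); rewrite mulr0 expR0 mulr1; exact: le_trans.
have e0 s : s <= 0 -> 0 <= e s by move=> _; rewrite mulr_ge0// expR_ge0.
have eC : continuous e.
  by apply: (@is_derive_continuous _ _ _ (fun s => C *: (b * expR (b * s)))) => s; exact: (is_derive_scalefun C (is_derive_expRM b s)).
have hC : continuous (g \+ e) by move=> s; apply: cvgD; [exact: gC|exact: eC].
have gb' s : s <= 0 -> `|g s| <= e s.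
  by move=> s0; have := gb (- s); rewrite opprK oppr_ge0 mulrNN; exact.
have h0 s : s <= 0 -> 0 <= (g \+ e) s.
  by move=> /gb'; rewrite /= ler_norml => /andP[]; lra.
have [E [E0 ED]] := antiderivative (NC _ eC).
have [F [F0 FD]] := antiderivative (NC _ gC).
have eb s : 0 <= s -> `|(e \o -%R) s| <= C * expR (- b * s).
  by move=> s0; rewrite /= ger0_norm /e ?mulrN ?mulNr// mulr_ge0// expR_ge0.
have [eI El] := iint_cvg b0 (NC _ eC) eb ED.
have [gI Fl] := iint_cvg b0 (NC _ gC) gb FD.
have [ei eE] := iintN_ge0 eC e0 ED El.
have hD s : is_derive (s : R) (1 : R) (fun s => F s + E s) ((g \+ e) (- s)) by exact: is_derive_addfun.
have [hi hE] := iintN_ge0 hC h0 hD (cvgD Fl El).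
have mI : measurable (`]-oo, 0]%classic : set R) by exact: measurable_itv.
have gE : g = (g \+ e) \- e by apply/funext => s /=; rewrite addrK.
rewrite [in LHS]gE RintegralB// hE eE.
rewrite /iint -RintegralB//; last first.
  exact: (@integrableD _ _ _ mu _ (measurable_itv _) (EFin \o (g \o -%R)) (EFin \o (e \o -%R)) gI eI).
by apply: eq_Rintegral => s _ /=; rewrite addrK.
Qed.

End Integrals.

(** * Perturbation of block diagonal flows *)

Section FrameNorm.
Variables (R : realType) (d : nat).
Implicit Types M Y Z : 'M[R]_d.

(* The factor [d] makes this rescaled maximum norm submultiplicative. *)
Definition frame_norm M Y : R := locked (d%:R * `|invmx M *m Y *m M|).

Lemma frame_normE M Y : frame_norm M Y = d%:R * `|invmx M *m Y *m M|.
Proof. by rewrite /frame_norm -lock. Qed.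

Lemma frame_norm_ge0 M Y : 0 <= frame_norm M Y.
Proof. by rewrite frame_normE mulr_ge0. Qed.

Lemma conj_le_frame_norm M Y : `|invmx M *m Y *m M| <= frame_norm M Y.
Proof.
rewrite frame_normE; have [d0|d0] := posnP d.
  apply: (@le_trans _ _ 0); last exact: mulr_ge0.
  by apply: mx_norm_le => // i; have := ltn_ord i; rewrite {2}d0.
by rewrite ler_peMl// ler1n.
Qed.

Lemma frame_normD M Y Z : frame_norm M (Y + Z) <= frame_norm M Y + frame_norm M Z.
Proof. by rewrite !frame_normE -mulrDr ler_wpM2l// mulmxDr mulmxDl ler_normD. Qed.

Lemma frame_normN M Y : frame_norm M (- Y) = frame_norm M Y.
Proof. by rewrite !frame_normE mulmxN mulNmx normrN. Qed.

Lemma frame_normB M Y Z : frame_norm M (Y - Z) <= frame_norm M Y + frame_norm M Z.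
Proof. by rewrite -(frame_normN M Z) frame_normD. Qed.

Lemma frame_norm_distC M Y Z : frame_norm M (Y - Z) = frame_norm M (Z - Y).
Proof. by rewrite -frame_normN opprB. Qed.

Lemma frame_normZ M (a : R) Y : frame_norm M (a *: Y) = `|a| * frame_norm M Y.
Proof. by rewrite !frame_normE -scalemxAr -scalemxAl normrZ mulrCA. Qed.

Lemma frame_norm0 M : frame_norm M 0 = 0.
Proof. by rewrite frame_normE mulmx0 mul0mx normr0 mulr0. Qed.

Lemma frame_norm_sum (I : Type) (r : seq I) (P : pred I) M (F : I -> 'M[R]_d) :
  frame_norm M (\sum_(i <- r | P i) F i) <= \sum_(i <- r | P i) frame_norm M (F i).
Proof.
elim/big_rec2 : _ => [|i y1 y2 _ H]; first by rewrite frame_norm0.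
by rewrite (le_trans (frame_normD _ _ _))// lerD2l.
Qed.

Lemma frame_norm1 M : M \in unitmx -> frame_norm M 1%:M <= d%:R.
Proof. by move=> Mu; rewrite frame_normE mulmx1 mulVmx// ler_piMr// mx_norm1. Qed.

Lemma frame_normM M Y Z : M \in unitmx ->
  frame_norm M (Y *m Z) <= frame_norm M Y * frame_norm M Z.
Proof.
move=> Mu; rewrite !frame_normE -mulrA ler_wpM2l//.
have -> : invmx M *m (Y *m Z) *m M = (invmx M *m Y *m M) *m (invmx M *m Z *m M).
  by rewrite !mulmxA mulmxK.
by rewrite (le_trans (mx_norm_mul _ _))// mulrA (mulrC d%:R).
Qed.

Lemma frame_norm_eq0 M Y : M \in unitmx -> frame_norm M Y <= 0 -> Y = 0.
Proof.
move=> Mu Y0; have := le_trans (conj_le_frame_norm M Y) Y0.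
rewrite normr_le0 => /eqP E.
have -> : Y = M *m (invmx M *m Y *m M) *m invmx M by rewrite !mulmxA mulmxK// mulmxV// mul1mx.
by rewrite E mulmx0 mul0mx.
Qed.

Lemma cvg_frame_norm (T : Type) (FF : set_system T) {FFilter : Filter FF}
    (M Y : T -> 'M[R]_d) (M0 Y0 : 'M[R]_d) :
  (forall x, M x \in unitmx) -> M0 \in unitmx ->
  M x @[x --> FF] --> M0 -> Y x @[x --> FF] --> Y0 ->
  frame_norm (M x) (Y x) @[x --> FF] --> frame_norm M0 Y0.
Proof.
move=> Mu M0u MM YY; under eq_fun do rewrite frame_normE; rewrite frame_normE.
apply: cvgM; first exact: cvg_cst.
by apply: cvg_norm; apply: cvg_mulmx => //; apply: cvg_mulmx => //; exact: cvg_invmx.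
Qed.

(** A row kernel [k] of [Y] satisfies [k = k (1 - Y)], so its norm is at most half of itself. The
    bound on the inverse comes in the same way from [Y^-1 = 1 + (1 - Y) Y^-1], the identity having
    norm at most [d]. *)
Lemma near_id_unit M Y : M \in unitmx -> frame_norm M (Y - 1%:M) <= 2^-1 ->
  Y \in unitmx /\ frame_norm M (invmx Y) <= 2 * d%:R.
Proof.
move=> Mu Y1.
have Yu : Y \in unitmx.
  rewrite -row_free_unit -kermx_eq0; set k := kermx Y.
  have kY : k *m Y = 0 by exact: mulmx_ker.
  have kE : k = k *m (1%:M - Y) by rewrite mulmxBr mulmx1 kY subr0.
  have nk : frame_norm M k <= frame_norm M k * 2^-1.
    rewrite {1}kE (le_trans (frame_normM _ _ Mu))//.
    by rewrite ler_wpM2l ?frame_norm_ge0// frame_norm_distC.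
  by apply/eqP; apply: (@frame_norm_eq0 M) => //; have := frame_norm_ge0 M k; lra.
split=> //; have E : invmx Y = 1%:M + (1%:M - Y) *m invmx Y.
  by rewrite mulmxBl mul1mx mulmxV// addrC subrK.
have : frame_norm M (invmx Y) <= d%:R + 2^-1 * frame_norm M (invmx Y).
  rewrite {1}E; apply: le_trans (frame_normD _ _ _) _.
  apply: lerD; first exact: frame_norm1.
  apply: le_trans (frame_normM _ _ Mu) _; apply: ler_wpM2r; first exact: frame_norm_ge0.
  by rewrite frame_norm_distC.
by lra.
Qed.

(** The integrand is conjugated by the frame before it is integrated, so the final bound does not
    involve [M]. The decay constant [C], measured in a fixed norm, does depend on [M] and serves
    only to justify convergence. *)
Lemma mint_frame_norm M (g : R -> 'M[R]_d) (b c : R) : M \in unitmx -> 0 < b ->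
  continuous g -> (forall s, 0 <= s -> frame_norm M (g s) <= c * expR (- b * s)) ->
  (exists C, expdec b C g) /\ frame_norm M (mint g) <= d%:R * c / b.
Proof.
move=> Mu b0 gC gb; pose G s := invmx M *m g s *m M.
have GE : expdec b c G.
  split=> [s|s s0]; last by rewrite (le_trans (conj_le_frame_norm _ _))// gb.
  apply: cvg_mulmx; last exact: cvg_cst.
  by apply: cvg_mulmx; [exact: cvg_cst|exact: gC].
have gE : g = fun s => M *m G s *m invmx M.
  by apply/funext => s; rewrite /G !mulmxA mulmxK// mulmxV// mul1mx.
split; first by rewrite gE; eexists; exact: expdec_sandwich GE.
rewrite gE (mint_sandwich _ _ b0 GE) frame_normE !mulmxA mulmxKV// mulVmx// mul1mx.
by rewrite -mulrA ler_wpM2l//; exact: mint_norm.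
Qed.

End FrameNorm.

(** The tail of the geometric series from rank [k] on is [2 * e / 2 ^+ k]; the explicit rate is what
    later makes limits uniform over all points. *)
Lemma geometric_cvg (R : realType) m n (u : nat -> 'M[R]_(m, n)) (e : R) :
  (forall k, `|u k.+1 - u k| <= e / 2 ^+ k) ->
  exists l, forall k, `|u k - l| <= 2 * e / 2 ^+ k.
Proof.
move=> ue; have e0 : 0 <= e.
  by have := ue 0%N; rewrite expr0 divr1; exact: le_trans.
have p0 k : (0 : R) < 2 ^+ k by rewrite exprn_gt0.
have H k j : `|u (k + j)%N - u k| <= 2 * e / 2 ^+ k - 2 * e / 2 ^+ (k + j).
  elim: j => [|j IH]; first by rewrite addn0 !subrr normr0.
  rewrite addnS -(subrK (u (k + j)%N) (u _)) -addrA (le_trans (ler_normD _ _))//.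
  have := lerD (ue (k + j)%N) IH => /le_trans; apply.
  rewrite exprS invfM; set z := 2 ^- (k + j).
  suff -> : 2 * e * (2^-1 * z) = e * z by lra.
  by field.
have H' k j : (k <= j)%N -> `|u j - u k| <= 2 * e / 2 ^+ k.
  move=> /subnKC <-; rewrite (le_trans (H _ _))// gerBl.
  by rewrite divr_ge0 ?mulr_ge0// ltW.
have small (eps : R) : 0 < eps -> exists k, 2 * e / 2 ^+ k < eps.
  move=> eps0; exists (Num.Def.archi_bound (2 * e / eps)).
  set k := Num.Def.archi_bound _; rewrite ltr_pdivrMr//.
  have : 2 * e / eps < 2 ^+ k by apply: upper_nthrootP; exact: leqnn.
  by rewrite ltr_pdivrMr// [_ * eps]mulrC.
have uc : cvg (u @ \oo).
  apply: cauchy_cvg; apply/cauchy_exP => eps eps0; have [k ke] := small _ eps0.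
  exists (u k).
  suff : \forall j \near \oo, ball (u k) eps (u j) by [].
  near=> j; rewrite -ball_normE /ball_ /= distrC (le_lt_trans _ ke)// H'//.
  by near: j; exact: nbhs_infty_ge.
exists (lim (u @ \oo)) => k.
have ukl : `|u k - u j| @[j --> \oo] --> `|u k - lim (u @ \oo)|.
  by apply: cvg_norm; apply: cvgB => //; exact: cvg_cst.
apply: (closed_cvg (fun y => y <= 2 * e / 2 ^+ k)) ukl; first exact: closed_le.
near=> j; rewrite distrC H'//.
by near: j; exact: nbhs_infty_ge.
Unshelve. all: by end_near. Qed.

(** * Diagonal, lower and upper parts with respect to a system of idempotents *)

Section Blocks.
Variables (R : realType) (d n : nat).
Implicit Types (p : 'I_n -> 'M[R]_d) (Y : 'M[R]_d).

(** A complete system of orthogonal idempotents: the algebraic form of a decomposition of the space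
    into ordered summands. *)
Definition block_family p := (forall i j, p i *m p j = if i == j then p i else 0) /\
  \sum_(i < n) p i = 1%:M.

Definition diag_part p Y := \sum_(i < n) p i *m Y *m p i.
Definition lower_part p Y := \sum_(i < n) \sum_(j < n | (j < i)%N) p i *m Y *m p j.
Definition upper_part p Y := \sum_(i < n) \sum_(j < n | (i < j)%N) p i *m Y *m p j.

Variable p : 'I_n -> 'M[R]_d.
Hypothesis pP : block_family p.

Lemma block_mul i j : p i *m p j = if i == j then p i else 0.
Proof. by have [+ _] := pP; apply. Qed.

Lemma block_idem i : p i *m p i = p i.
Proof. by rewrite block_mul eqxx. Qed.

Lemma block_decomposition Y : Y = diag_part p Y + lower_part p Y + upper_part p Y.
Proof.
have [_ p1] := pP.
rewrite -{1}[Y]mul1mx -{1}[_ *m Y]mulmx1 -p1 mulmx_suml mulmx_suml.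
rewrite -!big_split /=; apply: eq_bigr => i _; rewrite mulmx_sumr.
rewrite (bigD1 i)//= -addrA; congr (_ + _).
rewrite (bigID (fun j : 'I_n => (j < i)%N)) /=; congr (_ + _); apply: eq_bigl => j.
  by rewrite -val_eqE /=; case: ltngtP.
by rewrite -val_eqE /=; case: ltngtP.
Qed.

Lemma diag_part_mulr Y i : diag_part p Y *m p i = p i *m Y *m p i.
Proof.
rewrite mulmx_suml (bigD1 i)//= -mulmxA block_idem big1 ?addr0// => j ji.
by rewrite -mulmxA block_mul (negbTE ji) mulmx0.
Qed.

Lemma diag_part_mull Y i : p i *m diag_part p Y = p i *m Y *m p i.
Proof.
rewrite mulmx_sumr (bigD1 i)//= !mulmxA block_idem big1 ?addr0// => j ji.
by rewrite !mulmxA block_mul eq_sym (negbTE ji) !mul0mx.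
Qed.

Lemma block_sandwich i j Y k l :
  p k *m (p i *m Y *m p j) *m p l = if (k == i) && (l == j) then p i *m Y *m p j else 0.
Proof.
rewrite !mulmxA block_mul; case: eqP => [->|_] /=; last by rewrite !mul0mx.
by rewrite -mulmxA block_mul eq_sym; case: eqP => //= _; rewrite mulmx0.
Qed.

Lemma diag_part_lower Y : diag_part p (lower_part p Y) = 0.
Proof.
rewrite /diag_part big1 // => k _; rewrite mulmx_sumr mulmx_suml big1 // => i _.
rewrite mulmx_sumr mulmx_suml big1 // => j ji; rewrite block_sandwich.
by case: (k =P i) => //= ->; case: eqP => // E; move: ji; rewrite E ltnn.
Qed.

Lemma diag_part_upper Y : diag_part p (upper_part p Y) = 0.
Proof.
rewrite /diag_part big1 // => k _; rewrite mulmx_sumr mulmx_suml big1 // => i _.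
rewrite mulmx_sumr mulmx_suml big1 // => j ji; rewrite block_sandwich.
by case: (k =P i) => //= ->; case: eqP => // E; move: ji; rewrite E ltnn.
Qed.

Lemma diag_partD Y Z : diag_part p (Y + Z) = diag_part p Y + diag_part p Z.
Proof. by rewrite -big_split /=; apply: eq_bigr => i _; rewrite mulmxDr mulmxDl. Qed.

Lemma diag_partN Y : diag_part p (- Y) = - diag_part p Y.
Proof. by rewrite -sumrN; apply: eq_bigr => i _; rewrite mulmxN mulNmx. Qed.

Lemma lower_partD Y Z : lower_part p (Y + Z) = lower_part p Y + lower_part p Z.
Proof.
rewrite -big_split /=; apply: eq_bigr => i _; rewrite -big_split /=.
by apply: eq_bigr => j _; rewrite mulmxDr mulmxDl.
Qed.

Lemma upper_partD Y Z : upper_part p (Y + Z) = upper_part p Y + upper_part p Z.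
Proof.
rewrite -big_split /=; apply: eq_bigr => i _; rewrite -big_split /=.
by apply: eq_bigr => j _; rewrite mulmxDr mulmxDl.
Qed.

Lemma lower_partZ (a : R) Y : lower_part p (a *: Y) = a *: lower_part p Y.
Proof.
rewrite scaler_sumr /=; apply: eq_bigr => i _; rewrite scaler_sumr /=.
by apply: eq_bigr => j _; rewrite -scalemxAr -scalemxAl.
Qed.

Lemma upper_partZ (a : R) Y : upper_part p (a *: Y) = a *: upper_part p Y.
Proof.
rewrite scaler_sumr /=; apply: eq_bigr => i _; rewrite scaler_sumr /=.
by apply: eq_bigr => j _; rewrite -scalemxAr -scalemxAl.
Qed.

Lemma diag_part_mul Y D : (forall i, p i *m D = D *m p i) ->
  diag_part p (Y *m D) = diag_part p Y *m D.
Proof.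
move=> pD; rewrite mulmx_suml; apply: eq_bigr => i _.
by rewrite -!mulmxA pD.
Qed.

Lemma diag_part_comm Y i : p i *m diag_part p Y = diag_part p Y *m p i.
Proof. by rewrite diag_part_mull diag_part_mulr. Qed.

Lemma cvg_lower_part (T : Type) (FF : set_system T) {FFilter : Filter FF}
    (F : T -> 'M[R]_d) (A : 'M[R]_d) :
  F x @[x --> FF] --> A -> lower_part p (F x) @[x --> FF] --> lower_part p A.
Proof.
move=> FA; apply: cvg_big => [|i _]; first exact: add_continuous.
apply: cvg_big => [|j _]; first exact: add_continuous.
by apply: cvg_mulmx; [apply: cvg_mulmx => //; exact: cvg_cst|exact: cvg_cst].
Qed.

Lemma cvg_upper_part (T : Type) (FF : set_system T) {FFilter : Filter FF}
    (F : T -> 'M[R]_d) (A : 'M[R]_d) :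
  F x @[x --> FF] --> A -> upper_part p (F x) @[x --> FF] --> upper_part p A.
Proof.
move=> FA; apply: cvg_big => [|i _]; first exact: add_continuous.
apply: cvg_big => [|j _]; first exact: add_continuous.
by apply: cvg_mulmx; [apply: cvg_mulmx => //; exact: cvg_cst|exact: cvg_cst].
Qed.

Lemma cvg_diag_part (T : Type) (FF : set_system T) {FFilter : Filter FF}
    (F : T -> 'M[R]_d) (A : 'M[R]_d) :
  F x @[x --> FF] --> A -> diag_part p (F x) @[x --> FF] --> diag_part p A.
Proof.
move=> FA; apply: cvg_big => [|i _]; first exact: add_continuous.
by apply: cvg_mulmx; [apply: cvg_mulmx => //; exact: cvg_cst|exact: cvg_cst].
Qed.

End Blocks.

(** * Integration of off-diagonal blocks along a dominated flow *)

Section Perturbation.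
Variables (R : realType) (d n : nat) (X : Type) (phi : R -> X -> X).
Variables (M : X -> 'M[R]_d) (p : X -> 'I_n -> 'M[R]_d) (b C kappa : R).

(* Domination as it acts on matrices: the block from [p x j] to [p x i] decays
   forwards when [i < j] and backwards when [j < i]. *)
Record block_flow : Prop := BlockFlow {
  bf_flow0 : forall x, phi 0 x = x;
  bf_flowD : forall s r x, phi s (phi r x) = phi (s + r) x;
  bf_unit : forall x, M x \in unitmx;
  bf_cont : forall x, continuous (fun s => M (phi s x));
  bf_block : forall x, block_family (p x);
  bf_inv : forall s x, p (phi s x) = p x;
  bf_rate : 0 < b;
  bf_C : 0 <= C;
  bf_bound : forall x i, frame_norm (M x) (p x i) <= kappa;
  bf_up : forall x (i j : 'I_n) (Y : 'M[R]_d) s, (i < j)%N -> 0 <= s ->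
    frame_norm (M (phi s x)) (p x i *m Y *m p x j) <=
      C * expR (- b * s) * frame_norm (M x) Y;
  bf_low : forall x (i j : 'I_n) (Y : 'M[R]_d) s, (j < i)%N -> 0 <= s ->
    frame_norm (M (phi (- s) x)) (p x i *m Y *m p x j) <=
      C * expR (- b * s) * frame_norm (M x) Y }.

Hypothesis H : block_flow.
Local Notation nrm x Y := (frame_norm (M x) Y).
Implicit Types (f g Z : X -> 'M[R]_d) (x : X).

Definition orbit_continuous f := forall x, continuous (fun s => f (phi s x)).

Definition bounded_by f (c : R) := forall x, nrm x (f x) <= c.

(* Solves [g' = - (lower_part + upper_part) f] along the flow; each part is
   integrated in the direction in which it decays. *)
Definition integrator f x : 'M[R]_d :=
  mint (fun s => lower_part (p x) (f (phi s x))) -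
  mint (fun s => upper_part (p x) (f (phi (- s) x))).

Let Mu := bf_unit H.
Let b0 := bf_rate H.

Lemma sum_pair_le (F : 'I_n -> 'I_n -> R) (P : 'I_n -> 'I_n -> bool) (c : R) : 0 <= c ->
  (forall i j, P i j -> F i j <= c) ->
  \sum_(i < n) \sum_(j < n | P i j) F i j <= n%:R * n%:R * c.
Proof.
move=> c0 Fc; apply: (@le_trans _ _ (\sum_(i < n) \sum_(j < n) c)).
  apply: ler_sum => i _; rewrite [leRHS](bigID (P i)) /= -[leLHS]addr0.
  by rewrite lerD//; [apply: ler_sum => j /Fc|apply: sumr_ge0].
by under eq_bigr do rewrite sumr_const card_ord; rewrite sumr_const card_ord -mulrA !mulr_natl.
Qed.

Lemma frame_norm_pair_le (F : 'I_n -> 'I_n -> 'M[R]_d) (P : 'I_n -> 'I_n -> bool) (c : R) x :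
  0 <= c -> (forall i j, P i j -> nrm x (F i j) <= c) ->
  nrm x (\sum_(i < n) \sum_(j < n | P i j) F i j) <= n%:R * n%:R * c.
Proof.
move=> c0 Fc; rewrite (le_trans (frame_norm_sum _ _ _ _))//.
apply: le_trans (sum_pair_le c0 Fc).
by apply: ler_sum => i _; exact: frame_norm_sum.
Qed.

(** Read in the parallel sections, a matrix does not move along the orbit, only the norm does. The
    bound is [bf_low] at the point [phi s x], from which [x] is reached backwards in time [s]. *)
Lemma lower_decay f c x s : bounded_by f c -> 0 <= s ->
  nrm x (lower_part (p x) (f (phi s x))) <= n%:R * n%:R * (C * c) * expR (- b * s).
Proof.
move=> fc s0; have c0 : 0 <= c := le_trans (frame_norm_ge0 _ _) (fc x).
rewrite -mulrA; apply: frame_norm_pair_le => [|i j ji].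
  by rewrite !mulr_ge0 ?expR_ge0// (bf_C H).
have := bf_low H (phi s x) (f (phi s x)) ji s0.
rewrite (bf_flowD H) addNr (bf_flow0 H) (bf_inv H) => /le_trans; apply.
rewrite [leRHS]mulrAC ler_wpM2l ?mulr_ge0 ?expR_ge0 ?(bf_C H)//; exact: fc.
Qed.

Lemma upper_decay f c x s : bounded_by f c -> 0 <= s ->
  nrm x (upper_part (p x) (f (phi (- s) x))) <= n%:R * n%:R * (C * c) * expR (- b * s).
Proof.
move=> fc s0; have c0 : 0 <= c := le_trans (frame_norm_ge0 _ _) (fc x).
rewrite -mulrA; apply: frame_norm_pair_le => [|i j ji].
  by rewrite !mulr_ge0 ?expR_ge0// (bf_C H).
have := bf_up H (phi (- s) x) (f (phi (- s) x)) ji s0.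
rewrite (bf_flowD H) addrN (bf_flow0 H) (bf_inv H) => /le_trans; apply.
rewrite [leRHS]mulrAC ler_wpM2l ?mulr_ge0 ?expR_ge0 ?(bf_C H)//; exact: fc.
Qed.

(** Two integrals, each of at most [n * n] blocks of size [C], with [1 / b] from the integral of the
    exponential and [d] from [mint_frame_norm]. *)
Definition int_const : R := 2 * (d%:R * (n%:R * n%:R * C) / b).

Lemma int_const_ge0 : 0 <= int_const.
Proof. by rewrite !mulr_ge0// ?invr_ge0 ?(bf_C H)// ltW. Qed.

Lemma orbit_continuousN f x : orbit_continuous f -> continuous (fun s => f (phi (- s) x)).
Proof.
move=> fC s; apply: (@continuous_comp _ _ _ (@GRing.opp R) (fun s => f (phi s x))).
  exact: oppr_continuous.
exact: fC.
Qed.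

Lemma lower_expdec f c x : orbit_continuous f -> bounded_by f c ->
  (exists D, expdec b D (fun s => lower_part (p x) (f (phi s x)))) /\
  nrm x (mint (fun s => lower_part (p x) (f (phi s x)))) <=
    d%:R * (n%:R * n%:R * (C * c)) / b.
Proof.
move=> fC fc; apply: mint_frame_norm => //; last by move=> s; exact: lower_decay.
by move=> s; apply: cvg_lower_part; exact: fC.
Qed.

Lemma upper_expdec f c x : orbit_continuous f -> bounded_by f c ->
  (exists D, expdec b D (fun s => upper_part (p x) (f (phi (- s) x)))) /\
  nrm x (mint (fun s => upper_part (p x) (f (phi (- s) x)))) <=
    d%:R * (n%:R * n%:R * (C * c)) / b.
Proof.
move=> fC fc; apply: mint_frame_norm => //; last by move=> s; exact: upper_decay.
by move=> s; apply: cvg_upper_part; exact: orbit_continuousN.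
Qed.

Lemma integrator_bound f c : orbit_continuous f -> bounded_by f c ->
  bounded_by (integrator f) (int_const * c).
Proof.
move=> fC fc x; rewrite (le_trans (frame_normB _ _ _))//.
have [_ l] := lower_expdec x fC fc; have [_ u] := upper_expdec x fC fc.
rewrite (le_trans (lerD l u))// le_eqVlt; apply/orP; left; apply/eqP.
by rewrite /int_const; field; exact: lt0r_neq0.
Qed.

Lemma integratorB f g c c' x : orbit_continuous f -> bounded_by f c ->
  orbit_continuous g -> bounded_by g c' ->
  integrator (fun y => f y - g y) x = integrator f x - integrator g x.
Proof.
move=> fC fc gC gc.
pose g' y := (-1) *: g y.
have gC' : orbit_continuous g' by move=> y s; apply: cvgZ; [exact: cvg_cst|exact: gC].
have gc' : bounded_by g' c'.
  by move=> y; rewrite /g' frame_normZ normrN normr1 mul1r.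
have [[lf lfE] _] := lower_expdec x fC fc; have [[uf ufE] _] := upper_expdec x fC fc.
have [[lg lgE] _] := lower_expdec x gC gc; have [[ug ugE] _] := upper_expdec x gC gc.
have [[lg' lgE'] _] := lower_expdec x gC' gc'; have [[ug' ugE'] _] := upper_expdec x gC' gc'.
rewrite /integrator.
have -> : (fun s => lower_part (p x) (f (phi s x) - g (phi s x))) =
  (fun s => lower_part (p x) (f (phi s x)) + lower_part (p x) (g' (phi s x))).
  by apply/funext => s; rewrite -lower_partD /g' scaleN1r.
have -> : (fun s => upper_part (p x) (f (phi (- s) x) - g (phi (- s) x))) =
  (fun s => upper_part (p x) (f (phi (- s) x)) + upper_part (p x) (g' (phi (- s) x))).
  by apply/funext => s; rewrite -upper_partD /g' scaleN1r.
rewrite (mintD b0 lfE lgE') (mintD b0 ufE ugE').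
under [X in _ + mint X - _]eq_fun do rewrite /g' lower_partZ.
under [X in - (_ + mint X)]eq_fun do rewrite /g' upper_partZ.
rewrite (mintZ _ b0 lgE) (mintZ _ b0 ugE) !scaleN1r.
move: (mint _) (mint _) (mint _) (mint _) => m1 m2 m3 m4.
by rewrite !opprD !opprK addrACA.
Qed.

Lemma integratorZ (a : R) f c x : orbit_continuous f -> bounded_by f c ->
  integrator (fun y => a *: f y) x = a *: integrator f x.
Proof.
move=> fC fc.
have [[lf lfE] _] := lower_expdec x fC fc; have [[uf ufE] _] := upper_expdec x fC fc.
rewrite /integrator scalerBr -(mintZ _ b0 lfE) -(mintZ _ b0 ufE).
by congr (mint _ - mint _); apply/funext => s; rewrite ?lower_partZ ?upper_partZ.
Qed.

(** Along the orbit the two integrals are tails, towards the future for the lower part and towards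
    the past for the upper one. The minus sign of the second in [integrator] makes both contribute
    to the derivative with the same sign. *)
Lemma integrator_derive f c x r : orbit_continuous f -> bounded_by f c ->
  is_derive (r : R) (1 : R) (fun r => integrator f (phi r x))
    (- (lower_part (p x) (f (phi r x)) + upper_part (p x) (f (phi r x)))).
Proof.
move=> fC fc; rewrite /integrator.
have L u : exists D, expdec b D (fun s => lower_part (p x) (f (phi (s + u) x))).
  have [[D HD] _] := lower_expdec (phi u x) fC fc; exists D.
  by move: HD; rewrite (bf_inv H); under eq_fun do rewrite (bf_flowD H).
have U u : exists D, expdec b D (fun s => upper_part (p x) (f (phi (- (s + u)) x))).
  have [[D HD] _] := upper_expdec (phi (- u) x) fC fc; exists D.
  by move: HD; rewrite (bf_inv H); under eq_fun do rewrite (bf_flowD H) -opprD.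
have dL := @mint_shift_derive _ _ _ (fun s => lower_part (p x) (f (phi s x))) b r b0 L.
have dU := @mint_shift_derive _ _ _ (fun s => upper_part (p x) (f (phi (- s) x))) b (- r) b0 U.
have dU' : is_derive (r : R) (1 : R)
    (fun r => mint (fun s => upper_part (p x) (f (phi (- (s + - r)) x))))
    (upper_part (p x) (f (phi r x))).
  have N1 : is_derive (r : R) (1 : R) (@GRing.opp R) (-1 : R) by exact: is_deriveNid.
  rewrite opprK in dU.
  apply/is_derive_mxP => i j; move/is_derive_mxP: dU => /(_ i j) dU.
  refine (is_derive_eq (is_derive1_comp dU N1) _).
  by rewrite mxE mulrN1 opprK.
rewrite opprD.
have FE u : mint (fun s => lower_part (p x) (f (phi (s + u) x))) -
    mint (fun s => upper_part (p x) (f (phi (- (s + - u)) x))) =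
  mint (fun s => lower_part (p (phi u x)) (f (phi s (phi u x)))) -
    mint (fun s => upper_part (p (phi u x)) (f (phi (- s) (phi u x)))).
  have pI : p (phi u x) = p x by exact: bf_inv H u x.
  have F1 : (fun s => lower_part (p x) (f (phi (s + u) x))) =
      fun s => lower_part (p (phi u x)) (f (phi s (phi u x))).
    by apply: funext => s; rewrite pI (bf_flowD H s u x).
  have F2 : (fun s => upper_part (p x) (f (phi (- (s + - u)) x))) =
      fun s => upper_part (p (phi u x)) (f (phi (- s) (phi u x))).
    by apply: funext => s; rewrite pI (bf_flowD H (- s) u x) opprD opprK.
  by rewrite F1 F2.
by rewrite -(funext FE); exact: is_derive_subfun.
Qed.

End Perturbation.

(** * The Picard iteration for the perturbed splitting *)

Section FixedPoint.
Variables (R : realType) (d n : nat) (X : Type) (phi : R -> X -> X).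
Variables (M : X -> 'M[R]_d) (p : X -> 'I_n -> 'M[R]_d) (b C kappa : R).
Hypothesis H : block_flow phi M p b C kappa.
Local Notation nrm x Y := (frame_norm (M x) Y).
Local Notation orbit_continuous := (orbit_continuous phi).
Local Notation bounded_by := (bounded_by M).
Local Notation integrator := (integrator phi p).
Local Notation int_const := (int_const d n b C).
Implicit Types (f g Z : X -> 'M[R]_d) (x : X).

Let Mu := bf_unit H.
Let b0 := bf_rate H.

Definition diag_const : R := n%:R * kappa ^+ 2.

Lemma diag_const_ge0 : 0 <= diag_const.
Proof. by rewrite mulr_ge0// sqr_ge0. Qed.

Lemma diag_part_bound x Y : nrm x (diag_part (p x) Y) <= diag_const * nrm x Y.
Proof.
rewrite (le_trans (frame_norm_sum _ _ _ _))//.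
apply: (@le_trans _ _ (\sum_(i < n) kappa ^+ 2 * nrm x Y)); last first.
  by rewrite sumr_const card_ord -mulr_natl mulrA.
apply: ler_sum => i _; rewrite (le_trans (frame_normM _ _ (Mu x)))//.
rewrite expr2 mulrAC.
apply: ler_pM; [exact: frame_norm_ge0|exact: frame_norm_ge0| |exact: (bf_bound H)].
rewrite (le_trans (frame_normM _ _ (Mu x)))// ler_wpM2r ?frame_norm_ge0//.
exact: (bf_bound H).
Qed.

Lemma orbit_continuous_diag f : orbit_continuous f ->
  orbit_continuous (fun x => diag_part (p x) (f x)).
Proof.
move=> fC x s; under eq_fun do rewrite (bf_inv H).
by apply: cvg_diag_part; exact: fC.
Qed.

Lemma orbit_continuous_mul f g : orbit_continuous f -> orbit_continuous g ->
  orbit_continuous (fun x => f x *m g x).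
Proof. by move=> fC gC x s; apply: cvg_mulmx; [exact: fC|exact: gC]. Qed.

Lemma orbit_continuous_sub f g : orbit_continuous f -> orbit_continuous g ->
  orbit_continuous (fun x => f x - g x).
Proof. by move=> fC gC x s; apply: cvgB; [exact: fC|exact: gC]. Qed.

Lemma orbit_continuous_cst (A : 'M[R]_d) : orbit_continuous (fun=> A).
Proof. by move=> x s; exact: cvg_cst. Qed.

(** Large enough for [pert_const * delta] to be both a bound for [picard_integrand] and a Lipschitz
    constant of it in [Z]. The factor [d + 1] bounds [Z], which is within 1 of the identity. *)
Definition pert_const : R := (d%:R + 1) * (1 + 2 * diag_const).

Lemma pert_const_ge0 : 0 <= pert_const.
Proof. by rewrite mulr_ge0// addr_ge0// mulr_ge0// diag_const_ge0. Qed.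

Variables (B : X -> 'M[R]_d) (delta : R).
Hypotheses (BC : orbit_continuous B) (Bd : bounded_by B delta).
Hypothesis small : int_const * pert_const * delta <= 4^-1.
Hypothesis delta0 : 0 <= delta.

(** [q] bounds the distance from [Z] to the identity and is also the contraction factor of [picard].
    A value below 1/2 ensures both geometric convergence and the invertibility of [Z]. *)
Let q := int_const * pert_const * delta.

Lemma q_ge0 : 0 <= q.
Proof.
apply: mulr_ge0 => //.
by apply: mulr_ge0; [exact: (int_const_ge0 H)|exact: pert_const_ge0].
Qed.

Lemma q_le1 : q <= 1.
Proof. by apply: le_trans small _; lra. Qed.

(* With [D := diag_part (B Z)], a fixed point of [picard] satisfies
   [Z' = - B Z + Z D] along the flow: it conjugates the cocycle perturbed by [B]
   to the block diagonal one generated by [D]. *)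
Definition picard_integrand Z x : 'M[R]_d :=
  B x *m Z x - (Z x - 1%:M) *m diag_part (p x) (B x *m Z x).

Definition picard Z x : 'M[R]_d := 1%:M + integrator (picard_integrand Z) x.

Definition near_id Z := orbit_continuous Z /\ forall x, nrm x (Z x - 1%:M) <= q.

Lemma near_id_le Z x : near_id Z -> nrm x (Z x) <= d%:R + 1.
Proof.
move=> [_ Zq]; rewrite -(subrK 1%:M (Z x)) addrC (le_trans (frame_normD _ _ _))//.
apply: lerD; first exact: frame_norm1.
exact: le_trans (Zq x) q_le1.
Qed.

Lemma near_id_mulB_le Z x : near_id Z -> nrm x (B x *m Z x) <= delta * (d%:R + 1).
Proof.
move=> Zn; rewrite (le_trans (frame_normM _ _ (Mu x)))//.
by apply: ler_pM; [exact: frame_norm_ge0|exact: frame_norm_ge0|exact: Bd|exact: near_id_le].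
Qed.

Lemma near_id_diag_le Z x : near_id Z ->
  nrm x (diag_part (p x) (B x *m Z x)) <= diag_const * (delta * (d%:R + 1)).
Proof.
move=> Zn; rewrite (le_trans (diag_part_bound _ _))//.
by rewrite ler_wpM2l ?diag_const_ge0// near_id_mulB_le.
Qed.

Lemma picard_integrand_cont Z : near_id Z -> orbit_continuous (picard_integrand Z).
Proof.
move=> [ZC _]; apply: orbit_continuous_sub; first exact: orbit_continuous_mul.
apply: orbit_continuous_mul.
  by apply: orbit_continuous_sub => //; exact: orbit_continuous_cst.
by apply: orbit_continuous_diag; exact: orbit_continuous_mul.
Qed.

Lemma picard_integrand_bound Z : near_id Z ->
  bounded_by (picard_integrand Z) (pert_const * delta).
Proof.
move=> Zn x; rewrite (le_trans (frame_normB _ _ _))//.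
have h1 := near_id_mulB_le x Zn; have h2 := near_id_diag_le x Zn.
have h3 : nrm x ((Z x - 1%:M) *m diag_part (p x) (B x *m Z x)) <=
    1 * (diag_const * (delta * (d%:R + 1))).
  rewrite (le_trans (frame_normM _ _ (Mu x)))//; apply: ler_pM; [exact: frame_norm_ge0|exact: frame_norm_ge0| |exact: h2].
  exact: le_trans (proj2 Zn x) q_le1.
rewrite (le_trans (lerD h1 h3))// /pert_const mul1r -subr_ge0.
rewrite [leRHS](_ : _ = (d%:R + 1) * delta * diag_const); last by ring.
by move: (diag_const) diag_const_ge0 => D D0; rewrite !mulr_ge0// addr_ge0.
Qed.

Lemma picard_integrand_lip Z Z' e : near_id Z -> near_id Z' -> 0 <= e ->
  bounded_by (fun x => Z x - Z' x) e ->
  bounded_by (fun x => picard_integrand Z x - picard_integrand Z' x) (pert_const * delta * e).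
Proof.
move=> Zn Zn' e0 ZZ x.
have BZ : nrm x (B x *m (Z x - Z' x)) <= delta * e.
  by rewrite (le_trans (frame_normM _ _ (Mu x)))//; apply: ler_pM; [exact: frame_norm_ge0|exact: frame_norm_ge0|exact: Bd|exact: ZZ].
rewrite /picard_integrand.
(* The integrand is quadratic in [Z]; its difference is split so that each term has one factor
   [Z - Z'], using the linearity of [diag_part]. *)
have -> : B x *m Z x - (Z x - 1%:M) *m diag_part (p x) (B x *m Z x) -
    (B x *m Z' x - (Z' x - 1%:M) *m diag_part (p x) (B x *m Z' x)) =
  B x *m (Z x - Z' x) - (Z x - Z' x) *m diag_part (p x) (B x *m Z x)
   - (Z' x - 1%:M) *m diag_part (p x) (B x *m (Z x - Z' x)).
  rewrite mulmxBr diag_partD diag_partN -(subrKA (Z' x) (Z x) (- 1%:M)).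
  rewrite mulmxDl [in RHS]mulmxBr.
  move: (B x *m Z x) (B x *m Z' x) => a a'.
  move: (diag_part _ a) (diag_part _ a') (Z x - Z' x) (Z' x - 1%:M) => e1 e2 u v.
  move: (u *m e1) (v *m e1) (v *m e2) => w1 w2 w3.
  by apply/matrixP => i j; rewrite !mxE; ring.
have h1 : nrm x ((Z x - Z' x) *m diag_part (p x) (B x *m Z x)) <=
    e * (diag_const * (delta * (d%:R + 1))).
  by rewrite (le_trans (frame_normM _ _ (Mu x)))//; apply: ler_pM; [exact: frame_norm_ge0|exact: frame_norm_ge0|exact: ZZ|exact: near_id_diag_le].
have h2 : nrm x ((Z' x - 1%:M) *m diag_part (p x) (B x *m (Z x - Z' x))) <=
    1 * (diag_const * (delta * e)).
  rewrite (le_trans (frame_normM _ _ (Mu x)))//; apply: ler_pM; [exact: frame_norm_ge0|exact: frame_norm_ge0| |].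
    exact: le_trans (proj2 Zn' x) q_le1.
  by rewrite (le_trans (diag_part_bound _ _))// ler_wpM2l ?diag_const_ge0.
rewrite (le_trans (frame_normB _ _ _))//.
apply: (le_trans (lerD (le_trans (frame_normB _ _ _) (lerD BZ h1)) h2)).
rewrite /pert_const -subr_ge0.
rewrite [leRHS](_ : _ = delta * e * (d%:R + d%:R * diag_const)); last by ring.
by move: (diag_const) diag_const_ge0 => D D0; rewrite !mulr_ge0// addr_ge0// mulr_ge0.
Qed.

Lemma picard_integrator_bound Z x : near_id Z -> nrm x (integrator (picard_integrand Z) x) <= q.
Proof.
move=> Zn; have := integrator_bound H (picard_integrand_cont Zn) (picard_integrand_bound Zn) x.
by rewrite mulrA.
Qed.

(** Continuity along orbits is regained at each step because [integrator] is differentiable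
    there. *)
Lemma near_id_picard Z : near_id Z -> near_id (picard Z).
Proof.
move=> Zn; have gC := picard_integrand_cont Zn; have gb := picard_integrand_bound Zn.
split=> [x|x]; last by rewrite /picard addrC addKr; exact: picard_integrator_bound.
apply: (@is_derive_continuous _ _ _ (fun r => - (lower_part (p x) (picard_integrand Z (phi r x)) +
  upper_part (p x) (picard_integrand Z (phi r x))))) => s.
rewrite /picard; under eq_fun do rewrite addrC.
by apply: is_derive_addc; exact: (integrator_derive H x s gC gb).
Qed.

Lemma picard_lip Z Z' e : near_id Z -> near_id Z' -> 0 <= e ->
  bounded_by (fun x => Z x - Z' x) e ->
  bounded_by (fun x => picard Z x - picard Z' x) (q * e).
Proof.
move=> Zn Zn' e0 ZZ x.
have gC := picard_integrand_cont Zn; have gb := picard_integrand_bound Zn.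
have gC' := picard_integrand_cont Zn'; have gb' := picard_integrand_bound Zn'.
have -> : picard Z x - picard Z' x =
    integrator (fun y => picard_integrand Z y - picard_integrand Z' y) x.
  by rewrite (integratorB H x gC gb gC' gb') /picard opprD addrACA subrr add0r.
have := integrator_bound H (orbit_continuous_sub gC gC') (picard_integrand_lip Zn Zn' e0 ZZ) x.
by rewrite /q !mulrA.
Qed.

Lemma near_id_one : near_id (fun=> 1%:M).
Proof. by split=> [|x]; [exact: orbit_continuous_cst|rewrite subrr frame_norm0 q_ge0]. Qed.

(** The increments of the iterates are geometric in the frame norm of each point, uniformly over
    points. The limit is therefore taken of the conjugates by [M x], separately at each [x], and
    conjugated back. *)
Lemma picard_fixed_point : exists Z, near_id Z /\ forall x, Z x = picard Z x.
Proof.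
pose u k := iter k picard (fun=> 1%:M).
have un k : near_id (u k).
  by elim: k => [|k IH]; [exact: near_id_one|exact: near_id_picard].
have q4 : q <= 2^-1 by apply: le_trans small _; lra.
have e0 k : 0 <= 1 / 2 ^+ k :> R by rewrite divr_ge0// exprn_ge0.
have du k : bounded_by (fun x => u k.+1 x - u k x) (1 / 2 ^+ k).
  elim: k => [|k IH] x.
    by rewrite expr0 divr1; apply: le_trans (proj2 (un 1%N) x) q_le1.
  apply: le_trans (picard_lip (un k.+1) (un k) (e0 k) IH x) _.
  by rewrite exprS invfM !mul1r; apply: ler_wpM2r => //; rewrite -div1r.
have conjK (Y : 'M[R]_d) x : M x *m (invmx (M x) *m Y *m M x) *m invmx (M x) = Y.
  by rewrite !mulmxA mulmxK// mulmxV// mul1mx.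
have /choice[A HA] x : exists l, forall k, `|invmx (M x) *m u k x *m M x - l| <= 2 * 1 / 2 ^+ k.
  apply: (@geometric_cvg _ _ _ (fun k => invmx (M x) *m u k x *m M x)) => k.
  rewrite -mulmxBl -mulmxBr; apply: le_trans (conj_le_frame_norm _ _) _; exact: du.
pose Z x := M x *m A x *m invmx (M x).
have ZA x : invmx (M x) *m Z x *m M x = A x.
  by rewrite /Z !mulmxA mulVmx// mul1mx mulmxKV.
have uZ k : bounded_by (fun x => u k x - Z x) (d%:R * (2 * 1 / 2 ^+ k)).
  move=> x; rewrite frame_normE ler_wpM2l// mulmxBr mulmxBl ZA; exact: HA.
have small_pow (eps : R) : 0 < eps -> exists k, 2 * 1 / 2 ^+ k < eps.
  move=> eps0; exists (Num.Def.archi_bound (2 * 1 / eps)).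
  set k := Num.Def.archi_bound _; rewrite ltr_pdivrMr ?exprn_gt0//.
  have : 2 * 1 / eps < 2 ^+ k by apply: upper_nthrootP; exact: leqnn.
  by rewrite ltr_pdivrMr// [_ * eps]mulrC.
have le_small (a c : R) : 0 <= c -> (forall k, a <= c * (2 * 1 / 2 ^+ k)) -> a <= 0.
  move=> c0 ac; rewrite leNgt; apply/negP => a0.
  have c1 : 0 < c + 1 by lra.
  have [k ka] := small_pow (a / (c + 1)) (divr_gt0 a0 c1).
  have := ac k; rewrite ltr_pdivlMr// in ka.
  have : 0 <= 2 * 1 / 2 ^+ k :> R by rewrite divr_ge0// exprn_ge0.
  by move: (2 * 1 / 2 ^+ k) ka => z; nra.
have Zq x : nrm x (Z x - 1%:M) <= q.
  rewrite -subr_le0; apply: (@le_small _ d%:R) => // k.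
  rewrite lerBlDr -(subrK (u k x) (Z x)) -addrA (le_trans (frame_normD _ _ _))//.
  apply: lerD; first by rewrite frame_norm_distC; exact: uZ.
  exact: (proj2 (un k)).
have Mc x s : M (phi t x) @[t --> s] --> M (phi s x) by exact: (bf_cont H).
have Mi x s : invmx (M (phi t x)) @[t --> s] --> invmx (M (phi s x)).
  by apply: cvg_invmx; [move=> t; exact: Mu|exact: Mu|exact: Mc].
(* A uniform limit of functions continuous along the orbit, with error [e / 3] for each of the three
   terms. *)
have AC x : continuous (fun s => A (phi s x)).
  move=> s; apply/cvgrPdist_le => e e_gt0; have [k ke] := small_pow (e / 3) (divr_gt0 e_gt0 (ltr0Sn _ _)).
  have : (invmx (M (phi t x)) *m u k (phi t x) *m M (phi t x)) @[t --> s] -->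
      invmx (M (phi s x)) *m u k (phi s x) *m M (phi s x).
    apply: cvg_mulmx; last exact: Mc.
    by apply: cvg_mulmx; [exact: Mi|exact: (proj1 (un k))].
  move=> /cvgrPdist_le /(_ (e / 3) (divr_gt0 e_gt0 (ltr0Sn _ _))); apply: filterS => t H1.
  have H2 := HA (phi s x) k; have H3 := HA (phi t x) k.
  move: H1 H2 H3; set a := invmx _ *m _ *m _; set a' := invmx _ *m _ *m _ => H1 H2 H3.
  have -> : A (phi s x) - A (phi t x) = - (a - A (phi s x)) + (a - a') + (a' - A (phi t x)).
    by rewrite opprB !addrA subrK subrK.
  rewrite (le_trans (ler_normD _ _))//; have := ler_normD (- (a - A (phi s x))) (a - a').
  by rewrite normrN => H4; move: ke; lra.
have Zn : near_id Z.
  split=> // x s; rewrite /Z; apply: cvg_mulmx; last exact: Mi.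
  by apply: cvg_mulmx; [exact: Mc|exact: AC].
(* [Z] and [picard Z] are both compared with the iterate [u k.+1], the second through the
   contraction; the two distances tend to 0. *)
exists Z; split=> // x; apply/eqP; rewrite -subr_eq0; apply/eqP.
apply: (frame_norm_eq0 (Mu x)); apply: (@le_small _ (d%:R + q * d%:R)).
  by rewrite addr_ge0// mulr_ge0// q_ge0.
move=> k; set e := 2 * 1 / 2 ^+ k.
have e_ge0 : 0 <= e by rewrite divr_ge0// exprn_ge0.
rewrite -(subrK (u k.+1 x) (Z x)) -addrA (le_trans (frame_normD _ _ _))// mulrDl.
apply: lerD.
  rewrite frame_norm_distC; apply: le_trans (uZ k.+1 x) _; rewrite ler_wpM2l// /e.
  by rewrite exprS invfM ler_wpM2l// ler_piMl ?invr_ge0 ?exprn_ge0// invf_le1// ler1n.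
rewrite -mulrA; by apply: picard_lip => //; exact: mulr_ge0.
Qed.

Lemma diag_part_mint (pb : 'I_n -> 'M[R]_d) (g : R -> 'M[R]_d) D : block_family pb ->
  expdec b D g -> (forall s, diag_part pb (g s) = 0) -> diag_part pb (mint g) = 0.
Proof.
move=> pbP gE g0; rewrite /diag_part big1// => i _.
rewrite -(mint_sandwich _ _ b0 gE) -[RHS](scale0r (mint g)) -(mintZ 0 b0 gE).
by congr mint; apply/funext => s; rewrite -diag_part_mull// g0 mulmx0 scale0r.
Qed.

(** This is the normalization of the fixed point: [Z - 1] has no diagonal part. [picard_ode] depends
    on it. *)
Lemma diag_part_integrator f c x : orbit_continuous f -> bounded_by f c ->
  diag_part (p x) (integrator f x) = 0.
Proof.
move=> fC fc; have pb := bf_block H x; rewrite diag_partD diag_partN.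
have [[lf lfE] _] := lower_expdec H x fC fc; have [[uf ufE] _] := upper_expdec H x fC fc.
rewrite (diag_part_mint pb lfE) ?(diag_part_mint pb ufE) ?subr0// => s.
  exact: diag_part_upper.
exact: diag_part_lower.
Qed.

(** As [Z - 1] has no diagonal part, neither has its product with the block diagonal [D]. The
    diagonal part of the integrand [B Z - (Z - 1) D] is thus [D] itself, and removing it leaves
    [B Z - Z D], the opposite of the derivative. *)
Lemma picard_ode Z x r : near_id Z -> (forall x, Z x = picard Z x) ->
  is_derive (r : R) (1 : R) (fun r => Z (phi r x))
    (- (B (phi r x) *m Z (phi r x)) + Z (phi r x) *m diag_part (p x) (B (phi r x) *m Z (phi r x))).
Proof.
move=> Zn ZE.
have gC := picard_integrand_cont Zn; have gb := picard_integrand_bound Zn.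
have -> : (fun r => Z (phi r x)) = (fun r => integrator (picard_integrand Z) (phi r x) + 1%:M).
  by apply/funext => s; rewrite ZE /picard addrC.
refine (is_derive_eq (is_derive_addc _ (integrator_derive H x r gC gb)) _).
set y := phi r x; have px : p x = p y by rewrite /y (bf_inv H).
rewrite px; have pb := bf_block H y.
have dZ : diag_part (p y) (Z y - 1%:M) = 0.
  by rewrite ZE /picard addrC addKr; exact: diag_part_integrator gC gb.
have gE := block_decomposition pb (picard_integrand Z y).
have -> : lower_part (p y) (picard_integrand Z y) + upper_part (p y) (picard_integrand Z y) =
   picard_integrand Z y - diag_part (p y) (picard_integrand Z y).
  by apply/eqP; rewrite eq_sym subr_eq; apply/eqP; rewrite {1}gE -addrA addrC.
have dE : diag_part (p y) (picard_integrand Z y) = diag_part (p y) (B y *m Z y).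
  rewrite /picard_integrand diag_partD diag_partN (diag_part_mul (Z y - 1%:M) (diag_part_comm pb (B y *m Z y))).
  by rewrite dZ mul0mx subr0.
rewrite dE /picard_integrand mulmxBl mul1mx.
move: (diag_part _ _) => e; move: (Z y *m e) (B y *m Z y) => w a.
by apply/matrixP => i j; rewrite !mxE; ring.
Qed.

(** The integrand minus [B] is [B (Z - 1) - (Z - 1) D], where every factor is of order [delta]. This
    linearization later provides the derivative of [Z] in the parameter. *)
Lemma picard_second_order Z x : near_id Z -> (forall x, Z x = picard Z x) ->
  nrm x (Z x - 1%:M - integrator B x) <=
    int_const * (int_const * pert_const * (1 + diag_const * (d%:R + 1))) * delta ^+ 2.
Proof.
move=> Zn ZE.
have gC := picard_integrand_cont Zn; have gb := picard_integrand_bound Zn.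
have -> : Z x - 1%:M - integrator B x =
    integrator (fun y => picard_integrand Z y - B y) x.
  by rewrite (integratorB H x gC gb BC Bd) ZE /picard [1%:M + _]addrC addrK.
have gB : bounded_by (fun y => picard_integrand Z y - B y)
    (delta * q + q * (diag_const * (delta * (d%:R + 1)))).
  move=> y; rewrite /picard_integrand addrAC -{2}[B y]mulmx1 -mulmxBr.
  rewrite (le_trans (frame_normB _ _ _))//; apply: lerD.
    rewrite (le_trans (frame_normM _ _ (Mu y)))//.
    by apply: ler_pM; [exact: frame_norm_ge0|exact: frame_norm_ge0|exact: Bd|exact: (proj2 Zn)].
  rewrite (le_trans (frame_normM _ _ (Mu y)))//.
  apply: ler_pM; [exact: frame_norm_ge0|exact: frame_norm_ge0|exact: (proj2 Zn)|].
  exact: near_id_diag_le.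
apply: le_trans (integrator_bound H (orbit_continuous_sub gC BC) gB x) _.
by rewrite le_eqVlt; apply/orP; left; apply/eqP; rewrite /q; ring.
Qed.

End FixedPoint.

(** * Domination for a perturbed block diagonal flow *)

Section PerturbedDomination.
Variables (R : realType) (d n : nat) (X : Type) (phi : R -> X -> X).
Variables (M : X -> 'M[R]_d) (p : X -> 'I_n -> 'M[R]_d) (b C kappa : R).
Hypothesis H : block_flow phi M p b C kappa.
Local Notation nrm x Y := (frame_norm (M x) Y).

Let Mu := bf_unit H.
Let b0 := bf_rate H.

(** The conjugate of [pb i] by the flow has zero derivative, since the generator commutes with the
    blocks. *)
Lemma diag_flow_comm (pb : 'I_n -> 'M[R]_d) (Dl De : R -> 'M[R]_d) i s :
  (forall s, De s \in unitmx) -> De 0 = 1%:M ->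
  (forall s, is_derive s (1 : R) De (- (Dl s *m De s))) ->
  (forall s i, pb i *m Dl s = Dl s *m pb i) -> De s *m pb i = pb i *m De s.
Proof.
move=> Deu De0 DeD pD.
have E : invmx (De s) *m pb i *m De s = pb i.
  have D t : is_derive t (1 : R) (fun t => invmx (De t) *m (pb i *m De t)) 0.
    refine (is_derive_eq (is_derive_mulmx (is_derive_invmx Deu (DeD t))
      (is_derive_mulmxl _ (DeD t))) _).
    rewrite !mulmxN !mulNmx opprK !mulmxA mulmxK//.
    by rewrite -(mulmxA _ (pb i) (Dl t)) pD !mulmxA addrN.
  by have := derive0_cst D s 0; rewrite De0 invmx1 mul1mx mulmx1 mulmxA.
by rewrite -{1}E !mulmxA mulmxV// mul1mx.
Qed.

(** The transported matrix [W] stays in the block [(i, j)] and has derivative [[W, Dl]]. In the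
    frame of a later time this derivative is damped by the unperturbed domination, and the error it
    accumulates is absorbed thanks to the smallness of [e], at the cost of half the rate. *)
Lemma diag_domination x (Dl De : R -> 'M[R]_d) (e : R) (i j : 'I_n) (Y : 'M[R]_d) s :
  (forall s, De s \in unitmx) -> De 0 = 1%:M ->
  (forall s, is_derive s (1 : R) De (- (Dl s *m De s))) ->
  (forall s i, p x i *m Dl s = Dl s *m p x i) ->
  0 <= e -> (forall s, nrm (phi s x) (Dl s) <= e) ->
  d%:R * (2 * C * e) <= b / 4 -> (i < j)%N -> 0 <= s ->
  nrm (phi s x) (De s *m (p x i *m Y *m p x j) *m invmx (De s)) <=
    2 * C * expR (- (b / 2) * s) * nrm x Y.
Proof.
move=> Deu De0 DeD pD e0 De_e small ij s0.
have pb := bf_block H x; have C0 := bf_C H.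
have comm k t := diag_flow_comm k t Deu De0 DeD pD.
have commV k t : invmx (De t) *m p x k = p x k *m invmx (De t).
  by rewrite -[LHS](mulmxK (Deu t)) -(mulmxA (invmx _)) -comm mulmxA mulVmx// mul1mx.
set P0 := p x i *m Y *m p x j.
pose W t := De t *m P0 *m invmx (De t).
have WE t : W t = p x i *m W t *m p x j.
  rewrite /W /P0 !mulmxA -comm -!mulmxA commV !mulmxA.
  rewrite -(mulmxA (De t) (p x i) (p x i)) (block_idem pb).
  by rewrite -[in RHS](mulmxA _ (p x j) (p x j)) (block_idem pb).
have WD t : is_derive t (1 : R) W (- (Dl t *m W t) + W t *m Dl t).
  refine (is_derive_eq (is_derive_mulmx (is_derive_mulmxr P0 (DeD t)) (is_derive_invmx Deu (DeD t))) _).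
  by rewrite /W !(mulNmx, mulmxN) opprK !mulmxA mulmxK.
have VE t : - (Dl t *m W t) + W t *m Dl t = p x i *m (- (Dl t *m W t) + W t *m Dl t) *m p x j.
  rewrite mulmxDr mulmxDl mulmxN mulNmx {1 2}WE.
  by rewrite !mulmxA -!(pD t) -!mulmxA -!(pD t) !mulmxA.
pose y t := nrm (phi t x) (W t).
have y0 t : 0 <= y t by exact: frame_norm_ge0.
pose b' := b / 2; have b'0 : 0 < b' by rewrite divr_gt0.
pose w t := expR (b' * t) * y t.
have wC : continuous w.
  move=> t; apply: cvgM; first exact: is_derive_at_cvg (is_derive_expRM b' t).
  apply: cvg_frame_norm; [by move=> u; exact: Mu|exact: Mu|exact: (bf_cont H)|].
  exact: is_derive_at_cvg (WD t).
(* The norm at [phi t x] is only known to be continuous in [t], so instead of a differential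
   inequality the weighted norm is estimated at the time [c] where it is largest on [[0, s]]. *)
have [c c0s wmax] := EVT_max s0 (continuous_subspaceT wC).
have /andP[c0 cs] : 0 <= c <= s by move: c0s; rewrite in_itv.
set S := w c.
have S0 : 0 <= S by rewrite mulr_ge0// expR_ge0.
have yS t : 0 <= t <= c -> y t <= expR (- b' * t) * S.
  move=> /andP[t0 tc]; have : w t <= S by apply: wmax; rewrite in_itv /= t0 (le_trans tc).
  by rewrite /w mulNr expRN -ler_pdivlMl ?expR_gt0.
pose Mc := M (phi c x).
(* The derivative at time [t] lies in the block [(i, j)], so [bf_up] carries it to the frame at
   [phi c x] with the factor [expR (- b * (c - t))]. *)
have bound t : 0 <= t <= c ->
    `|invmx Mc *m (- (Dl t *m W t) + W t *m Dl t) *m Mc| <= (2 * C * e * S * expR (- b * c)) * expR (b' * t).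
  move=> tc; apply: le_trans (conj_le_frame_norm _ _) _; rewrite VE.
  have /andP[t0 tc'] := tc.
  have ct : 0 <= c - t by rewrite subr_ge0.
  have := bf_up H (phi t x) (- (Dl t *m W t) + W t *m Dl t) ij ct.
  rewrite (bf_flowD H) subrK (bf_inv H) => /le_trans; apply.
  have N : nrm (phi t x) (- (Dl t *m W t) + W t *m Dl t) <= 2 * e * (expR (- b' * t) * S).
    rewrite (le_trans (frame_normD _ _ _))// frame_normN.
    have h1 : nrm (phi t x) (Dl t *m W t) <= e * (expR (- b' * t) * S).
      apply: le_trans (frame_normM _ _ (Mu _)) _.
      by apply: ler_pM; [exact: frame_norm_ge0|exact: frame_norm_ge0|exact: De_e|exact: yS].
    have h2 : nrm (phi t x) (W t *m Dl t) <= (expR (- b' * t) * S) * e.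
      apply: le_trans (frame_normM _ _ (Mu _)) _.
      by apply: ler_pM; [exact: frame_norm_ge0|exact: frame_norm_ge0|exact: yS|exact: De_e].
    by apply: le_trans (lerD h1 h2) _; rewrite le_eqVlt; apply/orP; left; apply/eqP; ring.
  apply: (@le_trans _ _ (C * expR (- b * (c - t)) * (2 * e * (expR (- b' * t) * S)))).
    by apply: ler_wpM2l => //; rewrite mulr_ge0// expR_ge0.
  have -> : expR (- b * (c - t)) = expR (- b * c) * (expR (b' * t) * expR (b' * t)).
    by rewrite -!expRD; congr expR; rewrite /b'; field.
  have E1 : expR (b' * t) * expR (- b' * t) = 1 by rewrite -expRD mulNr subrr expR0.
  rewrite [leLHS](_ : _ = (2 * C * e * S * expR (- b * c)) * expR (b' * t) * (expR (b' * t) * expR (- b' * t))); last by ring.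
  by rewrite E1 mulr1.
have incr : `|invmx Mc *m W c *m Mc - invmx Mc *m W 0 *m Mc| <= (2 * C * e * S * expR (- b' * c)) / b'.
  pose K := 2 * C * e * S * expR (- b * c).
  have GD t : is_derive t (1 : R) (fun t => (K / b') *: expR (b' * t)) (K * expR (b' * t)).
    refine (is_derive_eq (is_derive_scalefun (K / b') (is_derive_expRM b' t)) _).
    by rewrite -[LHS]/(K / b' * (b' * expR (b' * t))) mulrA divfK// lt0r_neq0.
  have := @mx_derive_norm _ _ _ (fun t => invmx Mc *m W t *m Mc)
    (fun t => invmx Mc *m (- (Dl t *m W t) + W t *m Dl t) *m Mc)
    _ _ 0 c c0 (fun t _ => is_derive_mulmxr Mc (is_derive_mulmxl (invmx Mc) (WD t))) (fun t _ => GD t) bound.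
  move=> /le_trans; apply.
  rewrite -scalerBr mulr0 expR0 -[leLHS]/(K / b' * (expR (b' * c) - 1)).
  have K0 : 0 <= K / b' by rewrite divr_ge0 ?(ltW b'0)// !mulr_ge0 ?expR_ge0.
  apply: (@le_trans _ _ (K / b' * expR (b' * c))); first by rewrite ler_wpM2l// gerBl.
  rewrite /K; have -> : expR (- b' * c) = expR (- b * c) * expR (b' * c).
    by rewrite -expRD; congr expR; rewrite /b'; field.
  by rewrite le_eqVlt; apply/orP; left; apply/eqP; field; exact: lt0r_neq0.
have y0c : nrm (phi c x) (W 0) <= C * expR (- b * c) * nrm x Y.
  by rewrite /W De0 invmx1 mul1mx mulmx1; exact: (bf_up H).
(* The smallness hypothesis makes the accumulated error at most [S / 2], which is moved to the
   left. *)
have SE : S <= 2 * C * nrm x Y.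
  have yc : y c <= C * expR (- b * c) * nrm x Y + d%:R * ((2 * C * e * S * expR (- b' * c)) / b').
    rewrite /y -(subrK (W 0) (W c)) addrC (le_trans (frame_normD _ _ _))// lerD//.
    by rewrite frame_normE ler_wpM2l// mulmxBr mulmxBl.
  have E1 : expR (b' * c) * expR (- b' * c) = 1 by rewrite -expRD mulNr subrr expR0.
  have E2 : expR (b' * c) * expR (- b * c) <= 1.
    by rewrite -expRD -expR0 ler_expR /b'; have := mulr_ge0 (ltW b0) c0; lra.
  have : S <= expR (b' * c) * (C * expR (- b * c) * nrm x Y + d%:R * ((2 * C * e * S * expR (- b' * c)) / b')).
    by rewrite ler_wpM2l ?expR_ge0.
  have -> : expR (b' * c) * (C * expR (- b * c) * nrm x Y + d%:R * ((2 * C * e * S * expR (- b' * c)) / b')) =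
    C * nrm x Y * (expR (b' * c) * expR (- b * c)) + (d%:R * (2 * C * e)) / b' * S * (expR (b' * c) * expR (- b' * c)).
    by rewrite /b'; field; rewrite (lt0r_neq0 b0).
  rewrite E1 mulr1.
  have h1 : C * nrm x Y * (expR (b' * c) * expR (- b * c)) <= C * nrm x Y.
    by apply: ler_piMr => //; rewrite mulr_ge0// frame_norm_ge0.
  have h2 : d%:R * (2 * C * e) / b' * S <= 2^-1 * S.
    apply: ler_wpM2r => //; rewrite ler_pdivrMr// /b'; move: small; lra.
  by move: h1 h2; lra.
have : w s <= S by apply: wmax; rewrite in_itv /= s0 lexx.
rewrite /w => ws; have : y s <= expR (- b' * s) * S.
  by rewrite mulNr expRN ler_pdivlMl ?expR_gt0.
move=> /le_trans; apply; rewrite -/b'.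
apply: (@le_trans _ _ (expR (- b' * s) * (2 * C * nrm x Y))).
  by rewrite ler_wpM2l ?expR_ge0.
by rewrite le_eqVlt; apply/orP; left; apply/eqP; ring.
Qed.

End PerturbedDomination.

Section PerturbedBlocks.
Variables (R : realType) (d n : nat) (X : Type) (phi : R -> X -> X).
Variables (M : X -> 'M[R]_d) (p : X -> 'I_n -> 'M[R]_d) (b C kappa : R).
Hypothesis H : block_flow phi M p b C kappa.
Local Notation nrm x Y := (frame_norm (M x) Y).
Variables (B : X -> 'M[R]_d) (delta : R).
Hypotheses (BC : orbit_continuous phi B) (Bd : bounded_by M B delta).
Hypothesis small : int_const d n b C * pert_const d n kappa * delta <= 4^-1.
Hypothesis small' : d%:R * (2 * C * (diag_const n kappa * (delta * (d%:R + 1)))) <= b / 4.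
Hypothesis delta0 : 0 <= delta.
Variable Z : X -> 'M[R]_d.
Hypothesis Zn : near_id n phi M b C kappa delta Z.
Hypothesis ZE : forall x, Z x = picard phi p B Z x.

Let Mu := bf_unit H.

Definition conj_block x i := Z x *m p x i *m invmx (Z x).

Lemma near_id_inv x : Z x \in unitmx /\ nrm x (invmx (Z x)) <= 2 * d%:R.
Proof.
apply: near_id_unit => //; apply: le_trans (proj2 Zn x) _.
by apply: le_trans small _; lra.
Qed.

Variables (x : X) (U : R -> 'M[R]_d).
Hypotheses (Uu : forall s, U s \in unitmx) (U0 : U 0 = 1%:M).
Hypothesis UD : forall s, is_derive (s : R) (1 : R) U (- (B (phi s x) *m U s)).

(** [U] is the perturbed cocycle over the orbit of [x], [De] its conjugate by [Z], and [Dl] the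
    generator of [De] up to sign. *)
Let De s := invmx (Z (phi s x)) *m U s *m Z x.
Let Dl s := diag_part (p x) (B (phi s x) *m Z (phi s x)).
Let Zu y : Z y \in unitmx := proj1 (near_id_inv y).

Let Deu s : De s \in unitmx.
Proof. by rewrite /De !unitmx_mul unitmx_inv !Zu Uu. Qed.

Let De0 : De 0 = 1%:M.
Proof. by rewrite /De U0 mulmx1 (bf_flow0 H) mulVmx. Qed.

Let DeD s : is_derive (s : R) (1 : R) De (- (Dl s *m De s)).
Proof.
(* In the derivative of [V = U^-1 Z] the terms in [B] cancel and [V' = V Dl] remains; [De] is [V^-1]
   times a constant. *)
pose V t := invmx (U t) *m Z (phi t x).
have Vu t : V t \in unitmx by rewrite /V unitmx_mul unitmx_inv Zu Uu.
have VD t : is_derive (t : R) (1 : R) V (V t *m Dl t).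
  have ZD := picard_ode H BC Bd small delta0 x t Zn ZE.
  refine (is_derive_eq (is_derive_mulmx (is_derive_invmx Uu (UD t)) ZD) _).
  rewrite /V !(mulmxN, mulNmx) opprK mulmxDr mulmxN !mulmxA mulmxK//.
  by rewrite addrA addrN add0r.
have -> : De = fun t => invmx (V t) *m Z x.
  by apply/funext => t; rewrite /De /V invmx_mulmx ?invmxK// unitmx_inv.
refine (is_derive_eq (is_derive_mulmxr (Z x) (is_derive_invmx Vu (VD s))) _).
by rewrite (mulKmx (Vu s)) mulNmx mulmxA.
Qed.

Let comm i s : De s *m p x i = p x i *m De s.
Proof.
apply: (diag_flow_comm i s Deu De0 DeD) => t k.
exact: (diag_part_comm (bf_block H x)).
Qed.

Let UE s : U s = Z (phi s x) *m De s *m invmx (Z x).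
Proof. by rewrite /De !mulmxA mulmxV// mul1mx mulmxK. Qed.

Let UVE s : invmx (U s) = Z x *m invmx (De s) *m invmx (Z (phi s x)).
Proof.
have ZDu : Z (phi s x) *m De s \in unitmx by rewrite unitmx_mul Zu Deu.
have ZVu : invmx (Z x) \in unitmx by rewrite unitmx_inv Zu.
by rewrite {1}UE (invmx_mulmx ZDu ZVu) (invmx_mulmx (Zu _) (Deu _)) invmxK mulmxA.
Qed.

(** [U] is [De] conjugated by [Z], and [De] commutes with the blocks: the conjugated blocks are
    invariant under the perturbed flow. *)
Lemma perturbed_conj i s : U s *m conj_block x i *m invmx (U s) = conj_block (phi s x) i.
Proof.
rewrite UVE UE; move: (comm i s) (Deu s); move: (De s) => D DpC Du.
rewrite /conj_block !mulmxA (bf_inv H) !(mulmxKV (Zu _)) -(mulmxA _ D) DpC !mulmxA.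
by rewrite mulmxK.
Qed.

(** [diag_domination] conjugated by [Z] at both ends of the orbit segment: each end costs [d + 1]
    for [Z] and [2 * d] for its inverse. *)
Lemma perturbed_domination (i j : 'I_n) (Y : 'M[R]_d) s : (i < j)%N -> 0 <= s ->
  nrm (phi s x) (U s *m (conj_block x i *m Y *m conj_block x j) *m invmx (U s)) <=
    (d%:R + 1) ^+ 2 * (2 * d%:R) ^+ 2 * (2 * C) * expR (- (b / 2) * s) * nrm x Y.
Proof.
move=> ij s0.
have -> : U s *m (conj_block x i *m Y *m conj_block x j) *m invmx (U s) =
  Z (phi s x) *m (De s *m (p x i *m (invmx (Z x) *m Y *m Z x) *m p x j) *m invmx (De s)) *m invmx (Z (phi s x)).
  by rewrite UVE UE /conj_block; move: (De s) => D; rewrite !mulmxA !(mulmxKV (Zu _)).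
set e := diag_const n kappa * (delta * (d%:R + 1)).
have e0 : 0 <= e.
  by apply: mulr_ge0; [exact: diag_const_ge0|apply: mulr_ge0 => //; exact: addr_ge0].
have De_e t : nrm (phi t x) (Dl t) <= e.
  by rewrite /Dl -(bf_inv H t x); exact: (near_id_diag_le H Bd small (phi t x) Zn).
have dom := diag_domination H (invmx (Z x) *m Y *m Z x) Deu De0 DeD
  (fun t k => diag_part_comm (bf_block H x) _ k) e0 De_e small' ij s0.
have Zle y : nrm y (Z y) <= d%:R + 1 by exact: (near_id_le H small y Zn).
have ZVle y : nrm y (invmx (Z y)) <= 2 * d%:R := proj2 (near_id_inv y).
have F := frame_norm_ge0.
have ZYZ : nrm x (invmx (Z x) *m Y *m Z x) <= (2 * d%:R) * nrm x Y * (d%:R + 1).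
  apply: le_trans (frame_normM _ _ (Mu _)) _.
  apply: ler_pM; [exact: F|exact: F| |exact: Zle].
  apply: le_trans (frame_normM _ _ (Mu _)) _.
  by apply: ler_wpM2r; [exact: F|exact: ZVle].
have K0 : 0 <= 2 * C * expR (- (b / 2) * s).
  by rewrite mulr_ge0 ?expR_ge0// mulr_ge0 ?(bf_C H).
have dom' := le_trans dom (ler_wpM2l K0 ZYZ).
apply: le_trans (frame_normM _ _ (Mu _)) _.
apply: (@le_trans _ _ (((d%:R + 1) * (2 * C * expR (- (b / 2) * s) * ((2 * d%:R) * nrm x Y * (d%:R + 1)))) * (2 * d%:R))); last first.
  by rewrite le_eqVlt; apply/orP; left; apply/eqP; ring.
apply: ler_pM; [exact: F|exact: F| |exact: ZVle].
apply: le_trans (frame_normM _ _ (Mu _)) _.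
by apply: ler_pM; [exact: F|exact: F|exact: Zle|exact: dom'].
Qed.

End PerturbedBlocks.

(** * Flows on the unit tangent bundle and trivializations *)

Section Flows.
Variable R : realType.
Implicit Types (X W Y : 'rV[R]_3) (s r : R) (x y : UH2 R).

Lemma vec3_eq X Y : c0 X = c0 Y -> c1 X = c1 Y -> c2 X = c2 Y -> X = Y.
Proof.
rewrite /c0 /c1 /c2 => h0 h1 h2; apply/rowP => -[[|[|[|i]]] hi] //.
- by rewrite (_ : Ordinal hi = @Ordinal 3 0 isT)//; exact: val_inj.
- by rewrite (_ : Ordinal hi = @Ordinal 3 1 isT)//; exact: val_inj.
- by rewrite (_ : Ordinal hi = @Ordinal 3 2 isT)//; exact: val_inj.
Qed.

Lemma coshD s r : coshR (s + r) = coshR s * coshR r + sinhR s * sinhR r :> R.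
Proof. by rewrite /coshR /sinhR opprD !expRD; field. Qed.

Lemma sinhD s r : sinhR (s + r) = sinhR s * coshR r + coshR s * sinhR r :> R.
Proof. by rewrite /coshR /sinhR opprD !expRD; field. Qed.

Lemma cosh0 : coshR 0 = 1 :> R.
Proof. by rewrite /coshR oppr0 expR0; field. Qed.

Lemma sinh0 : sinhR 0 = 0 :> R.
Proof. by rewrite /sinhR oppr0 expR0; field. Qed.

(** The base point and the normal undergo the same hyperbolic rotation in their plane, which makes
    [nflow] additive in time. [normal_rot] plays this part for [rflow]. *)
Lemma normal_slide X W s : uh2_set (X, W) ->
  unit_normal (coshR s *: X + sinhR s *: unit_normal X W) W =
  coshR s *: unit_normal X W + sinhR s *: X.
Proof.
move=> [/= _ _ WW XW]; move: WW XW; rewrite /lorentz => WW XW.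
apply: vec3_eq; rewrite !coordE.
- transitivity (coshR s * (c2 X * c1 W - c1 X * c2 W) + sinhR s *
    (c0 X * (c1 W * c1 W + c2 W * c2 W - c0 W * c0 W) - c0 W * (c1 X * c1 W + c2 X * c2 W - c0 X * c0 W))); first by ring.
  by rewrite WW XW; ring.
- transitivity (coshR s * (c2 X * c0 W - c0 X * c2 W) + sinhR s *
    (c1 X * (c1 W * c1 W + c2 W * c2 W - c0 W * c0 W) - c1 W * (c1 X * c1 W + c2 X * c2 W - c0 X * c0 W))); first by ring.
  by rewrite WW XW; ring.
- transitivity (coshR s * (c0 X * c1 W - c1 X * c0 W) + sinhR s *
    (c2 X * (c1 W * c1 W + c2 W * c2 W - c0 W * c0 W) - c2 W * (c1 X * c1 W + c2 X * c2 W - c0 X * c0 W))); first by ring.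
  by rewrite WW XW; ring.
Qed.

Lemma normal_rot X W s : uh2_set (X, W) ->
  unit_normal X (cos s *: W + sin s *: unit_normal X W) =
  cos s *: unit_normal X W - sin s *: W.
Proof.
move=> [/= XX _ _ XW]; move: XX XW; rewrite /lorentz => XX XW.
rewrite -scaleNr; apply: vec3_eq; rewrite !coordE.
- transitivity (cos s * (c2 X * c1 W - c1 X * c2 W) + sin s *
    (c0 W * (c1 X * c1 X + c2 X * c2 X - c0 X * c0 X) - c0 X * (c1 X * c1 W + c2 X * c2 W - c0 X * c0 W))); first by ring.
  by rewrite XX XW; ring.
- transitivity (cos s * (c2 X * c0 W - c0 X * c2 W) + sin s *
    (c1 W * (c1 X * c1 X + c2 X * c2 X - c0 X * c0 X) - c1 X * (c1 X * c1 W + c2 X * c2 W - c0 X * c0 W))); first by ring.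
  by rewrite XX XW; ring.
- transitivity (cos s * (c0 X * c1 W - c1 X * c0 W) + sin s *
    (c2 W * (c1 X * c1 X + c2 X * c2 X - c0 X * c0 X) - c2 X * (c1 X * c1 W + c2 X * c2 W - c0 X * c0 W))); first by ring.
  by rewrite XX XW; ring.
Qed.

Lemma flow0 i x : flow i 0 x = x.
Proof.
apply: val_inj; rewrite [RHS]surjective_pairing.
by case: i; rewrite /= ?cosh0 ?sinh0 ?cos0 ?sin0 !scale0r scale1r ?scale1r ?addr0 ?add0r.
Qed.

Lemma flowD i s r x : flow i s (flow i r x) = flow i (s + r) x.
Proof.
apply: val_inj; have xP := uh2P x; case: i => /=.
- by congr pair; rewrite coshD sinhD !scalerDr !scalerDl !scalerA addrACA; [|rewrite [X in _ + X]addrC]; congr (_ + _); rewrite addrC.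
- congr pair; rewrite normal_slide// coshD sinhD; move: (unit_normal _ _) => N.
  by apply/rowP => k; rewrite !mxE; ring.
- congr pair; rewrite normal_rot// cosD sinD; move: (unit_normal _ _) => N.
  by apply/rowP => k; rewrite !mxE; ring.
Qed.

Lemma is_derive_coshR s : is_derive s (1 : R) (@coshR R) (sinhR s).
Proof.
have D := is_derive_addfun (is_derive_expRM 1 s) (is_derive_expRM (-1) s).
have -> : @coshR R = fun t => 2^-1 *: (expR (1 * t) + expR (-1 * t)).
  by apply/funext => t; rewrite /coshR mul1r mulN1r mulrC.
refine (is_derive_eq (is_derive_scalefun 2^-1 D) _).
by rewrite -[LHS]/(2^-1 * _) /sinhR !mul1r !mulN1r mulrC.
Qed.

Lemma is_derive_sinhR s : is_derive s (1 : R) (@sinhR R) (coshR s).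
Proof.
have D := is_derive_subfun (is_derive_expRM 1 s) (is_derive_expRM (-1) s).
have -> : @sinhR R = fun t => 2^-1 *: (expR (1 * t) - expR (-1 * t)).
  by apply/funext => t; rewrite /sinhR mul1r mulN1r mulrC.
refine (is_derive_eq (is_derive_scalefun 2^-1 D) _).
by rewrite -[LHS]/(2^-1 * _) /coshR !mul1r !mulN1r mulrC opprK.
Qed.

Lemma continuous_flow i x : continuous (fun s => flow i s x).
Proof.
have cC : continuous (@coshR R) by apply: is_derive_continuous is_derive_coshR.
have sC : continuous (@sinhR R) by apply: is_derive_continuous is_derive_sinhR.
have comb (a c : R -> R) X W : continuous a -> continuous c -> continuous (fun s => a s *: X + c s *: W).
  move=> aC cC' s; apply: cvgD; apply: cvgZ; try exact: cvg_cst; [exact: aC|exact: cC'].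
have cstC X : continuous (fun _ : R => X) by move=> s; exact: cvg_cst.
apply: (@continuous_comp_initial (UH2 R) R _ set_val) => s.
have pairC (F G : R -> 'rV[R]_3) : continuous F -> continuous G -> (F t, G t) @[t --> s] --> (F s, G s).
  by move=> FC GC; exact: (cvg_pair (FC s) (GC s)).
case: i; rewrite /= /comp /=; apply: pairC; rewrite ?set_valE/=.
- exact: comb.
- exact: comb.
- exact: comb.
- exact: cstC.
- exact: cstC.
- by apply: comb; [exact: continuous_cos|exact: continuous_sin].
Qed.

Lemma sinhR_surj (a : R) : exists s, sinhR s = a.
Proof.
have q0 : 0 <= 1 + a ^+ 2 by rewrite addr_ge0// sqr_ge0.
pose u := a + Num.sqrt (1 + a ^+ 2).
have sq : Num.sqrt (1 + a ^+ 2) ^+ 2 = 1 + a ^+ 2 by rewrite sqr_sqrtr.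
have s0 : 0 <= Num.sqrt (1 + a ^+ 2) by exact: sqrtr_ge0.
have u0 : 0 < u.
  rewrite /u; have [a0|a0] := leP 0 a.
    have : 0 < Num.sqrt (1 + a ^+ 2) by rewrite sqrtr_gt0 ltr_pwDl// sqr_ge0.
    by lra.
  by nra.
exists (ln u); rewrite /sinhR expRN lnK ?posrE//.
have -> : u^-1 = Num.sqrt (1 + a ^+ 2) - a.
  apply: (mulfI (lt0r_neq0 u0)); rewrite divff ?lt0r_neq0// /u.
  by move: sq; set z := Num.sqrt _ => sq; ring: sq.
by rewrite /u; field.
Qed.

Lemma coshR_ge0 s : 0 < coshR s :> R.
Proof. by rewrite /coshR divr_gt0// addr_gt0// expR_gt0. Qed.

Lemma circle_param (a c : R) : a ^+ 2 + c ^+ 2 = 1 -> exists t, cos t = a /\ sin t = c.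
Proof.
move=> ac; have a1 : -1 <= a <= 1.
  by have := sqr_ge0 c => c2; apply/andP; split; nra.
have ca : cos (acos a) = a by rewrite acosK// in_itv.
have sa : sin (acos a) = `|c|.
  by rewrite sin_acos// -sqrtr_sqr; congr Num.sqrt; lra.
have [c0|c0] := leP 0 c.
  by exists (acos a); rewrite ca sa ger0_norm.
by exists (- acos a); rewrite cosN sinN ca sa ltr0_norm// opprK.
Qed.

(** [X], [V] and the normal [N] form a Lorentz orthonormal basis, so [- X X^T + V V^T + N N^T] is
    the diagonal matrix with entries -1, 1, 1. The facts [n00] to [n12] are the six entries of this
    relation. *)
Lemma frame_decomposition X V W : uh2_set (X, V) -> lorentz X W = 0 ->
  W = lorentz W V *: V + lorentz W (unit_normal X V) *: unit_normal X V.
Proof.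
move=> [/= XX _ VV XV]; move: XX VV XV; rewrite /lorentz => XX VV XV XW.
set N := unit_normal X V.
have N0E : c0 N = c2 X * c1 V - c1 X * c2 V by rewrite c0N.
have N1E : c1 N = c2 X * c0 V - c0 X * c2 V by rewrite c1N.
have N2E : c2 N = c0 X * c1 V - c1 X * c0 V by rewrite c2N.
suff [e0 [e1 e2]] : c0 W = (c1 W * c1 V + c2 W * c2 V - c0 W * c0 V) * c0 V +
    (c1 W * c1 N + c2 W * c2 N - c0 W * c0 N) * c0 N /\
  c1 W = (c1 W * c1 V + c2 W * c2 V - c0 W * c0 V) * c1 V +
    (c1 W * c1 N + c2 W * c2 N - c0 W * c0 N) * c1 N /\
  c2 W = (c1 W * c1 V + c2 W * c2 V - c0 W * c0 V) * c2 V +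
    (c1 W * c1 N + c2 W * c2 N - c0 W * c0 N) * c2 N.
  by apply: vec3_eq; rewrite !(c0Z, c1Z, c2Z).
move: (c0 N) (c1 N) (c2 N) N0E N1E N2E => {N} N0 N1 N2 N0E N1E N2E.
move: (c0 X) (c1 X) (c2 X) (c0 V) (c1 V) (c2 V) (c0 W) (c1 W) (c2 W) XX VV XV XW N0E N1E N2E
  => X0 X1 X2 V0 V1 V2 W0 W1 W2 XX VV XV XW N0E N1E N2E.
have n00 : N0 * N0 = X0 * X0 - 1 - V0 * V0.
  transitivity ((X1 * X1 + X2 * X2) * (V1 * V1 + V2 * V2) - (X1 * V1 + X2 * V2) ^+ 2).
    by rewrite N0E; ring.
  have -> : X1 * X1 + X2 * X2 = X0 * X0 - 1 by lra.
  have -> : V1 * V1 + V2 * V2 = V0 * V0 + 1 by lra.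
  have -> : X1 * V1 + X2 * V2 = X0 * V0 by lra.
  by ring.
have n11 : N1 * N1 = 1 + X1 * X1 - V1 * V1.
  transitivity ((X0 * V0 - X2 * V2) ^+ 2 + (X0 * X0 - X2 * X2) * (V2 * V2 - V0 * V0)).
    by rewrite N1E; ring.
  have -> : X0 * V0 - X2 * V2 = X1 * V1 by lra.
  have -> : X0 * X0 - X2 * X2 = 1 + X1 * X1 by lra.
  have -> : V2 * V2 - V0 * V0 = 1 - V1 * V1 by lra.
  by ring.
have n22 : N2 * N2 = 1 + X2 * X2 - V2 * V2.
  transitivity ((X0 * V0 - X1 * V1) ^+ 2 + (X0 * X0 - X1 * X1) * (V1 * V1 - V0 * V0)).
    by rewrite N2E; ring.
  have -> : X0 * V0 - X1 * V1 = X2 * V2 by lra.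
  have -> : X0 * X0 - X1 * X1 = 1 + X2 * X2 by lra.
  have -> : V1 * V1 - V0 * V0 = 1 - V2 * V2 by lra.
  by ring.
have n01 : N0 * N1 = X0 * X1 - V0 * V1.
  transitivity (V0 * V1 * (X2 * X2) + X0 * X1 * (V2 * V2) - (X0 * V1 + X1 * V0) * (X2 * V2)).
    by rewrite N0E N1E; ring.
  have -> : X2 * X2 = X0 * X0 - 1 - X1 * X1 by lra.
  have -> : V2 * V2 = V0 * V0 + 1 - V1 * V1 by lra.
  have -> : X2 * V2 = X0 * V0 - X1 * V1 by lra.
  by ring.
have n02 : N0 * N2 = X0 * X2 - V0 * V2.
  transitivity (V0 * V2 * (X1 * X1) + X0 * X2 * (V1 * V1) - (X0 * V2 + X2 * V0) * (X1 * V1)).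
    by rewrite N0E N2E; ring.
  have -> : X1 * X1 = X0 * X0 - 1 - X2 * X2 by lra.
  have -> : V1 * V1 = V0 * V0 + 1 - V2 * V2 by lra.
  have -> : X1 * V1 = X0 * V0 - X2 * V2 by lra.
  by ring.
have n12 : N1 * N2 = X1 * X2 - V1 * V2.
  transitivity ((X2 * V1 + X1 * V2) * (X0 * V0) - X1 * X2 * (V0 * V0) - V1 * V2 * (X0 * X0)).
    by rewrite N1E N2E; ring.
  have -> : X0 * X0 = X1 * X1 + X2 * X2 + 1 by lra.
  have -> : V0 * V0 = V1 * V1 + V2 * V2 - 1 by lra.
  have -> : X0 * V0 = X1 * V1 + X2 * V2 by lra.
  by ring.
split; [|split].
- transitivity (W1 * (V0 * V1 + N0 * N1) + W2 * (V0 * V2 + N0 * N2) - W0 * (V0 * V0 + N0 * N0)); last by ring.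
  rewrite n00 n01 n02.
  transitivity (X0 * (X1 * W1 + X2 * W2 - X0 * W0) + W0); last by ring.
  by rewrite XW; ring.
- transitivity (W1 * (V1 * V1 + N1 * N1) + W2 * (V1 * V2 + N1 * N2) - W0 * (V0 * V1 + N0 * N1)); last by ring.
  rewrite n11 n01 n12.
  transitivity (X1 * (X1 * W1 + X2 * W2 - X0 * W0) + W1); last by ring.
  by rewrite XW; ring.
- transitivity (W1 * (V1 * V2 + N1 * N2) + W2 * (V2 * V2 + N2 * N2) - W0 * (V0 * V2 + N0 * N2)); last by ring.
  rewrite n22 n02 n12.
  transitivity (X2 * (X1 * W1 + X2 * W2 - X0 * W0) + W2); last by ring.
  by rewrite XW; ring.
Qed.

Definition base_point : UH2 R.
Proof.
apply: (@mkUH2 R (vec3 1 0 0, vec3 0 1 0)).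
by split; rewrite /= /lorentz /c0 /c1 /c2 !mxE /=; [ring|exact: ltr01|ring|ring].
Defined.

(** This plays the role of connectedness: each point is the end of a path of three flow segments
    from [base_point], along the initial geodesic, then orthogonally to it, then by rotating the
    vector. *)
Lemma flow_transitive (P : UH2 R -> Prop) : P base_point ->
  (forall i s x, P x -> P (flow i s x)) -> forall x, P x.
Proof.
move=> P0 Pf x; have [x1 x0 x2 x12] := uh2P x.
set X := (\val x).1 in x1 x0 x2 x12; set W := (\val x).2 in x2 x12.
(* After time [r] along the geodesic and [q] orthogonally to it, the point is
   [(cosh q cosh r, cosh q sinh r, sinh q)]; this determines [q], then [r]. *)
have [q qE] := sinhR_surj (c2 X).
have Cq := coshR_ge0 q; have q2 := coshR2 q.
have [r rE] := sinhR_surj (c1 X / coshR q).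
have Cr := coshR_ge0 r; have r2 := coshR2 r.
pose y := flow Dn q (flow Ds r base_point).
have [v0 [v1 v2]] : c0 (vec3 (1 : R) 0 0) = 1 /\ c1 (vec3 (1 : R) 0 0) = 0 /\ c2 (vec3 (1 : R) 0 0) = 0.
  by rewrite /c0 /c1 /c2 !mxE.
have [w0 [w1 w2]] : c0 (vec3 0 (1 : R) 0) = 0 /\ c1 (vec3 0 (1 : R) 0) = 1 /\ c2 (vec3 0 (1 : R) 0) = 0.
  by rewrite /c0 /c1 /c2 !mxE.
rewrite /lorentz /= in x1.
have yX : (\val y).1 = X.
  apply: vec3_eq; rewrite /y /= !coordE v0 v1 v2 w0 w1 w2.
  - rewrite !(mulr0, mulr1, addr0, add0r, mul0r, subr0, subrr, oppr0).
    have CC0 : 0 <= coshR q * coshR r := mulr_ge0 (ltW Cq) (ltW Cr).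
    apply/eqP; rewrite -(@eqrXn2 _ 2%N _ _ isT CC0 (ltW x0)); apply/eqP.
    transitivity (coshR q ^+ 2 * (1 + (c1 X / coshR q) ^+ 2)).
      by rewrite exprMn -rE; congr (_ * _); lra.
    transitivity (coshR q ^+ 2 + c1 X ^+ 2); first by field; exact: lt0r_neq0.
    by have -> : coshR q ^+ 2 = 1 + c2 X ^+ 2; [rewrite -qE; lra|lra].
  - rewrite !(mulr0, mulr1, addr0, add0r, mul0r, subr0, subrr, oppr0) rE.
    by rewrite mulrCA divff ?lt0r_neq0// mulr1.
  - rewrite !(mulr0, mulr1, addr0, add0r, mul0r, subr0, subrr, oppr0) qE.
    by rewrite -!expr2 r2 mulr1.
have Py : P y by exact: (Pf Dn q _ (Pf Ds r _ P0)).
have yP := uh2P y; rewrite yX in yP.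
set V := (\val y).2 in yP; have [[/= _ _ NN XN] VN] := uh2_normal yP.
have [/= _ _ VV XV] := yP.
pose N := unit_normal X V.
have WE : W = lorentz W V *: V + lorentz W N *: N.
  exact: (frame_decomposition yP x12).
have [t [tc ts]] : exists t, cos t = lorentz W V /\ sin t = lorentz W N.
  apply: circle_param; transitivity (lorentz W W); last exact: x2.
  have bil a c : lorentz W (a *: V + c *: N) = a * lorentz W V + c * lorentz W N.
    by rewrite /lorentz !c0Z !c1Z !c2Z; ring.
  by rewrite !expr2 -bil -WE.
suff -> : x = flow Dr t y by exact: Pf.
apply: val_inj; transitivity (X, W); first exact: surjective_pairing.
transitivity ((\val y).1, cos t *: V + sin t *: unit_normal (\val y).1 V); last by [].
by rewrite yX tc ts -WE.
Qed.

End Flows.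

(** * Differentiation of a linear equation in a parameter *)

Section ParameterDerivative.
Variables (R : realType) (d : nat).
Implicit Types (c Y : R -> R -> 'M[R]_d) (g F : R -> 'M[R]_d).

(** At [t = 0] the solution is the identity, so the first order term of [Y t] is minus the primitive
    of the first order term of the coefficient. Convergence of the quotients is assumed at [t = 0]
    only, and everything is compared directly on [[0, a]]. *)
Lemma ode_param_derive c Y g F (y0 : 'M[R]_d) (a : R) : 0 <= a ->
  (\forall t \near (0 : R), forall s, is_derive (s : R) (1 : R) (Y t) (- (c t s *m Y t s))) ->
  (forall s, Y 0 s = 1%:M) ->
  is_derive (0 : R) (1 : R) (fun t => Y t 0) (- y0) ->
  continuous g ->
  (forall e, 0 < e -> \forall t \near (0 : R)^', forall s, 0 <= s <= a -> `|t^-1 *: c t s - g s| <= e) ->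
  F 0 = 0 -> (forall s, is_derive (s : R) (1 : R) F (g s)) ->
  is_derive (0 : R) (1 : R) (fun t => Y t a) (- (y0 + F a)).
Proof.
move=> a0 YD Y01 Y0D c0C cc F0 FD.
have [K [K1 kP]] : exists K, 1 <= K /\ forall s, 0 <= s <= a -> `|g s| + 1 <= K.
  have nC : continuous (fun s => `|g s|) by move=> s; apply: cvg_norm; exact: c0C.
  have [m _ mP] := EVT_max a0 (continuous_subspaceT nC).
  exists (`|g m| + 1); split; first by rewrite lerDr.
  by move=> s sa; rewrite lerD2r; apply: mP; rewrite in_itv.
have K0 : 0 <= K by lra.
pose D : R := d%:R.
have D0 : 0 <= D by rewrite /D.
have aDK0 : 0 <= a * D * K := mulr_ge0 (mulr_ge0 a0 D0) K0.
have aDK4 : 0 <= 4 * a * D * K by have -> : 4 * a * D * K = 4 * (a * D * K) by [ring|]; exact: mulr_ge0.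
(* [e * Q] is the length [a] times the bound [q] obtained below for the derivative of [E]; [e] is
   chosen to make it at most half of [eta]. *)
pose Q := a * (4 * D + D * K * (1 + 4 * a * D * K)).
have Q0 : 0 <= Q.
  apply: mulr_ge0 => //; apply: addr_ge0; first exact: mulr_ge0.
  by apply: mulr_ge0; [exact: mulr_ge0|exact: addr_ge0].
apply/is_deriveP; under eq_fun do rewrite addr0.
apply/cvgrPdist_le => eta eta0.
pose e := Num.min 1 (eta / 2 / (Q + 1)).
have Q10 : 0 < Q + 1 by lra.
have e0 : 0 < e by rewrite lt_min ltr01/= !divr_gt0.
have e1 : e <= 1 by rewrite ge_min lexx.
have eQ : e * Q <= eta / 2.
  have : e <= eta / 2 / (Q + 1) by rewrite ge_min lexx orbT.
  rewrite ler_pdivlMr// => h; apply: le_trans h; rewrite ler_wpM2l ?ltW//; lra.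
have YC : Y t 0 @[t --> (0 : R)] --> (1%:M : 'M[R]_d).
  by rewrite -(Y01 0); exact: is_derive_at_cvg Y0D.
have Y0q : \forall t \near (0 : R)^', `|- y0 - t^-1 *: (Y t 0 - 1%:M)| <= eta / 2.
  move/is_deriveP : Y0D; under eq_fun do rewrite addr0 Y01.
  by move/cvgrPdist_le; apply; rewrite divr_gt0.
have Y0e : \forall t \near (0 : R)^', `|1%:M - Y t 0| <= e.
  by apply: nbhs_dnbhs; move/cvgrPdist_le: YC; apply.
have te : \forall t \near (0 : R)^', `|t| <= e.
  apply: nbhs_dnbhs; have := @nbhsx_ballx _ _ (0 : R) e e0; apply: filterS => t.
  by rewrite -ball_normE /ball_ /= sub0r normrN => /ltW.
(* For [t] within [f] of 0 the product of [|t|] and [a * D * K] is at most 1/2, so that the maximum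
   [S] of the solution can be absorbed. *)
pose f := (2 * (a * D * K + 1))^-1.
have f0 : 0 < f by rewrite invr_gt0 mulr_gt0// ltr_wpDl.
have tf : \forall t \near (0 : R)^', `|t| <= f.
  apply: nbhs_dnbhs; have := @nbhsx_ballx _ _ (0 : R) f f0; apply: filterS => t.
  by rewrite -ball_normE /ball_ /= sub0r normrN => /ltW.
have t0 : \forall t \near (0 : R)^', t != 0 by exact: nbhs_dnbhs_neq.
have YD' := nbhs_dnbhs YD.
near=> t.
have tn0 : t != 0 by near: t.
have tle : `|t| <= e by near: t.
have tlf : `|t| <= f by near: t.
have Yte : `|1%:M - Y t 0| <= e by near: t.
have Ytq : `|- y0 - t^-1 *: (Y t 0 - 1%:M)| <= eta / 2 by near: t.
have YtD s : is_derive (s : R) (1 : R) (Y t) (- (c t s *m Y t s)).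
  by move: s; near: t.
have cte s : 0 <= s <= a -> `|t^-1 *: c t s - g s| <= e.
  by move: s; near: t; exact: cc.
have gK s : 0 <= s <= a -> `|g s| <= K.
  by move=> /kP; lra.
have ctK s : 0 <= s <= a -> `|c t s| <= `|t| * K.
  move=> sa; have -> : c t s = t *: (t^-1 *: c t s) by rewrite scalerA divff// scale1r.
  rewrite normrZ ler_wpM2l// -(subrK (g s) (t^-1 *: _)) (le_trans (ler_normD _ _))//.
  have := kP s sa; have := cte s sa; lra.
have nC : continuous (fun s => `|Y t s|).
  by move=> s; apply: cvg_norm; exact: is_derive_at_cvg (YtD s).
have [m ma mP] := EVT_max a0 (continuous_subspaceT nC).
set S := `|Y t m| in mP.
have S0 : 0 <= S by rewrite /S.
have SP s : 0 <= s <= a -> `|Y t s| <= S by move=> sa; apply: mP; rewrite in_itv.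
have cYS s : 0 <= s <= a -> `|- (c t s *m Y t s)| <= D * (`|t| * K) * S.
  move=> sa; rewrite normrN (le_trans (mx_norm_mul _ _))//.
  by apply: ler_pM; [exact: mulr_ge0|exact: normr_ge0|apply: ler_wpM2l => //; exact: ctK|exact: SP].
have idD (z : R) s : is_derive (s : R) (1 : R) (fun s => z *: s) z.
  refine (is_derive_eq (is_derive_scalefun z (is_derive_id s (1:R))) _).
  by rewrite -[LHS]/(z * 1) mulr1.
have diffY s : 0 <= s <= a -> `|Y t s - Y t 0| <= a * (D * (`|t| * K) * S).
  move=> /andP[s0 sa].
  have := @mx_derive_norm _ _ _ (Y t) (fun s => - (c t s *m Y t s))
    (fun s => (D * (`|t| * K) * S) *: s) (fun=> D * (`|t| * K) * S) 0 s s0 (fun s _ => YtD s) (fun s _ => idD _ s).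
  move=> H; apply: le_trans (H _) _.
    by move=> u /andP[u0 us]; apply: cYS; rewrite u0 (le_trans us).
  rewrite scaler0 subr0 -[leLHS]/(_ * s) mulrC ler_wpM2r//.
  exact: (mulr_ge0 (mulr_ge0 D0 (mulr_ge0 (normr_ge0 t) K0)) S0).
have YtK : `|t| * (a * D * K) <= 2^-1.
  apply: (@le_trans _ _ (f * (a * D * K))); first by rewrite ler_wpM2r.
  by rewrite /f mulrC ler_pdivrMr; move: (a * D * K) aDK0 => A A0; lra.
have SE : S <= 4.
  have : S <= `|Y t 0| + a * (D * (`|t| * K) * S).
    rewrite /S -{1}(subrK (Y t 0) (Y t m)) addrC (le_trans (ler_normD _ _))// lerD2l.
    by apply: diffY; move: ma; rewrite in_itv.
  have -> : a * (D * (`|t| * K) * S) = `|t| * (a * D * K) * S by ring.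
  have : `|Y t 0| <= 2.
    rewrite -(subrK 1%:M (Y t 0)) (le_trans (ler_normD _ _))//.
    have := @mx_norm1 R d; rewrite distrC; move: Yte e1; lra.
  have : `|t| * (a * D * K) * S <= 2^-1 * S by rewrite ler_wpM2r.
  lra.
have Y1 s : 0 <= s <= a -> `|Y t s - 1%:M| <= e * (1 + 4 * a * D * K).
  move=> sa; have := diffY s sa.
  have -> : Y t s - 1%:M = (Y t s - Y t 0) + (Y t 0 - 1%:M) by rewrite subrKA.
  have h : a * (D * (`|t| * K) * S) <= e * (4 * a * D * K).
    have -> : a * (D * (`|t| * K) * S) = (a * D * K) * (`|t| * S) by ring.
    have -> : e * (4 * a * D * K) = (a * D * K) * (e * 4) by ring.
    by apply: ler_wpM2l => //; apply: ler_pM.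
  move=> h1; rewrite (le_trans (ler_normD _ _))// (distrC (Y t 0)).
  by move: Yte h h1; lra.
(* [E] is the error of the difference quotient. Its derivative [- (t^-1 c - g) Y - g (Y - 1)] is of
   order [e]. *)
pose E s := t^-1 *: (Y t s - Y t 0) + F s.
have ED s : is_derive (s : R) (1 : R) E (t^-1 *: (- (c t s *m Y t s)) + g s).
  apply: is_derive_addfun; last exact: FD.
  by apply: is_derive_scalefun; exact: is_derive_addc.
pose q := 4 * D * e + D * K * (e * (1 + 4 * a * D * K)).
have EB s : 0 <= s <= a -> `|t^-1 *: (- (c t s *m Y t s)) + g s| <= q.
  move=> sa.
  have -> : t^-1 *: (- (c t s *m Y t s)) + g s =
     - ((t^-1 *: c t s - g s) *m Y t s) - g s *m (Y t s - 1%:M).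
    rewrite scalerN scalemxAl mulmxBl mulmxBr mulmx1.
    move: (_ *m Y t s) (g s *m Y t s) (g s) => u v w.
    by apply/matrixP => i j; rewrite !mxE; ring.
  rewrite (le_trans (ler_normD _ _))// !normrN; apply: lerD.
    rewrite (le_trans (mx_norm_mul _ _))//.
    have -> : 4 * D * e = D * e * 4 by ring.
    apply: ler_pM; [exact: mulr_ge0|exact: normr_ge0|apply: ler_wpM2l => //; exact: cte|].
    exact: le_trans (SP _ sa) SE.
  rewrite (le_trans (mx_norm_mul _ _))//.
  by apply: ler_pM; [exact: mulr_ge0|exact: normr_ge0|apply: ler_wpM2l => //; exact: gK|exact: Y1].
have Ea : `|E a| <= eta / 2.
  have := @mx_derive_norm _ _ _ E _ (fun s => q *: s) (fun=> q) 0 a a0 (fun s _ => ED s) (fun s _ => idD _ s) EB.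
  rewrite {2}/E subrr scaler0 F0 addr0 subr0 => /le_trans; apply.
  rewrite scaler0 subr0 -[leLHS]/(q * a) (le_trans _ eQ)// le_eqVlt; apply/orP; left; apply/eqP.
  by rewrite /q /Q; ring.
rewrite Y01.
have -> : - (y0 + F a) - t^-1 *: (Y t a - 1%:M) = (- y0 - t^-1 *: (Y t 0 - 1%:M)) - E a.
  rewrite /E -(subrKA (Y t 0) (Y t a) (- 1%:M)) scalerDr.
  move: (t^-1 *: _) (t^-1 *: _) => u v.
  by apply/matrixP => i j; rewrite !mxE; ring.
by rewrite (le_trans (ler_normB _ _))//; move: Ytq Ea; lra.
Unshelve. all: by end_near. Qed.

End ParameterDerivative.

Lemma family_compact_cvg (R : realType) (T : topologicalType) (d : nat) (I : Type)
    (FF : set_system I) {FFilter : Filter FF} (F : I -> T -> 'M[R]_d) (f : T -> 'M[R]_d)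
    (S : set T) (e : R) :
  {family compact, F t @[t --> FF] --> f} -> compact S -> 0 < e ->
  \forall t \near FF, forall y, S y -> `|F t y - f y| <= e.
Proof.
move=> Ff Sc e0.
have H : {uniform S, F t @[t --> FF] --> f}.
  by have /(@fam_cvgP _ _ compact) := Ff; apply.
apply: (H [set h | forall y, S y -> `|h y - f y| <= e]).
apply/uniform_nbhs; exists [set xy | ball xy.1 e xy.2]; split.
  by rewrite -entourage_ballE; exists e.
by move=> h /= hE y Sy; have := hE y Sy; rewrite -ball_normE /ball_ /= distrC => /ltW.
Qed.

(** * Trivializations along the flows and their variation *)

Section Trivializations.
Variables (R : realType) (d : nat).
Implicit Types (A : oneform R d) (x : UH2 R).

(** The group law moves the derivative from time 0 to any time. *)
Lemma flow_derive (V : normedModType R) (f g : UH2 R -> V) i :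
  (forall x, is_derive (0 : R) (1 : R) (fun s => f (flow i s x)) (g x)) ->
  forall x s, is_derive (s : R) (1 : R) (fun s => f (flow i s x)) (g (flow i s x)).
Proof.
move=> fg x s; have /is_deriveP D := fg (flow i s x); apply/is_deriveP.
by move: D; under eq_fun do rewrite addr0 flowD flow0.
Qed.

Lemma trivP A : trivializable_connection A -> parallel_basis A (triv A).
Proof. by move=> [_ [tau tauP]]; exact: (@xgetPex _ (fun=> 1%:M) [set tau | parallel_basis A tau]  (ex_intro _ tau tauP)). Qed.

Lemma triv_unit A x : trivializable_connection A -> triv A x \in unitmx.
Proof. by move=> /trivP []. Qed.

Lemma triv_derive A i x s : trivializable_connection A ->
  is_derive (s : R) (1 : R) (fun s => triv A (flow i s x))
    (- (A i (flow i s x) *m triv A (flow i s x))).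
Proof. by move=> /trivP [_ D]; exact: (flow_derive (D i)). Qed.

Lemma triv_orbit_continuous A i x : trivializable_connection A ->
  continuous (fun s => triv A (flow i s x)).
Proof. by move=> AT s; exact: is_derive_at_cvg (triv_derive i x s AT). Qed.

Lemma form_orbit_continuous A i j x : trivializable_connection A ->
  continuous (fun s => A j (flow i s x)).
Proof.
move=> [AC _] s; apply: (@continuous_comp _ _ _ (fun s => flow i s x) (A j)).
  exact: continuous_flow.
exact: AC.
Qed.

Lemma trivialized_orbit_continuous A (alpha : oneform R d) i j x : trivializable_connection A ->
  continuous (fun s => alpha j (flow i s x)) ->
  continuous (fun s => trivialized A alpha j (flow i s x)).
Proof.
move=> AT aC s; apply: cvg_mulmx; last exact: triv_orbit_continuous.
apply: cvg_mulmx; last exact: aC.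
by apply: cvg_invmx; [move=> t; exact: triv_unit|exact: triv_unit|exact: triv_orbit_continuous].
Qed.

End Trivializations.

Section Deformation.
Variables (R : realType) (d : nat) (A : R -> oneform R d) (A' : oneform R d) (eps : R).
Hypothesis eps0 : 0 < eps.
Hypothesis AT : forall t, `|t| < eps -> trivializable_connection (A t).
Hypothesis A'D : derivative_at0 A A'.
Implicit Types (x : UH2 R).

Let AT0 : trivializable_connection (A 0).
Proof. by apply: AT; rewrite normr0. Qed.

Definition form_diff t : oneform R d := fun i x => A t i x - A 0 i x.

Lemma form_diff_cvg i x (a e : R) : 0 < e ->
  \forall t \near (0 : R)^', forall s, - a <= s <= a ->
    `|t^-1 *: form_diff t i (flow i s x) - A' i (flow i s x)| <= e.
Proof.
move=> e0; pose S := (fun s => flow i s x) @` `[- a, a].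
have Sc : compact S.
  apply: continuous_compact; last exact: segment_compact.
  by apply: continuous_subspaceT; exact: continuous_flow.
have : \forall t \near (0 : R)^', forall y, S y -> `|t^-1 *: (A t i y - A 0 i y) - A' i y| <= e.
  by apply: family_compact_cvg Sc e0; exact: A'D.
by apply: filterS => t H s sa; apply: H; exists s; rewrite ?in_itv.
Qed.

(** On a segment of the orbit [A'] is a uniform limit of continuous quotients; one small enough [t]
    is used for each error. *)
Lemma deriv_orbit_continuous i x : continuous (fun s => A' i (flow i s x)).
Proof.
move=> s; apply/cvgrPdist_le => e e0.
have e30 : 0 < e / 3 by rewrite divr_gt0.
have cvgt := form_diff_cvg i x (`|s| + 1) e30.
have te : \forall t \near (0 : R)^', `|t| < eps.
  apply: nbhs_dnbhs; have := @nbhsx_ballx _ _ (0 : R) eps eps0; apply: filterS => t.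
  by rewrite -ball_normE /ball_ /= sub0r normrN.
have [t [tc teps]] : exists t, (forall r, - (`|s| + 1) <= r <= `|s| + 1 ->
    `|t^-1 *: form_diff t i (flow i r x) - A' i (flow i r x)| <= e / 3) /\ `|t| < eps.
  by apply: (@filter_ex _ (0 : R)^'); apply: filterI.
have C : (t^-1 *: form_diff t i (flow i r x)) @[r --> s] --> t^-1 *: form_diff t i (flow i s x).
  apply: cvgZ; first exact: cvg_cst.
  by apply: cvgB; apply: form_orbit_continuous => //; exact: AT.
move/cvgrPdist_le : C => /(_ (e / 3) e30) C.
have sB : \forall r \near s, `|r| <= `|s| + 1.
  have := @nbhsx_ballx _ _ s (1 : R) ltr01; apply: filterS => r.
  rewrite -ball_normE /ball_ /= => H; have := ler_distD s r 0; rewrite !subr0 distrC.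
  by move: H; rewrite distrC; lra.
near=> r.
have rB : - (`|s| + 1) <= r <= `|s| + 1 by rewrite -ler_norml; near: r.
have sBs : - (`|s| + 1) <= s <= `|s| + 1 by rewrite -ler_norml lerDl.
have h1 := tc r rB; have h2 := tc s sBs.
have h3 : `|t^-1 *: form_diff t i (flow i s x) - t^-1 *: form_diff t i (flow i r x)| <= e / 3.
  by near: r.
move: h1 h2 h3; move: (t^-1 *: _) (t^-1 *: _) (A' _ _) (A' _ _) => u v w z h1 h2 h3.
have -> : w - z = (u - v) + (v - z) - (u - w) by apply/matrixP => k l; rewrite !mxE; ring.
by rewrite (le_trans (ler_normB _ _))//; have := ler_normD (u - v) (v - z); lra.
Unshelve. all: by end_near. Qed.

Definition triv_diff t : oneform R d := trivialized (A 0) (form_diff t).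

(* The parallel basis of [A t] read in the parallel sections of [A 0]. *)
Definition triv_ratio t x : 'M[R]_d := invmx (triv (A 0) x) *m triv (A t) x.

(** The terms in [A 0] coming from the two trivializations combine into the difference of the forms,
    conjugated to the parallel sections of [A 0]. *)
Lemma triv_ratio_derive t i x s : `|t| < eps ->
  is_derive (s : R) (1 : R) (fun s => triv_ratio t (flow i s x))
    (- (triv_diff t i (flow i s x) *m triv_ratio t (flow i s x))).
Proof.
move=> teps; have D0 := triv_derive i x s AT0; have Dt := triv_derive i x s (AT teps).
refine (is_derive_eq (is_derive_mulmx (is_derive_invmx (fun s => triv_unit _ AT0) D0) Dt) _).
rewrite /triv_ratio /triv_diff /trivialized /form_diff.
have Tu := triv_unit (flow i s x) AT0.
rewrite !(mulmxN, mulNmx) opprK !mulmxA mulmxK// mulmxBr.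
rewrite [in RHS]mulmxBl [in RHS]mulmxBl [in RHS]mulmxBl opprB.
by congr (_ - _); rewrite mulmxK.
Qed.

Lemma triv_diff_cvg i x (a e : R) : 0 < e ->
  \forall t \near (0 : R)^', forall s, - a <= s <= a ->
    `|t^-1 *: triv_diff t i (flow i s x) - trivialized (A 0) A' i (flow i s x)| <= e.
Proof.
move=> e0; have [a0|a0] := leP 0 a; last first.
  by near=> t => s /andP[h1 h2]; have := le_trans h1 h2; lra.
pose g s := invmx (triv (A 0) (flow i s x)); pose h s := triv (A 0) (flow i s x).
have hC : continuous h by exact: triv_orbit_continuous.
have gC : continuous g.
  by move=> s; apply: cvg_invmx; [move=> t; exact: triv_unit|exact: triv_unit|exact: hC].
have bd (k : R -> 'M[R]_d) : continuous k -> exists K, 1 <= K /\ forall s, - a <= s <= a -> `|k s| <= K.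
  move=> kC; have nC : continuous (fun s => `|k s|) by move=> s; apply: cvg_norm; exact: kC.
  have aa : - a <= a by lra.
  have [m _ mP] := EVT_max aa (continuous_subspaceT nC).
  exists (`|k m| + 1); split; first by rewrite lerDr.
  by move=> s sa; apply: (le_trans (mP s _)); rewrite ?in_itv// lerDl.
have [Kg [Kg1 KgP]] := bd g gC; have [Kh [Kh1 KhP]] := bd h hC.
pose D : R := d%:R + 1.
have D1 : 1 <= D by rewrite lerDr.
have DK : 0 < (D * Kg) * (D * Kh) by rewrite !mulr_gt0//; lra.
have := form_diff_cvg i x a (divr_gt0 e0 DK).
apply: filterS => t H s sa.
have -> : t^-1 *: triv_diff t i (flow i s x) - trivialized (A 0) A' i (flow i s x) =
   g s *m (t^-1 *: form_diff t i (flow i s x) - A' i (flow i s x)) *m h s.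
  by rewrite mulmxBr mulmxBl -scalemxAr -scalemxAl.
apply: le_trans (mx_norm_mul _ _) _.
have -> : e = D * ((D * Kg) * (e / ((D * Kg) * (D * Kh)))) * Kh.
  by field; rewrite !lt0r_neq0//; lra.
have dD : d%:R <= D by rewrite lerDl.
apply: ler_pM; [exact: mulr_ge0|exact: normr_ge0| |exact: KhP].
apply: ler_pM; [by []|exact: normr_ge0|by []|].
apply: le_trans (mx_norm_mul _ _) _.
apply: ler_pM; [exact: mulr_ge0|exact: normr_ge0| |exact: H].
by apply: ler_pM; [by []|exact: normr_ge0|by []|exact: KgP].
Unshelve. all: by end_near. Qed.

End Deformation.

(** The difference is constant along the three flows, which act transitively. *)
Lemma primitive_unique (R : realType) (d : nat) (A0 A' : oneform R d) beta beta' x :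
  primitive A0 A' beta -> primitive A0 A' beta' ->
  beta x - beta' x = beta (base_point R) - beta' (base_point R).
Proof.
move=> bP bP'; apply: (@flow_transitive R (fun x =>
  beta x - beta' x = beta (base_point R) - beta' (base_point R))) => //.
move=> i s {}x <-.
have D r : is_derive (r : R) (1 : R) (fun r => beta (flow i r x) - beta' (flow i r x)) 0.
  have E := is_derive_subfun (flow_derive (bP i) x r) (flow_derive (bP' i) x r).
  by rewrite subrr in E.
by have := derive0_cst D s 0; rewrite flow0.
Qed.

(** * A primitive from the variation of the trivializations *)

Section Primitive.
Variables (R : realType) (d : nat) (A : R -> oneform R d) (A' : oneform R d) (eps : R).
Hypothesis eps0 : 0 < eps.
Hypothesis AT : forall t, `|t| < eps -> trivializable_connection (A t).
Hypothesis A'D : derivative_at0 A A'.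
Implicit Types (x : UH2 R).

Let AT0 : trivializable_connection (A 0).
Proof. by apply: AT; rewrite normr0. Qed.

Lemma triv_ratio_unit t x : `|t| < eps -> triv_ratio A t x \in unitmx.
Proof. by move=> te; rewrite unitmx_mul unitmx_inv !triv_unit//; exact: AT. Qed.

Lemma triv_ratio0 x : triv_ratio A 0 x = 1%:M.
Proof. by rewrite /triv_ratio mulVmx// triv_unit. Qed.

(* [triv] is only defined up to a constant change of basis, possibly
   discontinuous in [t]; normalizing at a base point removes it. *)
Definition normalized_ratio t x : 'M[R]_d :=
  triv_ratio A t x *m invmx (triv_ratio A t (base_point R)).

Lemma normalized_ratio_unit t x : `|t| < eps -> normalized_ratio t x \in unitmx.
Proof. by move=> te; rewrite unitmx_mul unitmx_inv !triv_ratio_unit. Qed.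

Lemma normalized_ratio0 x : normalized_ratio 0 x = 1%:M.
Proof. by rewrite /normalized_ratio !triv_ratio0 invmx1 mulmx1. Qed.

Lemma near0_lt : \forall t \near (0 : R), `|t| < eps.
Proof.
have := @nbhsx_ballx _ _ (0 : R) eps eps0; apply: filterS => t.
by rewrite -ball_normE /ball_ /= sub0r normrN.
Qed.

Lemma normalized_ratio_flow t i x s : `|t| < eps ->
  is_derive (s : R) (1 : R) (fun s => normalized_ratio t (flow i s x))
    (- (triv_diff A t i (flow i s x) *m normalized_ratio t (flow i s x))).
Proof.
move=> te; have D := triv_ratio_derive eps0 AT i x s te.
refine (is_derive_eq (is_derive_mulmxr (invmx (triv_ratio A t (base_point R))) D) _).
by rewrite mulNmx -mulmxA.
Qed.

(** Differentiability in [t] propagates along a flow segment by [ode_param_derive]. For negative [a]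
    the segment is run backwards, which changes the sign of the forms. *)
Lemma normalized_ratio_step i x (y0 : 'M[R]_d) (F : R -> 'M[R]_d) a :
  is_derive (0 : R) (1 : R) (fun t => normalized_ratio t x) (- y0) ->
  F 0 = 0 ->
  (forall s, is_derive (s : R) (1 : R) F (trivialized (A 0) A' i (flow i s x))) ->
  is_derive (0 : R) (1 : R) (fun t => normalized_ratio t (flow i a x)) (- (y0 + F a)).
Proof.
move=> y0D F0 FD.
have gC : continuous (fun s => trivialized (A 0) A' i (flow i s x)).
  apply: trivialized_orbit_continuous => //.
  exact: (deriv_orbit_continuous eps0 AT A'D).
have [a0|a0] := leP 0 a.
  apply: (@ode_param_derive _ _ (fun t s => triv_diff A t i (flow i s x))
    (fun t s => normalized_ratio t (flow i s x)) (fun s => trivialized (A 0) A' i (flow i s x))) => //.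
  - by apply: filterS near0_lt => t te s; exact: normalized_ratio_flow.
  - by move=> s; exact: normalized_ratio0.
  - by under eq_fun do rewrite flow0.
  - move=> e e0; have := triv_diff_cvg eps0 AT A'D i x a e0; apply: filterS => t H s /andP[s0 sa].
    by apply: H; rewrite sa andbT (le_trans _ s0)// oppr_le0.
have opp (f : R -> 'M[R]_d) g s : is_derive (- s) (1 : R) f g -> is_derive (s : R) (1 : R) (fun s => f (- s)) (- g).
  move=> fD; apply/is_derive_mxP => k l; move/is_derive_mxP: fD => /(_ k l) fD.
  refine (is_derive_eq (is_derive1_comp fD (is_deriveNid s (1 : R))) _).
  by rewrite mxE mulrN1.
have := @ode_param_derive _ _ (fun t s => - triv_diff A t i (flow i (- s) x))
    (fun t s => normalized_ratio t (flow i (- s) x)) (fun s => - trivialized (A 0) A' i (flow i (- s) x))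
    (fun s => F (- s)) y0 (- a).
rewrite opprK; apply.
- by rewrite oppr_ge0 ltW.
- apply: filterS near0_lt => t te s.
  have := opp _ _ _ (normalized_ratio_flow i x (- s) te).
  by rewrite mulNmx.
- by move=> s; exact: normalized_ratio0.
- by rewrite oppr0; under eq_fun do rewrite flow0.
- move=> s; apply: cvgN; apply: (@continuous_comp _ _ _ (@GRing.opp R) (fun s => trivialized (A 0) A' i (flow i s x))).
    exact: oppr_continuous.
  exact: gC.
- move=> e e0; have := triv_diff_cvg eps0 AT A'D i x (- a) e0; apply: filterS => t H s /andP[s0 sa].
  rewrite scalerN -opprD normrN; apply: H; rewrite opprK lerNr sa /= lerN2.
  by rewrite (le_trans _ s0)// ltW.
- by rewrite oppr0.
Qed.

(** Closedness of the variation is contained in the trivializability of all the connections. The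
    [t]-derivative of the normalized ratio is 0 at the base point, exists everywhere by propagation
    along the flows, and is minus a primitive. *)
Lemma primitive_exists : exists beta,
  (forall x, is_derive (0 : R) (1 : R) (fun t => normalized_ratio t x) (- beta x)) /\
  primitive (A 0) A' beta.
Proof.
have antid i x : exists F : R -> 'M[R]_d, F 0 = 0 /\
    forall s, is_derive (s : R) (1 : R) F (trivialized (A 0) A' i (flow i s x)).
  apply: mx_antiderivative; apply: trivialized_orbit_continuous => //.
  exact: (deriv_orbit_continuous eps0 AT A'D).
have ex x : exists b, is_derive (0 : R) (1 : R) (fun t => normalized_ratio t x) (- b).
  apply: (@flow_transitive R (fun x => exists b, is_derive (0 : R) (1 : R) (fun t => normalized_ratio t x) (- b))).
    exists 0; rewrite oppr0; refine (near_eq_is_derive _ (is_derive_cstfun (1%:M : 'M[R]_d) (0 : R))).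
    by apply: filterS near0_lt => t te; rewrite /normalized_ratio mulmxV// triv_ratio_unit.
  move=> i s {}x [b bD]; have [F [F0 FD]] := antid i x.
  by exists (b + F s); exact: normalized_ratio_step.
have [beta bP] := choice ex.
exists beta; split=> // i x.
have [F [F0 FD]] := antid i x.
have -> : (fun s => beta (flow i s x)) = fun s => F s + beta x.
  apply/funext => s.
  (* The derivative at [flow i s x] is known in two ways, from the choice of [beta] and by
     propagation from [x]; their equality gives the increment of [beta]. *)
  have D1 := normalized_ratio_step s (bP x) F0 FD.
  have := @derive_val _ _ _ _ _ _ _ D1; rewrite (@derive_val _ _ _ _ _ _ _ (bP (flow i s x))).
  by move=> /oppr_inj ->; rewrite addrC.
by apply: is_derive_addc; have := FD 0; rewrite flow0.
Qed.

End Primitive.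

(** * Dominated splittings *)

Section Subspaces.
Variables (R : realType) (d : nat).
Implicit Types (P Q : 'M[R]_d) (u v w : 'cV[R]_d) (F G : {vspace 'cV[R]_d}).

Definition linear_mx (f : 'End('cV[R]_d)) : 'M[R]_d := \matrix_(i, j) (f (delta_mx j 0)) i 0.

Lemma linear_mxE (f : 'End('cV[R]_d)) v : linear_mx f *m v = f v.
Proof.
have -> : f v = \sum_j v j 0 *: f (delta_mx j 0).
  rewrite {1}[v](matrix_sum_delta v) linear_sum; apply: eq_bigr => j _.
  by rewrite linear_sum big_ord1 linearZ.
apply/colP => i; rewrite !mxE summxE; apply: eq_bigr => j _.
by rewrite !mxE mulrC.
Qed.

Lemma projectorE F G v : projector F G *m v = daddv_pi F G v.
Proof. exact: linear_mxE. Qed.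

Lemma mulmx_inj P Q : (forall v, P *m v = Q *m v) -> P = Q.
Proof.
move=> PQ; apply/matrixP => i j.
by have := congr1 (fun v : 'cV[R]_d => v i 0) (PQ (delta_mx j 0)); rewrite -!colE !mxE.
Qed.

Lemma projector_unique F G P : (F + G)%VS = fullv -> (F :&: G)%VS = 0%VS ->
  (forall u, u \in F -> P *m u = u) -> (forall v, v \in G -> P *m v = 0) -> projector F G = P.
Proof.
move=> FG FG0 PF PG; apply: mulmx_inj => w.
have /memv_addP[u uF [v vG ->]] : w \in (F + G)%VS by rewrite FG memvf.
rewrite projectorE linearD mulmxDr PF// PG// addr0 /= daddv_pi_id//.
have GF0 : (G :&: F)%VS = 0%VS by rewrite capvC.
have := daddv_pi_add GF0 (subvP (addvSl G F) _ vG); rewrite (daddv_pi_id GF0 vG).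
by move=> /(canRL (addKr _)); rewrite addNr => ->; rewrite addr0.
Qed.

Definition mulmx_fun P : 'End('cV[R]_d) := linfun (mulmx P).

Lemma mulmx_funE P v : mulmx_fun P v = P *m v.
Proof. by rewrite /mulmx_fun lfunE. Qed.

(** For an idempotent this is its range; the encoding by fixed vectors turns membership into an
    equation. *)
Definition fix_space P : {vspace 'cV[R]_d} := lker (mulmx_fun P - \1)%VF.

Lemma mem_fix_space P v : (v \in fix_space P) = (P *m v == v).
Proof. by rewrite memv_ker add_lfunE opp_lfunE id_lfunE mulmx_funE subr_eq0. Qed.

Lemma dim_fix_conj P (S : 'M[R]_d) : S \in unitmx ->
  \dim (fix_space (S *m P *m invmx S)) = \dim (fix_space P).
Proof.
move=> Su; have kS : lker (mulmx_fun S) == 0%VS.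
  apply/lker0P => u v; rewrite !mulmx_funE => E.
  by rewrite -(mulKmx Su u) E mulKmx.
have -> : fix_space (S *m P *m invmx S) = (mulmx_fun S @: fix_space P)%VS.
  apply/vspaceP => v; rewrite mem_fix_space; apply/idP/memv_imgP.
    move=> /eqP E; exists (invmx S *m v); last by rewrite mulmx_funE mulKVmx.
    by rewrite mem_fix_space -{2}E !mulmxA mulVmx// mul1mx.
  by move=> [u]; rewrite mem_fix_space mulmx_funE => /eqP E ->; rewrite -!mulmxA mulKmx// E.
by rewrite limg_dim_eq// (eqP kS) capv0.
Qed.

Lemma fix_space_direct P : P *m P = P ->
  (fix_space P + fix_space (1%:M - P))%VS = fullv /\
  (fix_space P :&: fix_space (1%:M - P))%VS = 0%VS.
Proof.
move=> PP; split.
  apply/vspaceP => v; rewrite memvf -[v](subrK (P *m v)) addrC; apply: memv_add.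
    by rewrite mem_fix_space mulmxA PP.
  by rewrite mem_fix_space mulmxBl mul1mx mulmxBr mulmxA PP subrr subr0.
apply/eqP; rewrite -subv0; apply/subvP => v; rewrite memv_cap !mem_fix_space memv0.
by rewrite mulmxBl mul1mx => /andP[/eqP ->]; rewrite subrr eq_sym.
Qed.

Lemma projector_fix_space P : P *m P = P -> projector (fix_space P) (fix_space (1%:M - P)) = P.
Proof.
move=> PP; have [s c] := fix_space_direct PP; apply: projector_unique => // u.
  by rewrite mem_fix_space => /eqP.
by rewrite mem_fix_space mulmxBl mul1mx => /eqP E; rewrite -E mulmxBr mulmxA PP subrr.
Qed.

Section Flags.
Variables (n : nat) (p : 'I_n -> 'M[R]_d).
Hypothesis pP : block_family p.

Definition partial_sum (S : pred 'I_n) : 'M[R]_d := \sum_(i < n | S i) p i.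

Lemma partial_sum_mul S i : partial_sum S *m p i = if S i then p i else 0.
Proof.
rewrite mulmx_suml; case: ifP => Si.
  rewrite (bigD1 i)//= (block_idem pP) big1 ?addr0// => j /andP[_ ji].
  by rewrite (block_mul pP) (negbTE ji).
rewrite big1// => j Sj; rewrite (block_mul pP); case: eqP => // ji.
by rewrite -ji Sj in Si.
Qed.

Lemma partial_sum_mul_sum S S' : partial_sum S *m partial_sum S' = partial_sum (fun i => S i && S' i).
Proof.
rewrite [X in _ *m X]/partial_sum mulmx_sumr /partial_sum big_mkcondl /= [RHS](eq_bigl (fun i => S' i && true))//.
  by rewrite [RHS]big_mkcondr; apply: eq_bigr => i _; rewrite partial_sum_mul.
by move=> i; rewrite andbT.
Qed.

Lemma partial_sumC S : partial_sum (fun i => ~~ S i) = 1%:M - partial_sum S.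
Proof.
apply/eqP; rewrite eq_sym subr_eq; apply/eqP; have [_ <-] := pP.
by rewrite (bigID S) /= addrC.
Qed.

Lemma sum_fix_spaces S : (\sum_(i < n | S i) fix_space (p i))%VS = fix_space (partial_sum S).
Proof.
apply/vspaceP => v; apply/idP/idP.
  move=> /memv_sumP[w wP ->]; rewrite mem_fix_space mulmx_sumr; apply/eqP.
  apply: eq_bigr => i Si; have := wP i Si; rewrite mem_fix_space => /eqP <-.
  by rewrite mulmxA partial_sum_mul Si.
rewrite mem_fix_space => /eqP <-; rewrite mulmx_suml; apply: memv_sumr => i Si.
by rewrite mem_fix_space mulmxA (block_idem pP).
Qed.

Lemma directv_fix_spaces : (\sum_(i < n) fix_space (p i))%VS = fullv /\
  directv (\sum_(i < n) fix_space (p i)).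
Proof.
split.
  rewrite (sum_fix_spaces predT); apply/vspaceP => v; rewrite memvf mem_fix_space.
  by rewrite /partial_sum (proj2 pP) mul1mx eqxx.
apply/directv_sum_independent => us usP us0 i _.
have := congr1 (mulmx (p i)) us0; rewrite mulmx0 mulmx_sumr (bigD1 i)//=.
have pu j : p j *m us j = us j by have := usP j isT; rewrite mem_fix_space => /eqP.
rewrite pu big1 ?addr0// => j ji; rewrite -(pu j) mulmxA (block_mul pP).
by rewrite eq_sym (negbTE ji) mul0mx.
Qed.

End Flags.

Lemma block_of_decomposition n (E : 'I_n -> {vspace 'cV[R]_d}) :
  (\sum_(i < n) E i)%VS = fullv -> directv (\sum_(i < n) E i) ->
  exists p, block_family p /\ forall i, E i = fix_space (p i).
Proof.
move=> Ef Ed; pose V := (\sum_(i < n) E i)%VS.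
pose p i := linear_mx (sumv_pi V i).
have pE i v : p i *m v = sumv_pi V i v by exact: linear_mxE.
have psum v : \sum_(i < n) p i *m v = v.
  under eq_bigr do rewrite pE.
  by apply: sumv_pi_sum; rewrite [V]Ef memvf.
have pmem i v : p i *m v \in E i by rewrite pE memv_sum_pi.
have pid i j v : v \in E j -> p i *m v = if i == j then v else 0.
  move=> vj.
  have /(directv_sum_unique Ed) : forall i, true -> p i *m v \in E i by move=> k _; exact: pmem.
  move=> /(_ (fun k => if k == j then v else 0)).
  have H k : true -> (if k == j then v else 0) \in E k.
    by case: eqP => [->|_] _ //; exact: mem0v.
  move=> /(_ H); rewrite psum -big_mkcond big_pred1_eq eqxx => /esym /forallP /(_ i).
  by move=> /eqP.
exists p; split; last first.
  move=> i; apply/vspaceP => v; rewrite mem_fix_space; apply/idP/eqP => [vi|<-]; last exact: pmem.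
  by rewrite (pid i i)// eqxx.
split=> [i j|].
  apply: mulmx_inj => v; rewrite -mulmxA (pid _ _ _ (pmem j v)).
  by case: eqP => [->//|_]; rewrite mul0mx.
by apply: mulmx_inj => v; rewrite mulmx_suml psum mul1mx.
Qed.

End Subspaces.

(** * Norms and angles of vectors in a frame *)

Section VectorNorm.
Variables (R : realType) (d : nat).
Implicit Types (M S Y : 'M[R]_d) (u v w : 'cV[R]_d) (F G : {vspace 'cV[R]_d}).

Lemma dotMC M u v : dotM M u v = dotM M v u.
Proof. by apply: eq_bigr => i _; rewrite mulrC. Qed.

Lemma dotMDr M u v w : dotM M u (v + w) = dotM M u v + dotM M u w.
Proof. by rewrite /dotM; under eq_bigr do rewrite mulmxDr [X in _ * X]mxE mulrDr; exact: big_split. Qed.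

Lemma dotMZr M (a : R) u v : dotM M u (a *: v) = a * dotM M u v.
Proof. by rewrite /dotM mulr_sumr; apply: eq_bigr => i _; rewrite -scalemxAr [X in _ * X]mxE mulrCA. Qed.

Lemma dotMDl M u v w : dotM M (u + v) w = dotM M u w + dotM M v w.
Proof. by rewrite dotMC dotMDr !(dotMC _ w). Qed.

Lemma dotMZl M (a : R) u v : dotM M (a *: u) v = a * dotM M u v.
Proof. by rewrite dotMC dotMZr dotMC. Qed.

Lemma dotMNr M u v : dotM M u (- v) = - dotM M u v.
Proof. by rewrite -scaleN1r dotMZr mulN1r. Qed.

Lemma dotM_ge0 M u : 0 <= dotM M u u.
Proof. by apply: sumr_ge0 => i _; rewrite -expr2 sqr_ge0. Qed.

Lemma normM_ge0 M u : 0 <= normM M u.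
Proof. exact: sqrtr_ge0. Qed.

Lemma normM_sqr M u : normM M u ^+ 2 = dotM M u u.
Proof. by rewrite sqr_sqrtr// dotM_ge0. Qed.

Lemma normMN M u : normM M (- u) = normM M u.
Proof. by rewrite /normM dotMNr dotMC dotMNr opprK. Qed.

Lemma normMZ M (a : R) u : normM M (a *: u) = `|a| * normM M u.
Proof. by rewrite /normM dotMZl dotMZr mulrA -expr2 sqrtrM ?sqr_ge0// sqrtr_sqr. Qed.

Lemma normM0 M : normM M 0 = 0.
Proof. by apply/eqP; rewrite -sqrf_eq0 normM_sqr -(scale0r 0) dotMZr mul0r. Qed.

Lemma cauchy_schwarz M u v : dotM M u v ^+ 2 <= dotM M u u * dotM M v v.
Proof.
set a := dotM M u u; set s := dotM M u v; set c := dotM M v v.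
have c0 : 0 <= c := dotM_ge0 M v.
have key x y : 0 <= x ^+ 2 * a + 2 * x * y * s + y ^+ 2 * c.
  have := dotM_ge0 M (x *: u + y *: v).
  rewrite !(dotMDl, dotMDr, dotMZl, dotMZr) (dotMC M v u) -/a -/s -/c.
  by rewrite [X in 0 <= X -> _](_ : _ = x ^+ 2 * a + 2 * x * y * s + y ^+ 2 * c)//; ring.
have [cz|cn] := eqVneq c 0.
  have sz : s = 0.
    apply/eqP; rewrite -sqrf_eq0 eq_le sqr_ge0 andbT.
    (* When [c = 0] the quadratic form is affine in [y]; this choice leaves [- (a + 2) s^2], which
       forces [s = 0]. *)
    have := key s (- (a + 1)); rewrite cz mulr0 addr0; have := dotM_ge0 M u; rewrite -/a.
    have := sqr_ge0 s; nra.
  by rewrite sz expr0n /= cz mulr0.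
have cp : 0 < c by rewrite lt_def cn.
have := key c (- s); rewrite [X in 0 <= X -> _](_ : _ = c * (a * c - s ^+ 2)); last by ring.
by rewrite pmulr_rge0// subr_ge0.
Qed.

Lemma dotM_le M u v : `|dotM M u v| <= normM M u * normM M v.
Proof.
rewrite -ler_sqr ?nnegrE ?mulr_ge0 ?normM_ge0// real_normK ?num_real//.
by rewrite exprMn !normM_sqr cauchy_schwarz.
Qed.

Lemma normMD M u v : normM M (u + v) <= normM M u + normM M v.
Proof.
rewrite -ler_sqr ?nnegrE ?addr_ge0 ?normM_ge0// normM_sqr dotMDl !dotMDr (dotMC M v u).
rewrite sqrrD !normM_sqr; have := le_trans (ler_norm _) (dotM_le M u v).
by rewrite mulr2n; lra.
Qed.

Lemma normM_gt0 M u : M \in unitmx -> u != 0 -> 0 < normM M u.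
Proof.
move=> Mu u0; rewrite lt_def normM_ge0 andbT; apply: contraNneq u0 => n0.
have : dotM M u u = 0 by rewrite -normM_sqr n0 expr0n.
move/eqP; rewrite psumr_eq0; last by move=> i _; rewrite -expr2 sqr_ge0.
move=> /allP z; have : invmx M *m u = 0.
  apply/colP => i; rewrite [RHS]mxE; have := z i (mem_index_enum i).
  by rewrite /= mulf_eq0 orbb => /eqP.
by move=> /(congr1 (mulmx M)); rewrite mulKVmx// mulmx0 => ->.
Qed.

Lemma normM_mul S M v : S \in unitmx -> M \in unitmx -> normM (S *m M) (S *m v) = normM M v.
Proof. by move=> Su Mu; rewrite /normM /dotM invmx_mulmx// -mulmxA mulKmx. Qed.

Lemma coord_le_normM M v : `|invmx M *m v| <= normM M v.
Proof.
apply: mx_norm_le => [|i j]; first exact: normM_ge0.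
rewrite [j]ord1 -ler_sqr ?nnegrE ?normM_ge0// real_normK ?num_real// normM_sqr.
by rewrite /dotM (bigD1 i)//= -expr2 lerDl sumr_ge0// => k _; rewrite -expr2 sqr_ge0.
Qed.

Lemma normM_le_coord M v : normM M v <= d%:R * `|invmx M *m v|.
Proof.
have dn0 : 0 <= d%:R * `|invmx M *m v| by exact: mulr_ge0.
rewrite -ler_sqr ?nnegrE ?normM_ge0// normM_sqr.
apply: (@le_trans _ _ (\sum_(i < d) `|invmx M *m v| ^+ 2)).
  apply: ler_sum => i _; rewrite -expr2 -(real_normK (num_real _)).
  by rewrite ler_sqr ?nnegrE// entry_le_norm.
rewrite sumr_const card_ord -[leLHS]mulr_natl [leRHS]exprMn; apply: ler_wpM2r; first exact: sqr_ge0.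
by rewrite -natrX ler_nat; have [->|d0] := posnP d => //; rewrite expnS expn1 leq_pmull.
Qed.

Lemma frame_norm_le M Y (C : R) : M \in unitmx -> 0 <= C ->
  (forall v, normM M (Y *m v) <= C * normM M v) -> frame_norm M Y <= d%:R * C.
Proof.
move=> Mu C0 YC; rewrite frame_normE ler_wpM2l//; apply: mx_norm_le => // i j.
have := le_trans (coord_le_normM M (Y *m (M *m delta_mx j 0))) (YC _).
have -> : normM M (M *m delta_mx j 0) = 1.
  rewrite /normM /dotM mulKmx// (bigD1 j)//= big1 => [|k kj].
    by rewrite mxE !eqxx mulr1 addr0 sqrtr1.
  by rewrite mxE (negbTE kj) mul0r.
rewrite mulr1; apply: le_trans; rewrite !mulmxA -colE.
by have := entry_le_norm (col j (invmx M *m Y *m M)) i 0; rewrite mxE.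
Qed.

Lemma normM_mulmx_le M Y v : M \in unitmx -> normM M (Y *m v) <= d%:R * frame_norm M Y * normM M v.
Proof.
move=> Mu; apply: le_trans (normM_le_coord _ _) _; rewrite -mulrA ler_wpM2l//.
have -> : invmx M *m (Y *m v) = (invmx M *m Y *m M) *m (invmx M *m v).
  by rewrite !mulmxA mulmxK.
apply: le_trans (mx_norm_mul _ _) _; rewrite frame_normE.
by apply: ler_wpM2l; [exact: mulr_ge0|exact: coord_le_normM].
Qed.

Lemma gapM_self M F : gapM M F F <= 0.
Proof.
rewrite /gapM; set S := [set r | _].
(* The zero subspace has no unit vector, and the supremum is then 0 by convention. *)
have [->|/set0P S0] := eqVneq S set0; first by rewrite sup0.
apply: ge_sup => // r [u uF [_ ->]].
apply: ge_inf; last by exists u => //; rewrite subrr normM0.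
by exists 0 => _ [w _ <-]; exact: normM_ge0.
Qed.

Lemma distM_self M F : distM M F F <= 0.
Proof. by rewrite ge_max !gapM_self. Qed.

(** A lower bound on the angle controls the projection on [F] along [G], with a constant depending
    only on the angle. *)
Lemma angle_bound (e0 : R) : 0 < e0 -> exists k : R, 1 <= k /\ forall M F G,
  M \in unitmx -> 2 * e0 < angleM M F G ->
  forall u v, u \in F -> v \in G -> normM M u <= k * normM M (u + v).
Proof.
(* The cap at [pi / 2] makes the cosine [c] nonnegative and keeps [e] where the cosine decreases. *)
move=> e00; pose e := Num.min (2 * e0) (pi / 2).
have pi0 : 0 < pi :> R by exact: pi_gt0.
have e_gt0 : 0 < e by rewrite lt_min mulr_gt0//= divr_gt0.
have epi : e <= pi / 2 by rewrite ge_min lexx orbT.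
pose c := cos e.
have c0 : 0 <= c by apply: cos_ge0_pihalf; rewrite epi andbT; lra.
have c1 : c < 1.
  by rewrite -cos0 ltr_cos// in_itv /= ?lexx ?(ltW pi0)//; apply/andP; split; lra.
have c2 : 0 < 1 - c ^+ 2 by nra.
exists (1 - c ^+ 2)^-1; split.
  by rewrite -[leLHS]invr1 lef_pV2 ?posrE//; have := sqr_ge0 c; lra.
move=> M F G Mu ang u v uF vG; set k := (1 - c ^+ 2)^-1.
have k1 : 1 <= k by rewrite -[leLHS]invr1 lef_pV2 ?posrE//; have := sqr_ge0 c; lra.
have [u0|u0] := eqVneq u 0; first by rewrite u0 normM0 mulr_ge0 ?normM_ge0//; lra.
have [v0|v0] := eqVneq v 0; first by rewrite v0 addr0 ler_peMl ?normM_ge0.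
have nu := normM_gt0 Mu u0; have nv := normM_gt0 Mu v0.
have inter u' v' : u' != 0 -> v' != 0 -> -1 <= dotM M u' v' / (normM M u' * normM M v') <= 1.
  move=> u'0 v'0; have nu' := normM_gt0 Mu u'0; have nv' := normM_gt0 Mu v'0.
  have nn : 0 < normM M u' * normM M v' by exact: mulr_gt0.
  by rewrite -ler_norml normrM normfV (gtr0_norm nn) ler_pdivrMr// mul1r dotM_le.
(* The angle is tested on [u] and [- v], since cancellation in [u + v] occurs when [v] is close to
   the direction opposite to [u]. *)
have dotle : dotM M u (- v) <= c * (normM M u * normM M v).
  have Nv0 : - v != 0 by rewrite oppr_eq0.
  have NvG : - v \in G by rewrite memvN.
  set q := dotM M u (- v) / (normM M u * normM M (- v)).
  have qi : -1 <= q <= 1 by exact: inter.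
  have eq_ : e < acos q.
    apply: (@le_lt_trans _ _ (2 * e0)); first by rewrite ge_min lexx.
    apply: lt_le_trans ang _; apply: ge_inf; last by exists u, (- v).
    by exists 0 => _ [u' [v' [_ _ u'0 v'0 ->]]]; exact/acos_ge0/inter.
  have qc : q <= c.
    have a0 : 0 <= acos q by exact: acos_ge0.
    have api : acos q <= pi by exact: acos_lepi.
    rewrite -(@acosK _ q) ?in_itv// ltW// /c ltr_cos// in_itv /= ?a0 ?api//.
    by apply/andP; split; lra.
  by move: qc; rewrite /q normMN ler_pdivrMr// mulr_gt0.
have : normM M u ^+ 2 <= k * normM M (u + v) ^+ 2.
  rewrite [X in _ <= _ * X]normM_sqr dotMDl !dotMDr (dotMC M v u) -!normM_sqr.
  rewrite -ler_pdivrMl ?invr_gt0//; rewrite /k invrK.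
  rewrite dotMNr in dotle; move: dotle; set x := normM M u; set y := normM M v; set z := dotM M u v => dotle.
  (* Indeed [x^2 - 2 c x y + y^2] is [(1 - c^2) x^2] plus this square. *)
  have := sqr_ge0 (y - c * x); nra.
move=> H; rewrite -ler_sqr ?nnegrE ?mulr_ge0 ?normM_ge0//; last by lra.
rewrite exprMn; apply: le_trans H _; rewrite ler_wpM2r ?sqr_ge0//; nra.
Qed.

End VectorNorm.

(** * Uniqueness of a dominated subspace of given dimension *)

Section FastSubspace.
Variables (R : realType) (d : nat) (N : R -> 'cV[R]_d -> R).
Hypothesis Nadd : forall s u v, N s (u + v) <= N s u + N s v.
Hypothesis Nopp : forall s u, N s (- u) = N s u.
Hypothesis Nzero : forall s, N s 0 = 0.
Hypothesis Npos : forall s u, u != 0 -> 0 < N s u.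
Implicit Types (F G : {vspace 'cV[R]_d}).

Definition dominates F G := exists B b : R, [/\ 0 < B, 0 < b &
  forall s u v, 0 < s -> u \in F -> u != 0 -> v \in G -> v != 0 ->
    N s u / N 0 u <= B * expR (- b * s) * (N s v / N 0 v)].

(** A vector outside [F] has a nonzero component in [G], which eventually outweighs every vector of
    [F], including the other component of [u]. *)
Lemma dominates_negligible F G u w (e : R) : dominates F G -> (F + G)%VS = fullv ->
  u \notin F -> w \in F -> 0 < e -> \forall s \near +oo, N s w <= e * N s u.
Proof.
move=> [B [b [B0 b0 D]]] S uF wF e0.
have Nge s v : 0 <= N s v.
  by have [->|/(Npos s)/ltW//] := eqVneq v 0; rewrite Nzero.
have : u \in (F + G)%VS by rewrite S memvf.
move=> /memv_addP[l lF [v vG uE]].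
have v0 : v != 0 by apply: contraNneq uF => v0; rewrite uE v0 addr0.
have small z (e' : R) : z \in F -> 0 < e' -> \forall s \near +oo, N s z <= e' * N s v.
  move=> zF e'0; have [->|z0] := eqVneq z 0.
    by near=> s; rewrite Nzero mulr_ge0// ltW.
  pose c := B * (N 0 z / N 0 v).
  have c0 : 0 < c by rewrite mulr_gt0// divr_gt0// Npos.
  have lim0 : expR (- b * s) @[s --> +oo] --> 0 by exact: cvg_expRN.
  have ec : 0 < e' / c by exact: divr_gt0.
  have lt : \forall s \near +oo, expR (- b * s) < e' / c by exact: (cvgr_lt 0 lim0).
  near=> s; have s0 : 0 < s by near: s; exact: nbhs_pinfty_gt.
  have := D s z v s0 zF z0 vG v0; rewrite ler_pdivrMr ?Npos// => /le_trans; apply.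
  rewrite [leLHS](_ : _ = c * expR (- b * s) * N s v); last by rewrite /c; field; rewrite gt_eqF// Npos.
  apply: ler_wpM2r => //; rewrite mulrC -ler_pdivlMr//; apply: ltW.
  by near: s.
have h0 : 0 < 2^-1 :> R by rewrite invr_gt0.
have e2 : 0 < e / 2 by rewrite divr_gt0.
(* The component [l] is eventually at most half of [v], so [v] is at most twice [u]; hence [e / 2]
   for [w]. *)
apply: filterS2 (small l _ lF h0) (small w _ wF e2) => s a1 a2.
have : N s v <= N s u + N s l.
  by rewrite -[N s l]Nopp; have := Nadd s u (- l); rewrite uE addrAC subrr add0r.
have := Nge s u; have := Nge s v; nra.
Unshelve. all: by end_near.
Qed.

(** Otherwise, by equality of dimensions, each subspace has a vector outside the other, and each of
    these two vectors would eventually be at most half of the other. *)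
Lemma dominates_unique F G F' G' : dominates F G -> dominates F' G' ->
  (F + G)%VS = fullv -> (F' + G')%VS = fullv -> \dim F = \dim F' -> F = F'.
Proof.
move=> D D' S S' dimE.
have [sub|/subvPn[w wF wF']] := boolP (F <= F')%VS.
  by apply/eqP; rewrite eqEdim sub dimE leqnn.
have [sub|/subvPn[u uF' uF]] := boolP (F' <= F)%VS.
  by apply/esym/eqP; rewrite eqEdim sub dimE leqnn.
have h0 : 0 < 2^-1 :> R by rewrite invr_gt0.
have h1 := dominates_negligible D S uF wF h0.
have h2 := dominates_negligible D' S' wF' uF' h0.
have w0 : w != 0 by apply: contraNneq wF' => ->; rewrite mem0v.
have [s [a1 a2]] := filter_ex (filterI h1 h2).
by exfalso; have := Npos s w0; lra.
Qed.

End FastSubspace.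

Lemma ratio_swap (R : realType) (a a' c c' k : R) : 0 < a -> 0 < a' -> 0 < c -> 0 < c' ->
  a / a' <= k * (c / c') -> c' / c <= k * (a' / a).
Proof.
move=> a0 a'0 c0 c'0; rewrite ler_pdivrMr// => H.
rewrite -[leLHS]mulr1 [leLHS](_ : _ = a * (c' / (a * c))); last by field; rewrite !gt_eqF.
rewrite [leRHS](_ : _ = k * (c / c') * a' * (c' / (a * c))); last by field; rewrite !gt_eqF.
by apply: ler_wpM2r => //; rewrite ltW// divr_gt0// mulr_gt0.
Qed.

Lemma gflow0 (R : realType) (x : UH2 R) : gflow 0 x = x.
Proof. exact: (flow0 Ds). Qed.

Lemma gflowD (R : realType) s r (x : UH2 R) : gflow s (gflow r x) = gflow (s + r) x.
Proof. exact: (flowD Ds). Qed.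

Section Splittings.
Variables (R : realType) (d : nat).
Implicit Types (A : oneform R d) (h : UH2 R -> 'M[R]_d) (u v w : 'cV[R]_d).

(** Once [E_x] is identified with the parallel sections, transport becomes the identity and the
    dynamics lies entirely in the variation of the norm of this frame along the orbit. *)
Definition flat_frame A h x : 'M[R]_d := invmx (triv A x) *m h x.

Lemma flat_frame_unit A h x : trivializable_connection A -> is_frame h ->
  flat_frame A h x \in unitmx.
Proof. by move=> AT [_ hu]; rewrite unitmx_mul unitmx_inv triv_unit// hu. Qed.

Lemma normM_flat A h x v : trivializable_connection A -> is_frame h ->
  normM (h x) (triv A x *m v) = normM (flat_frame A h x) v.
Proof.
move=> AT hF; have Tu := triv_unit x AT.
by rewrite -(normM_mul v Tu (flat_frame_unit x AT hF)) /flat_frame mulKVmx.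
Qed.

Lemma transport_flat A s x (v : 'cV[R]_d) : trivializable_connection A ->
  transport A s x *m (triv A x *m v) = triv A (gflow s x) *m v.
Proof. by move=> AT; rewrite /transport -mulmxA mulKmx// triv_unit. Qed.

Lemma flow_invariant_flat A (L : subfield R d) : trivializable_connection A ->
  flow_invariant A L <->
  forall s x (v : 'cV[R]_d), (triv A (gflow s x) *m v \in L (gflow s x)) = (triv A x *m v \in L x).
Proof.
move=> AT; split=> [I s x v|I s x v]; first by rewrite -transport_flat.
have -> : v = triv A x *m (invmx (triv A x) *m v) by rewrite mulKVmx// triv_unit.
by rewrite transport_flat.
Qed.

Lemma dominated_flat A h (L P : subfield R d) : trivializable_connection A -> is_frame h ->
  dominated A h L P <->
  exists B b : R, [/\ 0 < B, 0 < b & forall x s (u v : 'cV[R]_d), 0 < s ->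
    triv A x *m u \in L x -> u != 0 -> triv A x *m v \in P x -> v != 0 ->
    normM (flat_frame A h (gflow s x)) u / normM (flat_frame A h x) u <=
    B * expR (- b * s) *
      (normM (flat_frame A h (gflow s x)) v / normM (flat_frame A h x) v)].
Proof.
move=> AT hF.
have Tn x u : triv A x *m u != 0 <-> u != 0.
  split; apply: contraNneq; first by move=> ->; rewrite mulmx0.
  by move=> /(congr1 (mulmx (invmx (triv A x)))); rewrite mulKmx ?triv_unit// mulmx0 => ->.
split=> -[B [b [B0 b0 D]]]; exists B, b; split => // x s u v s0 uL u0 vP v0.
  by have := D x s _ _ s0 uL (proj2 (Tn x u) u0) vP (proj2 (Tn x v) v0);
    rewrite !transport_flat// !normM_flat.
have E w : w = triv A x *m (invmx (triv A x) *m w) by rewrite mulKVmx// triv_unit.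
move: uL u0 vP v0; rewrite (E u) (E v) => uL /Tn u0 vP /Tn v0.
by rewrite !transport_flat// !normM_flat//; exact: D.
Qed.

(** Under time reversal [P] is dominated by [L] with the same constants, as the four norms in the
    inequality trade places ([ratio_swap]). *)
Lemma dominated_flat_backward A h (L P : subfield R d) :
  trivializable_connection A -> is_frame h ->
  flow_invariant A L -> flow_invariant A P -> dominated A h L P ->
  exists B b : R, [/\ 0 < B, 0 < b & forall x s (u v : 'cV[R]_d), 0 < s ->
    triv A x *m u \in P x -> u != 0 -> triv A x *m v \in L x -> v != 0 ->
    normM (flat_frame A h (gflow (- s) x)) u / normM (flat_frame A h x) u <=
    B * expR (- b * s) *
      (normM (flat_frame A h (gflow (- s) x)) v / normM (flat_frame A h x) v)].
Proof.
move=> AT hF /(flow_invariant_flat _ AT) LI /(flow_invariant_flat _ AT) PI.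
move=> /(dominated_flat _ _ AT hF)[B [b [B0 b0 D]]]; exists B, b; split => // x s u v s0 uP u0 vL v0.
have := D (gflow (- s) x) s v u s0.
rewrite LI PI gflowD subrr gflow0 => /(_ vL v0 uP u0).
have Np y (w : 'cV[R]_d) : w != 0 -> 0 < normM (flat_frame A h y) w.
  by move=> w0; apply: normM_gt0 => //; exact: flat_frame_unit.
by apply: ratio_swap; exact: Np.
Qed.

(** Forward domination determines [L] by its dimension; time reversal then determines [P], of
    complementary dimension. *)
Lemma dominated_splitting_unique A h k (L P L' P' : subfield R d) :
  trivializable_connection A -> is_frame h ->
  dominated_splitting A h k L P -> dominated_splitting A h k L' P' ->
  forall x, L x = L' x /\ P x = P' x.
Proof.
move=> AT hF [S LI PI D] [S' LI' PI' D'] x.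
have Tu := triv_unit x AT.
have Fu y : flat_frame A h y \in unitmx by exact: flat_frame_unit.
pose N s (v : 'cV[R]_d) := normM (flat_frame A h (gflow s x)) (invmx (triv A x) *m v).
have Nadd s u v : N s (u + v) <= N s u + N s v by rewrite /N mulmxDr normMD.
have Nopp s u : N s (- u) = N s u by rewrite /N mulmxN normMN.
have Nzero s : N s 0 = 0 by rewrite /N mulmx0 normM0.
have inv0 (v : 'cV[R]_d) : v != 0 -> invmx (triv A x) *m v != 0.
  apply: contraNneq => /(congr1 (mulmx (triv A x))).
  by rewrite mulKVmx// mulmx0 => ->.
have Npos s u : u != 0 -> 0 < N s u by move=> u0; apply: normM_gt0 => //; exact: inv0.
have E v : v = triv A x *m (invmx (triv A x) *m v) by rewrite mulKVmx.
have N0 (v : 'cV[R]_d) : N 0 v = normM (flat_frame A h x) (invmx (triv A x) *m v).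
  by rewrite /N gflow0.
have fwd F G : dominated A h F G -> dominates N (F x) (G x).
  move=> /(dominated_flat _ _ AT hF)[B [b [B0 b0 H]]]; exists B, b; split => // s u v s0 uF u0 vG v0.
  by rewrite !N0; apply: H => //; rewrite -?E//; exact: inv0.
have bwd F G : flow_invariant A F -> flow_invariant A G -> dominated A h F G ->
    dominates (fun s => N (- s)) (G x) (F x).
  move=> FI GI /(dominated_flat_backward AT hF FI GI)[B [b [B0 b0 H]]].
  exists B, b; split => // s u v s0 uF u0 vG v0.
  by rewrite oppr0 !N0; apply: H => //; rewrite -?E//; exact: inv0.
have [LP LP0 dL] := S x; have [LP' LP0' dL'] := S' x.
split.
  by apply: (dominates_unique Nadd Nopp Nzero Npos (fwd _ _ D) (fwd _ _ D')) => //; rewrite dL dL'.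
apply: (dominates_unique _ _ _ _ (bwd _ _ LI PI D) (bwd _ _ LI' PI' D')) => //.
- by move=> s u; exact: Npos.
- by rewrite addvC.
- by rewrite addvC.
have := dimv_disjoint_sum LP0; have := dimv_disjoint_sum LP0'.
by rewrite LP LP' dL dL' => -> /addnI.
Qed.

End Splittings.

Section BlockUniqueness.
Variables (R : realType) (d n : nat).
Implicit Types (p q : 'I_n -> 'M[R]_d) (T M P Q Y : 'M[R]_d).

(** Inclusion of the ranges is enough, as each family is orthogonal and sums to the identity. *)
Lemma block_family_unique p q : block_family p -> block_family q ->
  (forall i (v : 'cV[R]_d), p i *m v = v -> q i *m v = v) -> p = q.
Proof.
move=> pP qP sub; apply: funext => j.
have qp i : q i *m p i = p i.
  by apply: mulmx_inj => v; rewrite -mulmxA sub// mulmxA block_idem.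
have -> : q j = \sum_i q j *m p i by rewrite -mulmx_sumr (proj2 pP) mulmx1.
rewrite (bigD1 j)//= qp big1 ?addr0// => i ij.
by rewrite -qp mulmxA block_mul// eq_sym (negbTE ij) mul0mx.
Qed.

Lemma block_family_conj T p : T \in unitmx -> block_family p ->
  block_family (fun i => T *m p i *m invmx T).
Proof.
move=> Tu [pm ps]; split=> [i j|].
  rewrite !mulmxA mulmxKV// -(mulmxA T) pm; case: eqP => // _.
  by rewrite mulmx0 mul0mx.
by rewrite -mulmx_suml -mulmx_sumr ps mulmx1 mulmxV.
Qed.

Lemma partial_sum_conj T p (S : pred 'I_n) :
  partial_sum (fun i => T *m p i *m invmx T) S = T *m partial_sum p S *m invmx T.
Proof. by rewrite /partial_sum -mulmx_suml -mulmx_sumr. Qed.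

(** On a vector [w] the hypothesis is applied to [v = Q w] and [u = P Y v]. The two projections cost
    [(d * kappa) ^+ 2]; the factors [d] pass between [frame_norm] and the action on vectors. *)
Lemma block_domination (M0 Ms P Q Y : 'M[R]_d) (c kappa : R) :
  M0 \in unitmx -> Ms \in unitmx -> P *m P = P -> Q *m Q = Q ->
  frame_norm M0 P <= kappa -> frame_norm Ms Q <= kappa -> 0 <= c -> 0 <= kappa ->
  (forall u v : 'cV[R]_d, P *m u = u -> u != 0 -> Q *m v = v -> v != 0 ->
    normM Ms u / normM M0 u <= c * (normM Ms v / normM M0 v)) ->
  frame_norm Ms (P *m Y *m Q) <= d%:R * (c * (d%:R * kappa) ^+ 2 * (d%:R * frame_norm M0 Y)).
Proof.
move=> M0u Msu PP QQ Pk Qk c_ge0 k0 dom; apply: frame_norm_le => // [|w].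
  apply: mulr_ge0; last by apply: mulr_ge0 => //; exact: frame_norm_ge0.
  by apply: mulr_ge0 => //; exact: sqr_ge0.
set v := Q *m w; set u := P *m Y *m Q *m w.
have nY := frame_norm_ge0 M0 Y; have dk0 : 0 <= d%:R * kappa by exact: mulr_ge0.
have [u0|u0] := eqVneq u 0.
  rewrite u0 normM0; apply: mulr_ge0; last exact: normM_ge0.
  apply: mulr_ge0; last by apply: mulr_ge0.
  by apply: mulr_ge0 => //; exact: sqr_ge0.
have uE : u = P *m (Y *m v) by rewrite /u /v !mulmxA.
have v0 : v != 0 by apply: contraNneq u0 => v0; rewrite uE v0 !mulmx0.
have Pu : P *m u = u by rewrite uE mulmxA PP.
have Qv : Q *m v = v by rewrite /v mulmxA QQ.
have nv0 := normM_gt0 M0u v0; have nu0 := normM_gt0 M0u u0.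
have := dom u v Pu u0 Qv v0; rewrite ler_pdivrMr// => /le_trans; apply.
have h1 : normM M0 u <= d%:R * kappa * (d%:R * frame_norm M0 Y * normM M0 v).
  rewrite uE; apply: le_trans (normM_mulmx_le _ _ M0u) _.
  apply: ler_pM; [by rewrite mulr_ge0// frame_norm_ge0|exact: normM_ge0|by rewrite ler_wpM2l|].
  exact: normM_mulmx_le.
have h2 : normM Ms v <= d%:R * kappa * normM Ms w.
  apply: le_trans (normM_mulmx_le _ _ Msu) _.
  by apply: ler_wpM2r; [exact: normM_ge0|rewrite ler_wpM2l].
have nvs := normM_ge0 Ms v; have nws := normM_ge0 Ms w.
apply: (@le_trans _ _ (c * (normM Ms v / normM M0 v) *
    (d%:R * kappa * (d%:R * frame_norm M0 Y * normM M0 v)))).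
  by apply: ler_wpM2l => //; rewrite mulr_ge0// divr_ge0// ltW.
rewrite [leLHS](_ : _ = c * (d%:R * kappa) * (d%:R * frame_norm M0 Y) * normM Ms v); last first.
  by field; rewrite gt_eqF.
rewrite [leRHS](_ : _ = c * (d%:R * kappa) * (d%:R * frame_norm M0 Y) * (d%:R * kappa * normM Ms w)); last first.
  by ring.
have nw := normM_ge0 Ms w; apply: ler_wpM2l => //.
by apply: mulr_ge0; apply: mulr_ge0.
Qed.

Lemma ratio_of_block_domination (M0 Ms P Q : 'M[R]_d) (c : R) (u v : 'cV[R]_d) :
  M0 \in unitmx -> Ms \in unitmx -> 0 <= c ->
  (forall Y, frame_norm Ms (P *m Y *m Q) <= c * frame_norm M0 Y) ->
  P *m u = u -> u != 0 -> Q *m v = v -> v != 0 ->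
  normM Ms u / normM M0 u <= d%:R ^+ 2 * c * (normM Ms v / normM M0 v).
Proof.
move=> M0u Msu c_ge0 dom Pu u0 Qv v0.
(* The domination is tested on the rank one matrix [u <v, .>]. *)
have [l lE] : exists l : 'rV[R]_d, forall w : 'cV[R]_d, l *m w = (dotM M0 v w)%:M.
  exists ((invmx M0 *m v)^T *m invmx M0) => w.
  apply/matrixP => i j; rewrite [i]ord1 [j]ord1 -mulmxA mxE [RHS]mxE eqxx mulr1n.
  by apply: eq_bigr => k _; rewrite mxE.
have nu := normM_gt0 M0u u0; have nv := normM_gt0 M0u v0; have nvs := normM_gt0 Msu v0.
have Yn : frame_norm M0 (u *m l) <= d%:R * (normM M0 u * normM M0 v).
  apply: frame_norm_le => //; first by rewrite mulr_ge0// ltW.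
  move=> w; rewrite -mulmxA lE mul_mx_scalar normMZ mulrC -mulrA.
  by apply: ler_wpM2l; [exact: ltW|exact: dotM_le].
have PYQ : P *m (u *m l) *m Q *m v = (normM M0 v) ^+ 2 *: u.
  by rewrite -!mulmxA Qv lE -normM_sqr mul_mx_scalar -scalemxAr Pu.
have : (normM M0 v) ^+ 2 * normM Ms u <=
    d%:R * (c * (d%:R * (normM M0 u * normM M0 v))) * normM Ms v.
  have := normMZ Ms (normM M0 v ^+ 2) u; rewrite ger0_norm ?sqr_ge0// => <-.
  rewrite -PYQ; apply: le_trans (normM_mulmx_le _ _ Msu) _.
  apply: ler_wpM2r; first exact: ltW.
  by apply: ler_wpM2l => //; apply: le_trans (dom _) _; apply: ler_wpM2l.
move: nu nv nvs (normM_ge0 Ms u); move: (normM M0 u) (normM M0 v) (normM Ms u) (normM Ms v).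
move=> x y xs ys x0 y0 ys0 xs0 H; rewrite ler_pdivrMr//.
rewrite -(ler_pM2l (_ : 0 < y ^+ 2)) ?exprn_gt0//; apply: le_trans H _.
by rewrite le_eqVlt; apply/orP; left; apply/eqP; field; rewrite gt_eqF.
Qed.

End BlockUniqueness.

Lemma sum_le_const (R : realType) (I : finType) (S : pred I) (F : I -> R) (c : R) : 0 <= c ->
  (forall i, S i -> F i <= c) -> \sum_(i | S i) F i <= #|I|%:R * c.
Proof.
move=> c_ge0 Fc; apply: (@le_trans _ _ (\sum_(i : I) c)); last by rewrite sumr_const mulr_natl.
by rewrite big_mkcond; apply: ler_sum => i _; case: ifP => // /Fc.
Qed.

Lemma uniform_rate (R : realType) (I : finType) (P : I -> R -> R -> Prop) :
  (forall i, exists B b, [/\ 0 < B, 0 < b & P i B b]) ->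
  (forall i B b B' b', 0 < B -> P i B b -> B <= B' -> 0 < b' <= b -> P i B' b') ->
  exists B b, [/\ 1 <= B, 0 < b & forall i, P i B b].
Proof.
move=> ex mono; have [f fP] := choice ex; have [g gP] := choice fP.
(* Sum and minimum both start from 1, so that [1 <= B] and the rate is positive even for an empty
   family. *)
exists (1 + \sum_i f i), (\big[Num.min/1]_i g i); split.
- by rewrite lerDl sumr_ge0// => i _; have [/ltW] := gP i.
- by apply: lt_bigmin => [|i _]; [exact: ltr01|have [] := gP i].
move=> i; have [f0 g0 Pi] := gP i; apply: mono f0 Pi _ _.
  rewrite (bigD1 i)//= addrCA lerDl addr_ge0// sumr_ge0// => j _.
  by have [/ltW] := gP j.
rewrite bigmin_le andbT.
by apply: lt_bigmin => [|j _]; [exact: ltr01|have [] := gP j].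
Qed.

(** * Splittings as families of idempotents of the parallel sections *)

Section Splitting.
Variables (R : realType) (d n : nat) (K : 'I_n -> nat).
Variables (A : oneform R d) (h : UH2 R -> 'M[R]_d).
Hypotheses (AT : trivializable_connection A) (hF : is_frame h).
Local Notation T := (triv A).
Let Tu x : T x \in unitmx := triv_unit x AT.

(** [the_splitting] is a mere choice, but uniqueness of dominated splittings gives it the same flags
    as [E]; so any known splitting computes [proj]. *)
Lemma proj_block_family E x (q : 'I_n.+1 -> 'M[R]_d) a :
  theta_splitting K A h E -> block_family q ->
  (forall i, E x i = fix_space (T x *m q i *m invmx (T x))) ->
  proj K A h a x = partial_sum q (fun i => (i <= a)%N).
Proof.
move=> EP qP Eq; set r := fun i => T x *m q i *m invmx (T x).
have rP : block_family r by exact: block_family_conj.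
have SP : theta_splitting K A h (the_splitting K A h) by apply: xgetPex; exists E.
have [FE FoE] := dominated_splitting_unique AT hF (proj2 SP a) (proj2 EP a) x.
rewrite /proj FE FoE.
have -> : flagF E a x = fix_space (partial_sum r (fun i => (i <= a)%N)).
  by rewrite -sum_fix_spaces//; apply: eq_bigr => i _; rewrite Eq.
have -> : flagFo E a x = fix_space (1%:M - partial_sum r (fun i => (i <= a)%N)).
  rewrite -partial_sumC// -sum_fix_spaces//; apply: eq_big => i; first by rewrite ltnNge.
  by rewrite Eq.
rewrite projector_fix_space.
  by rewrite partial_sum_conj !mulmxA mulVmx// mul1mx mulmxKV.
rewrite partial_sum_mul_sum//; apply: eq_bigl => i; exact: andbb.
Qed.

Section Blocks.
Variables (E : UH2 R -> 'I_n.+1 -> {vspace 'cV[R]_d}) (p : UH2 R -> 'I_n.+1 -> 'M[R]_d).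
Hypotheses (pP : forall x, block_family (p x))
  (Ep : forall x i, E x i = fix_space (T x *m p x i *m invmx (T x))).

Lemma mem_block_sum x (S : pred 'I_n.+1) (v : 'cV[R]_d) :
  (T x *m v \in (\sum_(i < n.+1 | S i) E x i)%VS) = (partial_sum (p x) S *m v == v).
Proof.
rewrite (eq_bigr (fun i => fix_space (T x *m p x i *m invmx (T x)))) => [|i _]; last exact: Ep.
rewrite sum_fix_spaces; last exact: block_family_conj.
rewrite partial_sum_conj mem_fix_space -!mulmxA (mulKmx (Tu x)).
by apply/eqP/eqP => [|->//]; exact: (can_inj (mulKmx (Tu x))).
Qed.

Lemma mem_block x i (v : 'cV[R]_d) : (T x *m v \in E x i) = (p x i *m v == v).
Proof.
have := mem_block_sum x (pred1 i) v.
by rewrite big_pred1_eq /partial_sum big_pred1_eq.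
Qed.

(** Transport is the identity on parallel sections, so invariance of the summands means that the
    idempotents are constant along orbits. *)
Lemma block_flow_invariant : (forall i, flow_invariant A (fun x => E x i)) <->
  forall s x, p (gflow s x) = p x.
Proof.
split=> [I s x|I i].
  apply: block_family_unique => // i v pv.
  have := proj1 (flow_invariant_flat _ AT) (I i) s x v.
  by rewrite !mem_block pv eqxx => /esym/eqP.
by apply/flow_invariant_flat => // s x v; rewrite !mem_block I.
Qed.

Lemma block_invariant_sum : (forall s x, p (gflow s x) = p x) ->
  forall S : pred 'I_n.+1, flow_invariant A (fun x => (\sum_(i < n.+1 | S i) E x i)%VS).
Proof. by move=> I S; apply/flow_invariant_flat => // s x v; rewrite !mem_block_sum I. Qed.

Local Notation M := (flat_frame A h).
Let Mu x : M x \in unitmx := flat_frame_unit x AT hF.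

Lemma blocks_dominated b C : 0 < b -> 0 <= C -> (forall s x, p (gflow s x) = p x) ->
  (forall x (i j : 'I_n.+1) (Y : 'M[R]_d) s, (i < j)%N -> 0 <= s ->
    frame_norm (M (gflow s x)) (p x i *m Y *m p x j) <=
      C * expR (- b * s) * frame_norm (M x) Y) ->
  forall a, dominated A h (flagF E a) (flagFo E a).
Proof.
move=> b0 C_ge0 I dom a; apply/dominated_flat => //.
pose B := d%:R ^+ 2 * (n.+1%:R * n.+1%:R * C).
have B0 : 0 <= B.
  by apply: mulr_ge0; [exact: sqr_ge0|apply: mulr_ge0 => //; exact: mulr_ge0].
(* [B] may vanish, whereas [dominated] asks for a positive constant. *)
exists (B + 1), b; split => // [|x s u v s0]; first by lra.
rewrite !mem_block_sum => /eqP Pu u0 /eqP Qv v0.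
set P := partial_sum _ _ in Pu; set Q := partial_sum _ _ in Qv.
have e0 : 0 <= expR (- b * s) by exact: expR_ge0.
have n0 y w : 0 <= normM (M y) w by exact: normM_ge0.
have PQ Y : frame_norm (M (gflow s x)) (P *m Y *m Q) <=
    (n.+1%:R * n.+1%:R * (C * expR (- b * s))) * frame_norm (M x) Y.
  have := frame_norm_ge0 (M x) Y => Y0.
  have c_ge0 : 0 <= C * expR (- b * s) * frame_norm (M x) Y.
    by apply: mulr_ge0 => //; exact: mulr_ge0.
  rewrite -(mulrA _ _ (frame_norm _ _)) -mulrA -[n.+1 in leRHS]card_ord.
  rewrite /P /partial_sum mulmx_suml mulmx_suml; apply: le_trans (frame_norm_sum _ _ _ _) _.
  apply: sum_le_const => [|i ia]; first exact: mulr_ge0.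
  rewrite /Q /partial_sum mulmx_sumr; apply: le_trans (frame_norm_sum _ _ _ _) _.
  by apply: sum_le_const => // j aj; apply: dom; [exact: leq_ltn_trans aj|exact: ltW].
apply: (@le_trans _ _ (B * expR (- b * s) * (normM (M (gflow s x)) v / normM (M x) v))).
  have := ratio_of_block_domination (Mu x) (Mu (gflow s x)) _ PQ Pu u0 Qv v0.
  rewrite (_ : d%:R ^+ 2 * _ = B * expR (- b * s)); last by rewrite /B; ring.
  by apply; apply: mulr_ge0; [exact: mulr_ge0|exact: mulr_ge0].
apply: ler_wpM2r; first by apply: divr_ge0.
by apply: ler_wpM2r => //; lra.
Qed.

Lemma blocks_theta_splitting b C : 0 < b -> 0 <= C -> (forall s x, p (gflow s x) = p x) ->
  (forall x (i j : 'I_n.+1) (Y : 'M[R]_d) s, (i < j)%N -> 0 <= s ->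
    frame_norm (M (gflow s x)) (p x i *m Y *m p x j) <=
      C * expR (- b * s) * frame_norm (M x) Y) ->
  (forall x (a : 'I_n), \dim (fix_space (partial_sum (p x) (fun i => (i <= a)%N))) = K a) ->
  theta_splitting K A h E.
Proof.
move=> b0 C_ge0 I dom dimK.
have FE x (S : pred 'I_n.+1) : (\sum_(i < n.+1 | S i) E x i)%VS =
    fix_space (T x *m partial_sum (p x) S *m invmx (T x)).
  rewrite (eq_bigr (fun i => fix_space (T x *m p x i *m invmx (T x)))) => [|i _]; last exact: Ep.
  rewrite sum_fix_spaces; last exact: block_family_conj.
  by rewrite partial_sum_conj.
split.
  split; last by apply/block_flow_invariant.
  move=> x; rewrite (_ : E x = fun i => fix_space (T x *m p x i *m invmx (T x))); last first.
    by apply: funext => i; exact: Ep.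
  by apply: directv_fix_spaces; exact: block_family_conj.
move=> a; split.
- move=> x; rewrite /flagF /flagFo !FE.
  set P := partial_sum _ _; set Q := partial_sum _ _.
  have QE : Q = 1%:M - P.
    by rewrite -partial_sumC//; apply: eq_bigl => i; rewrite ltnNge.
  have PP : P *m P = P.
    by rewrite partial_sum_mul_sum//; apply: eq_bigl => i; exact: andbb.
  rewrite dim_fix_conj// dimK.
  have -> : T x *m Q *m invmx (T x) = 1%:M - T x *m P *m invmx (T x).
    by rewrite QE mulmxBr mulmxBl mulmx1 mulmxV.
  have [] // := @fix_space_direct _ _ (T x *m P *m invmx (T x)).
  by rewrite !mulmxA mulmxKV// -(mulmxA _ P P) PP.
- exact: block_invariant_sum.
- exact: block_invariant_sum.
exact: (blocks_dominated b0 C_ge0).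
Qed.


(** The fibres of the two fields belong to their own closures, so transversality bounds their angle
    from below, and [angle_bound] bounds the projector. *)
Lemma block_partial_bound a : transverse_closures h (flagF E a) (flagFo E a) ->
  exists k : R, 0 <= k /\ forall x,
    frame_norm (M x) (partial_sum (p x) (fun i => (i <= a)%N)) <= k.
Proof.
move=> [e0 [e00 tr]]; have [k [k1 kP]] := angle_bound d e00.
exists (d%:R * k); split => [|x]; first by rewrite mulr_ge0//; lra.
have self (L : subfield R d) : section_closure h L x (L x).
  move=> U e xU e_gt0; exists x; first exact: nbhs_singleton.
  exact: le_lt_trans (distM_self _ _) _.
have hu : h x \in unitmx by case: hF.
apply: frame_norm_le => // [|v]; first by lra.
rewrite -!normM_flat//.
set P := partial_sum _ _.
have Pa : P *m P = P by rewrite partial_sum_mul_sum//; apply: eq_bigl => i; exact: andbb.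
have -> : T x *m v = T x *m (P *m v) + T x *m ((1%:M - P) *m v).
  by rewrite -mulmxDr -mulmxDl subrKC mul1mx.
apply: (kP _ _ _ hu (tr _ _ _ (self _) (self _))).
  by rewrite mem_block_sum mulmxA Pa.
rewrite mem_block_sum (_ : partial_sum _ _ = 1%:M - P); last first.
  by rewrite -partial_sumC//; apply: eq_bigl => i; rewrite ltnNge.
by rewrite mulmxA mulmxBl mul1mx [P *m (_ - _)]mulmxBr mulmx1 Pa subrr subr0.
Qed.

(** Each block is the difference of two consecutive flag projectors, which are uniformly bounded. *)
Lemma block_bound : (forall a, transverse_closures h (flagF E a) (flagFo E a)) ->
  exists k : R, 0 <= k /\ forall x i, frame_norm (M x) (p x i) <= k.
Proof.
move=> tr; have [f fP] := choice (fun a => block_partial_bound (tr a)).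
pose k := d%:R + \sum_a f a.
have k0 : 0 <= k by rewrite addr_ge0// sumr_ge0// => a _; case: (fP a).
have fk a : f a <= k.
  rewrite /k (bigD1 a)//= addrCA lerDl addr_ge0// sumr_ge0// => c _.
  by case: (fP c).
have partial x m : frame_norm (M x) (partial_sum (p x) (fun i => (i < m)%N)) <= k.
  (* Truncation at 0 gives zero and truncation beyond [n] gives the identity; in between, truncation
     at [m] is the flag projector of label [m - 1]. *)
  case: m => [|m]; first by rewrite /partial_sum big_pred0// frame_norm0.
  have [mn|nm] := ltnP m n; first by apply: le_trans (fk (Ordinal mn)); case: (fP (Ordinal mn)).
  rewrite /partial_sum (eq_bigl xpredT) => [|i].
    by rewrite (proj2 (pP x)); apply: le_trans (frame_norm1 (Mu x)) _; rewrite lerDl sumr_ge0// => a _; case: (fP a).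
  by rewrite ltnS (leq_trans _ nm)// -ltnS.
exists (k + k); split => [|x i]; first exact: addr_ge0.
have -> : p x i = partial_sum (p x) (fun j => (j < i.+1)%N) - partial_sum (p x) (fun j => (j < i)%N).
  rewrite /partial_sum (bigD1 i)//= (eq_bigl (fun j : 'I_n.+1 => (j < i)%N)) ?addrK// => j.
  by rewrite ltnS ltn_neqAle andbC.
by apply: le_trans (frame_normB _ _ _) _; apply: lerD; exact: partial.
Qed.


Lemma mem_flagF x (a : 'I_n) (i : 'I_n.+1) (u : 'cV[R]_d) : (i <= a)%N -> p x i *m u = u ->
  T x *m u \in flagF E a x.
Proof.
by move=> ia pu; rewrite mem_block_sum -pu mulmxA partial_sum_mul// ia.
Qed.

Lemma mem_flagFo x (a : 'I_n) (i : 'I_n.+1) (u : 'cV[R]_d) : (a < i)%N -> p x i *m u = u ->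
  T x *m u \in flagFo E a x.
Proof.
by move=> ia pu; rewrite mem_block_sum -pu mulmxA partial_sum_mul// ia.
Qed.

(** The boolean is the direction of time: [true] for the forward flow, [false] for the backward one,
    where the two flags exchange roles. Unlike in [dominated], the time 0 is included. *)
Let dominates_at a (e : bool) (B b : R) := forall x s (u v : 'cV[R]_d), 0 <= s ->
  T x *m u \in (if e then flagF E a x else flagFo E a x) -> u != 0 ->
  T x *m v \in (if e then flagFo E a x else flagF E a x) -> v != 0 ->
  normM (M (gflow (if e then s else - s) x)) u / normM (M x) u <= B * expR (- b * s) *
    (normM (M (gflow (if e then s else - s) x)) v / normM (M x) v).

Lemma dominated_uniform :
  (forall a, flow_invariant A (flagF E a) /\ flow_invariant A (flagFo E a)) ->
  (forall a, dominated A h (flagF E a) (flagFo E a)) ->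
  exists B b, [/\ 1 <= B, 0 < b & forall a e, dominates_at a e B b].
Proof.
move=> I D.
have np y (w : 'cV[R]_d) : w != 0 -> 0 < normM (M y) w by move=> w0; exact: normM_gt0.
pose P (ae : 'I_n * bool) B b := forall x s (u v : 'cV[R]_d), 0 < s ->
  T x *m u \in (if ae.2 then flagF E ae.1 x else flagFo E ae.1 x) -> u != 0 ->
  T x *m v \in (if ae.2 then flagFo E ae.1 x else flagF E ae.1 x) -> v != 0 ->
  normM (M (gflow (if ae.2 then s else - s) x)) u / normM (M x) u <= B * expR (- b * s) *
    (normM (M (gflow (if ae.2 then s else - s) x)) v / normM (M x) v).
have [|ae B b B' b' B0 H BB /andP[b'0 bb] x s u v s0 uF u0 vG v0|B [b [B1 b0 H]]] :=
  @uniform_rate _ _ P.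
- move=> [a [|]]; rewrite /P /=.
    by have [B [b [B0 b0 H]]] := proj1 (dominated_flat _ _ AT hF) (D a); exists B, b.
  have [B [b [B0 b0 H]]] := dominated_flat_backward AT hF (proj1 (I a)) (proj2 (I a)) (D a).
  by exists B, b.
- apply: le_trans (H x s u v s0 uF u0 vG v0) _.
  apply: ler_wpM2r; first by rewrite divr_ge0// ltW// np.
  have e0 : 0 <= expR (- b * s) by exact: expR_ge0.
  apply: (@le_trans _ _ (B' * expR (- b * s))); first exact: ler_wpM2r.
  by apply: ler_wpM2l; [lra|rewrite ler_expR ler_pM2r// lerN2].
(* At [s = 0] both ratios are 1, and [1 <= B] is enough. *)
exists B, b; split => // a e x s u v; rewrite le_eqVlt => /orP[/eqP <-|s0]; last exact: (H (a, e)).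
move=> _ u0 _ v0; have -> : (if e then 0 else - 0) = 0 :> R by case: e; rewrite ?oppr0.
have npu := np x u u0; have npv := np x v v0.
by rewrite gflow0 mulr0 expR0 !divff ?gt_eqF// !mulr1.
Qed.

Lemma theta_blocks_flow : invariant_decomposition A E ->
  (forall a, dominated A h (flagF E a) (flagFo E a)) ->
  (forall a, transverse_closures h (flagF E a) (flagFo E a)) ->
  exists b C kappa, block_flow (@gflow R) M p b C kappa.
Proof.
move=> [_ I] D tr; have pI := proj1 block_flow_invariant I.
have [k [k0 kP]] := block_bound tr.
have [|B [b [B1 b0 H]]] := dominated_uniform _ D.
  by move=> a; split; exact: block_invariant_sum.
have B0 : 0 <= B by lra.
pose C := d%:R * (B * (d%:R * k) ^+ 2 * d%:R).
have C_ge0 : 0 <= C.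
  by apply: mulr_ge0 => //; apply: mulr_ge0 => //; apply: mulr_ge0 => //; exact: sqr_ge0.
have CE s Y x : C * expR (- b * s) * frame_norm (M x) Y =
    d%:R * (B * expR (- b * s) * (d%:R * k) ^+ 2 * (d%:R * frame_norm (M x) Y)).
  by rewrite /C; ring.
have idem x i : p x i *m p x i = p x i by exact: block_idem.
have Be s : 0 <= B * expR (- b * s) by apply: mulr_ge0 => //; exact: expR_ge0.
exists b, C, k; split => //.
- exact: gflow0.
- exact: gflowD.
- move=> x s; apply: cvg_mulmx.
    apply: cvg_invmx => [t||]; [exact: Tu|exact: Tu|].
    exact: (triv_orbit_continuous (i := Ds)).
  apply: (@continuous_comp _ _ _ (fun s => gflow s x) h); first exact: (continuous_flow (i := Ds)).
  by case: hF => hC _; exact: hC.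
- move=> x i j Y s ij s0; rewrite CE.
  apply: block_domination => //; first by rewrite -(pI s x).
  move=> u v pu u0 pv v0.
  (* As [i < j <= n], the index [i] is itself a label, and its flag separates the two blocks. *)
  have an : (i < n)%N by apply: leq_trans ij _; rewrite -ltnS.
  apply: (H (Ordinal an) true x s) => //.
    exact: mem_flagF pu.
  exact: mem_flagFo pv.
move=> x i j Y s ij s0; rewrite CE.
apply: block_domination => //; first by rewrite -(pI (- s) x).
move=> u v pu u0 pv v0.
have an : (j < n)%N by apply: leq_trans ij _; rewrite -ltnS.
apply: (H (Ordinal an) false x s) => //.
  exact: mem_flagFo pu.
exact: mem_flagF pv.
Qed.

End Blocks.

Lemma theta_block_flow : theta_uniformly_hyperbolic K A h -> exists E p b C kappa,
  [/\ block_flow (@gflow R) (flat_frame A h) p b C kappa, theta_splitting K A h E &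
    forall x i, E x i = fix_space (T x *m p x i *m invmx (T x))].
Proof.
move=> [E [EI EH]].
have [f fP] := choice (fun x => block_of_decomposition (proj1 (proj1 EI x)) (proj2 (proj1 EI x))).
pose p x i := invmx (T x) *m f x i *m T x.
have pP x : block_family (p x).
  have := @block_family_conj _ _ _ (invmx (T x)) (f x); rewrite unitmx_inv invmxK.
  by apply => //; case: (fP x).
have Ep x i : E x i = fix_space (T x *m p x i *m invmx (T x)).
  by rewrite !mulmxA mulmxV// mul1mx mulmxK//; case: (fP x).
have [|a|b [C [kappa H]]] := theta_blocks_flow pP Ep EI; last exists E, p, b, C, kappa; last split => //.
- by move=> a; have [_ _ [_ _ _]] := EH a.
- by have [_ _ _ _ []] := EH a.
by split => // a; have [] := EH a.
Qed.

End Splitting.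

(** * Variation of the projectors *)

Lemma frame_norm_conj (R : realType) (d : nat) (S M Y : 'M[R]_d) : S \in unitmx -> M \in unitmx ->
  frame_norm (S *m M) (S *m Y *m invmx S) = frame_norm M Y.
Proof.
move=> Su Mu; rewrite !frame_normE invmx_mulmx//; congr (_ * `|_|).
by rewrite !mulmxA mulmxKV// -(mulmxA _ (invmx S) S) mulVmx// mulmx1.
Qed.

(** * A bound of order [t] on the variation, uniform over all points *)

Section Bound.
Variables (R : realType) (d k : nat) (eps : R) (A : R -> oneform R d) (h : UH2 R -> 'M[R]_d).
Hypotheses (k0 : (0 < k)%N) (hvar : bounded_variation_of k eps A h) (hF : is_frame h).

Lemma variation_derive x t : `|t| < eps -> exists D : 'M[R]_d,
  is_derive (t : R) (1 : R) (fun t => A t Ds x - A 0 Ds x) D.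
Proof.
case: hvar => [e0 AT [D [D0 _ DD _]] _] te; exists (D 1%N t x); apply/is_deriveP.
apply/cvgrPdist_le => e e_gt0.
have te' : \forall s \near (0 : R)^', `|t + s| < eps.
  apply: nbhs_dnbhs; have c : t + s @[s --> (0 : R)] --> t.
    by rewrite -[X in _ --> X]addr0; apply: cvgD; [exact: cvg_cst|exact: cvg_id].
  by apply: (cvgr_norm_lt _ c).
have H : \forall s \near (0 : R)^', forall y, [set x] y ->
    `|s^-1 *: (D 0%N (t + s) y - D 0%N t y) - D 1%N t y| <= e.
  by apply: family_compact_cvg e_gt0; [exact: (DD 0%N t k0 te)|exact: compact_set1].
move: te' H; apply: filterS2 => s tse /(_ x erefl).
by rewrite !D0// distrC [s + t]addrC.
Qed.

(** The mean value inequality in [t], at each fixed [x] and in the frame [h x], so that the constant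
    does not depend on [x]. One factor [d] passes from vectors to matrices, the other belongs to
    [frame_norm]. *)
Lemma variation_bound : exists C : R, 0 <= C /\ \forall t \near (0 : R), forall x,
  frame_norm (h x) (A t Ds x - A 0 Ds x) <= C * `|t|.
Proof.
case: (hvar) => [e0 AT _ [C H]].
pose c := d%:R * Num.max C 0.
have hu x : h x \in unitmx by case: hF.
have cge0 : 0 <= c by apply: mulr_ge0 => //; rewrite le_max lexx orbT.
exists (d%:R * c); split; first exact: mulr_ge0.
have ne : \forall t \near (0 : R), `|t| < eps.
  exact: near0_lt.
have [r /= r0 rP] := proj1 (nbhs_ballP _ _) (filterI H ne).
have rP' t : `|t| < r -> (forall x (v : 'cV[R]_d), normM (h x) (derive1 (fun s => A s Ds x - A 0 Ds x) t *m v) <= C * normM (h x) v) /\ `|t| < eps.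
  by move=> tr; apply: rP; rewrite -ball_normE /ball_ /= sub0r normrN.
apply/(nbhs_ballP _ _); exists r => //= t; rewrite -ball_normE /ball_ /= sub0r normrN => tr x.
pose F s := invmx (h x) *m (A s Ds x - A 0 Ds x) *m h x.
have Fder s : `|s| < r -> is_derive (s : R) (1 : R) F ('D_1 F s) /\ `|'D_1 F s| <= c.
  move=> sr; have [Hs se] := rP' s sr; have [D DP] := variation_derive x se.
  have FD : is_derive (s : R) (1 : R) F (invmx (h x) *m D *m h x).
    by apply: is_derive_mulmxr; apply: is_derive_mulmxl.
  have FE : 'D_1 F s = invmx (h x) *m D *m h x by rewrite derive_val.
  rewrite FE; split => //.
  (* [variation_derive] provides a true derivative, so the value of [derive1] bounded by the
     hypothesis is [D]. *)
  have DE : D = derive1 (fun s => A s Ds x - A 0 Ds x) s by rewrite derive1E derive_val.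
  apply: le_trans (conj_le_frame_norm _ _) _; apply: frame_norm_le => // [|v].
    by rewrite le_max lexx orbT.
  rewrite DE; apply: le_trans (Hs x v) _; apply: ler_wpM2r; first exact: normM_ge0.
  by rewrite le_max lexx.
rewrite frame_normE -mulrA ler_wpM2l//.
have F0 : F 0 = 0 by rewrite /F subrr mulmx0 mul0mx.
have -> : invmx (h x) *m (A t Ds x - A 0 Ds x) *m h x = F t - F 0 by rewrite F0 subr0.
have Gd (s : R) : is_derive s (1 : R) (fun s => c * s) c.
  by refine (is_derive_eq (is_derive_scalefun c (is_derive_id s (1 : R))) _); rewrite /GRing.scale /= mulr1.
have [t0|t0] := leP 0 t.
  have := @mx_derive_norm _ _ _ F (fun s => 'D_1 F s) (fun s => c * s) (fun=> c) 0 t t0.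
  rewrite mulr0 subr0 (ger0_norm t0); apply=> s // /andP[s0 st];
    by have [] := Fder s _; rewrite // ger0_norm// (le_lt_trans st)// -(ger0_norm t0).
have := @mx_derive_norm _ _ _ F (fun s => 'D_1 F s) (fun s => c * s) (fun=> c) t 0 (ltW t0).
have -> : c * 0 - c * t = c * `|t| by rewrite (ltr0_norm t0); ring.
rewrite distrC; apply=> s // /andP[ts s0];
  by have [] := Fder s _; rewrite // ler0_norm// (le_lt_trans _ tr)// (ltr0_norm t0) lerN2.
Qed.

End Bound.

(** * The projectors of the perturbed connection *)

Section Perturbed.
Variables (R : realType) (d n : nat) (K : 'I_n -> nat) (eps : R) (A : R -> oneform R d).
Variables (h : UH2 R -> 'M[R]_d) (E : UH2 R -> 'I_n.+1 -> {vspace 'cV[R]_d}).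
Variables (p : UH2 R -> 'I_n.+1 -> 'M[R]_d) (b C kappa : R).
Hypotheses (eps0 : 0 < eps) (AT : forall t, `|t| < eps -> trivializable_connection (A t)).
Hypothesis hF : is_frame h.
Local Notation M := (flat_frame (A 0) h).
Hypothesis H : block_flow (@gflow R) M p b C kappa.
Hypothesis ES : theta_splitting K (A 0) h E.
Hypothesis Ep : forall x i, E x i = fix_space (triv (A 0) x *m p x i *m invmx (triv (A 0) x)).
Variables (t delta : R) (Z : UH2 R -> 'M[R]_d).
Hypotheses (te : `|t| < eps) (delta0 : 0 <= delta).
Local Notation B := (triv_diff A t Ds).
Hypotheses (BC : orbit_continuous (@gflow R) B) (Bd : bounded_by M B delta).
Hypothesis small : int_const d n.+1 b C * pert_const d n.+1 kappa * delta <= 4^-1.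
Hypothesis small' : d%:R * (2 * C * (diag_const n.+1 kappa * (delta * (d%:R + 1)))) <= b / 4.
Hypothesis Zn : near_id n.+1 (@gflow R) M b C kappa delta Z.
Hypothesis ZE : forall x, Z x = picard (@gflow R) p B Z x.
Local Notation W := (triv_ratio A t).

(** The blocks conjugated by [Z] are invariant under the cocycle [W (gflow s y) W (y)^-1]. Pulled
    back by [W] to the parallel sections of [A t], they form a dominated splitting with the ranks of
    the original one, hence the only one. *)
Lemma perturbed_proj x a : proj K (A t) h a x =
  invmx (W x) *m (Z x *m partial_sum (p x) (fun i => (i <= a)%N) *m invmx (Z x)) *m W x.
Proof.
have AT0 : trivializable_connection (A 0) by apply: AT; rewrite normr0.
have Wu y : W y \in unitmx by exact: triv_ratio_unit te.
have Zu y : Z y \in unitmx by case: (near_id_inv H small Zn y).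
have Mu y : M y \in unitmx by exact: flat_frame_unit.
pose q y i := invmx (W y) *m conj_block p Z y i *m W y.
have qP y : block_family (q y).
  have := @block_family_conj _ _ _ (invmx (W y)) (conj_block p Z y); rewrite unitmx_inv invmxK.
  by apply => //; apply: block_family_conj => //; exact: bf_block H y.
have qS y S : partial_sum (q y) S = invmx (W y) *m (Z y *m partial_sum (p y) S *m invmx (Z y)) *m W y.
  have := partial_sum_conj (invmx (W y)) (conj_block p Z y) S; rewrite invmxK => ->.
  by rewrite partial_sum_conj.
rewrite -qS.
pose Et y i := fix_space (triv (A t) y *m q y i *m invmx (triv (A t) y)).
have Wx y : triv (A t) y = triv (A 0) y *m W y by rewrite /triv_ratio mulKVmx// triv_unit.
have MW y : flat_frame (A t) h y = invmx (W y) *m M y.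
  by rewrite /flat_frame Wx invmx_mulmx ?triv_unit// mulmxA.
pose U y s := W (gflow s y) *m invmx (W y).
have Uu y s : U y s \in unitmx by rewrite unitmx_mul unitmx_inv !Wu.
have U0 y : U y 0 = 1%:M by rewrite /U gflow0 mulmxV.
have UD y s : is_derive (s : R) (1 : R) (U y) (- (B (gflow s y) *m U y s)).
  refine (is_derive_eq (is_derive_mulmxr _ (triv_ratio_derive eps0 AT Ds y s te)) _).
  by rewrite mulNmx -mulmxA.
have UC y s i : U y s *m conj_block p Z y i *m invmx (U y s) = conj_block p Z (gflow s y) i.
  exact: (perturbed_conj H BC Bd small delta0 Zn ZE (Uu y) (U0 y) (UD y)).
have qI s y : q (gflow s y) = q y.
  apply: funext => i; rewrite /q -UC /U.
  move: (Wu y) (Wu (gflow s y)); move: (W y) (W (gflow s y)) (conj_block p Z y i) => w w' X wu wu'.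
  rewrite invmx_mulmx ?unitmx_inv// invmxK !mulmxA mulVmx// mul1mx.
  by rewrite mulmxKV.
apply: (proj_block_family (AT te) hF (E := Et)) => //.
pose C' := (d%:R + 1) ^+ 2 * (2 * d%:R) ^+ 2 * (2 * C).
have C'0 : 0 <= C'.
  by apply: mulr_ge0; [apply: mulr_ge0; exact: sqr_ge0|apply: mulr_ge0 => //; exact: bf_C H].
have EW y Y : frame_norm (invmx (W y) *m M y) Y = frame_norm (M y) (W y *m Y *m invmx (W y)).
  move: (Wu y) (Mu y); move: (W y) (M y) => w m wu mu.
  rewrite -(@frame_norm_conj _ _ (invmx w) m); [|by rewrite unitmx_inv|by []].
  by rewrite invmxK !mulmxA mulVmx// mul1mx mulmxKV.
have b2 : 0 < b / 2 by rewrite divr_gt0// (bf_rate H).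
apply: (blocks_theta_splitting (AT te) hF qP (fun _ _ => erefl) b2 C'0 qI) => [y i j Y s ij s0|y c].
  rewrite !MW.
  have := perturbed_domination H BC Bd small small' delta0 Zn ZE (Uu y) (U0 y) (UD y)
    (W y *m Y *m invmx (W y)) ij s0.
  rewrite !EW /q /U; move: (Wu y) (Wu (gflow s y)).
  move: (W y) (W (gflow s y)) (conj_block p Z y i) (conj_block p Z y j) => w w' X X' wu wu'.
  congr (frame_norm _ _ <= _).
  rewrite invmx_mulmx ?unitmx_inv// invmxK !mulmxA.
  by [].
rewrite qS.
rewrite -{2}[W y]invmxK dim_fix_conj; last by rewrite unitmx_inv; exact: Wu.
rewrite dim_fix_conj; last exact: Zu.
have [/(_ y)[_ _ <-] _ _ _] := proj2 ES c.
rewrite /flagF (eq_bigr (fun i => fix_space (triv (A 0) y *m p y i *m invmx (triv (A 0) y)))) => [|i _]; last exact: Ep.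
rewrite sum_fix_spaces; last by apply: block_family_conj; [exact: triv_unit|exact: bf_block H y].
by rewrite partial_sum_conj dim_fix_conj// triv_unit.
Qed.

End Perturbed.

Section FrameComparison.
Variables (R : realType) (d : nat).
Implicit Types (M Y : 'M[R]_d).

Lemma frame_norm_le_norm M Y :
  frame_norm M Y <= d%:R * (d%:R * (d%:R * `|invmx M| * `|M|)) * `|Y|.
Proof.
rewrite frame_normE.
rewrite [leRHS](_ : _ = d%:R * (d%:R * (d%:R * `|invmx M| * `|Y|) * `|M|)); last by ring.
apply: ler_wpM2l => //; apply: le_trans (mx_norm_mul _ _) _.
by apply: ler_wpM2r => //; apply: ler_wpM2l => //; exact: mx_norm_mul.
Qed.

Lemma norm_le_frame_norm M Y : M \in unitmx ->
  `|Y| <= d%:R * `|M| * `|invmx M| * frame_norm M Y.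
Proof.
move=> Mu; have E : Y = M *m (invmx M *m Y *m M) *m invmx M.
  by rewrite !mulmxA mulmxV// mul1mx mulmxK.
rewrite {1}E frame_normE; apply: le_trans (mx_norm_mul _ _) _.
rewrite [leRHS](_ : _ = d%:R * (d%:R * `|M| * `|invmx M *m Y *m M|) * `|invmx M|); last by ring.
by apply: ler_wpM2r => //; apply: ler_wpM2l => //; exact: mx_norm_mul.
Qed.

End FrameComparison.

Section IntegratorSmall.
Variables (R : realType) (d n : nat) (X : Type) (phi : R -> X -> X).
Variables (M : X -> 'M[R]_d) (p : X -> 'I_n -> 'M[R]_d) (b C kappa : R).
Hypothesis H : block_flow phi M p b C kappa.
Local Notation nrm x Y := (frame_norm (M x) Y).

(** A quantitative dominated convergence. Up to time [a] the field is at most [e]; beyond, half of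
    the exponential weight already reduces the global bound [c] to [e]. The other half is
    integrated, at rate [b / 2], whence the factor 2. *)
Lemma integrator_small (f : X -> 'M[R]_d) (c e a : R) x : orbit_continuous phi f ->
  bounded_by M f c -> 0 <= c ->
  (forall s, - a <= s <= a -> nrm (phi s x) (f (phi s x)) <= e) ->
  c * expR (- (b / 2) * a) <= e ->
  nrm x (integrator phi p f x) <= 2 * int_const d n b C * e.
Proof.
move=> fC fc c_ge0 fe ce; have b0 := bf_rate H; have Mu := bf_unit H.
have C0 := bf_C H.
have e0 : 0 <= e by apply: le_trans ce; apply: mulr_ge0 => //; exact: expR_ge0.
have b2 : 0 < b / 2 by rewrite divr_gt0.
(* [f'] agrees with [f] on the orbit segment and is small everywhere. *)
pose f' y : 'M[R]_d := if nrm y (f y) <= e then f y else 0.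
have f'e : bounded_by M f' e.
  by move=> y; rewrite /f'; case: ifP => //; rewrite frame_norm0.
have f'E s : - a <= s <= a -> f' (phi s x) = f (phi s x) by move=> /fe; rewrite /f' => ->.
have nnC : 0 <= n%:R * n%:R * C by apply: mulr_ge0 => //; exact: mulr_ge0.
have bound (P : 'M[R]_d -> 'M[R]_d) (g : R -> R) s : 0 <= s -> (`|s| = `|g s|) ->
    nrm x (P (f (phi (g s) x))) <= n%:R * n%:R * (C * c) * expR (- b * s) ->
    nrm x (P (f' (phi (g s) x))) <= n%:R * n%:R * (C * e) * expR (- b * s) ->
    nrm x (P (f (phi (g s) x))) <= n%:R * n%:R * C * e * expR (- (b / 2) * s).
  move=> s0 sg bf bf'.
  have ee : 0 <= expR (- (b / 2) * s) by exact: expR_ge0.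
  have eE : expR (- b * s) = expR (- (b / 2) * s) * expR (- (b / 2) * s).
    by rewrite -expRD; congr expR; field.
  have e1 : expR (- (b / 2) * s) <= 1 by rewrite -[leRHS]expR0 ler_expR mulNr oppr_le0 mulr_ge0// ltW.
  have [sa|sa] := leP s a.
    rewrite f'E in bf'; last by rewrite -ler_norml -sg ger0_norm.
    apply: le_trans bf' _; rewrite eE.
    rewrite [leLHS](_ : _ = n%:R * n%:R * C * e * expR (- (b / 2) * s) * expR (- (b / 2) * s)); last by ring.
    rewrite -[leRHS]mulr1; apply: ler_wpM2l => //.
    by apply: mulr_ge0 => //; exact: mulr_ge0.
  apply: le_trans bf _; rewrite eE.
  have ea : c * expR (- (b / 2) * s) <= e.
    apply: le_trans ce; apply: ler_wpM2l => //; by rewrite ler_expR !mulNr lerN2 ler_pM2l// ltW.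
  rewrite [leLHS](_ : _ = n%:R * n%:R * C * (c * expR (- (b / 2) * s)) * expR (- (b / 2) * s)); last by ring.
  by apply: ler_wpM2r => //; exact: ler_wpM2l.
have low : nrm x (mint (fun s => lower_part (p x) (f (phi s x)))) <=
    d%:R * (n%:R * n%:R * C * e) / (b / 2).
  apply: (mint_frame_norm (Mu x) b2 _ _).2 => [s|s s0].
    by apply: cvg_lower_part; exact: fC.
  apply: (bound _ id) => //; exact: (lower_decay H).
have upp : nrm x (mint (fun s => upper_part (p x) (f (phi (- s) x)))) <=
    d%:R * (n%:R * n%:R * C * e) / (b / 2).
  apply: (mint_frame_norm (Mu x) b2 _ _).2 => [s|s s0].
    by apply: cvg_upper_part; exact: (orbit_continuousN (x := x) fC).
  apply: (bound _ -%R) => //; [by rewrite normrN|exact: (upper_decay H)|exact: (upper_decay H)].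
apply: le_trans (frame_normB _ _ _) _; apply: le_trans (lerD low upp) _.
rewrite /int_const invf_div.
by rewrite [leRHS](_ : _ = d%:R * (n%:R * n%:R * C * e) * (2 / b) + d%:R * (n%:R * n%:R * C * e) * (2 / b)); [exact: lexx|ring].
Qed.

End IntegratorSmall.

Lemma near0_mul_le (R : realType) (q e : R) : 0 <= q -> 0 < e ->
  \forall t \near (0 : R), q * `|t| <= e.
Proof.
move=> q0 e0; have q1 : 0 < q + 1 by lra.
have := @near0_lt R (e / (q + 1)); rewrite divr_gt0// => /(_ isT); apply: filterS => t te.
apply: (@le_trans _ _ ((q + 1) * `|t|)); first by apply: ler_wpM2r => //; lra.
by rewrite mulrC -ler_pdivlMr// ltW.
Qed.

(** * Differentiability at 0 of the perturbed splitting *)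

Section Deformation.
Variables (R : realType) (d n : nat) (K : 'I_n -> nat) (eps : R) (A : R -> oneform R d).
Variables (A' : oneform R d).
Variables (h : UH2 R -> 'M[R]_d) (E : UH2 R -> 'I_n.+1 -> {vspace 'cV[R]_d}).
Variables (p : UH2 R -> 'I_n.+1 -> 'M[R]_d) (b C kappa c : R).
Hypotheses (eps0 : 0 < eps) (AT : forall t, `|t| < eps -> trivializable_connection (A t)).
Hypotheses (A'D : derivative_at0 A A') (hF : is_frame h).
Local Notation M := (flat_frame (A 0) h).
Hypothesis H : block_flow (@gflow R) M p b C kappa.
Hypothesis ES : theta_splitting K (A 0) h E.
Hypothesis Ep : forall x i, E x i = fix_space (triv (A 0) x *m p x i *m invmx (triv (A 0) x)).
Hypothesis c_ge0 : 0 <= c.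
Hypothesis Bc : \forall t \near (0 : R), forall x, frame_norm (M x) (triv_diff A t Ds x) <= c * `|t|.
Local Notation A'V := (trivialized (A 0) A' Ds).
Let AT0 : trivializable_connection (A 0).
Proof. by apply: AT; rewrite normr0. Qed.
Let Mu x : M x \in unitmx := bf_unit H x.

(** Convergence of the variation is known in a fixed norm; continuity of the frame makes it
    comparable with the frame norm on a bounded orbit segment. *)
Lemma frame_norm_le_norm_orbit x a : exists L : R, 0 <= L /\
  forall s, - a <= s <= a -> forall Y, frame_norm (M (gflow s x)) Y <= L * `|Y|.
Proof.
have [a0|a0] := leP 0 a; last by exists 0; split => // s /andP[h1 h2]; lra.
pose f s := d%:R * (d%:R * (d%:R * `|invmx (M (gflow s x))| * `|M (gflow s x)|)) : R.
have fC : continuous f.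
  move=> s; have Mc : M (gflow s0 x) @[s0 --> s] --> M (gflow s x) by exact: (bf_cont H).
  have Mic : invmx (M (gflow s0 x)) @[s0 --> s] --> invmx (M (gflow s x)).
    by apply: cvg_invmx => // t; exact: Mu.
  do 2 (apply: cvgM; first exact: cvg_cst).
  by apply: cvgM; [apply: cvgM; [exact: cvg_cst|exact: cvg_norm]|exact: cvg_norm].
have [||s0 _ s0P] := @EVT_max R f (- a) a; first lra.
  by apply: continuous_subspaceT.
exists (f s0); split => [|s sa Y]; first by rewrite /f; do 3 apply: mulr_ge0 => //; exact: mulr_ge0.
apply: le_trans (frame_norm_le_norm _ _) _; apply: ler_wpM2r => //.
by apply: s0P; rewrite in_itv.
Qed.

Lemma orbit_continuous_deriv : orbit_continuous (@gflow R) A'V.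
Proof.
move=> x; apply: (trivialized_orbit_continuous (i := Ds) AT0).
exact: (deriv_orbit_continuous eps0 AT A'D).
Qed.

Lemma orbit_continuous_triv_diff t : `|t| < eps -> orbit_continuous (@gflow R) (triv_diff A t Ds).
Proof.
move=> te x; apply: (trivialized_orbit_continuous (i := Ds) AT0) => s.
by apply: cvgB; apply: (form_orbit_continuous (i := Ds)); [exact: AT|].
Qed.

Lemma triv_diff_quotient_cvg x (a e : R) : 0 < e -> \forall t \near (0 : R)^', forall s, - a <= s <= a ->
  frame_norm (M (gflow s x)) (t^-1 *: triv_diff A t Ds (gflow s x) - A'V (gflow s x)) <= e.
Proof.
move=> e0; have [L [L0 LP]] := frame_norm_le_norm_orbit x a.
have e1 : 0 < e / (L + 1) by rewrite divr_gt0//; lra.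
have := triv_diff_cvg eps0 AT A'D Ds x a e1.
apply: filterS => t tP s sa; apply: le_trans (LP s sa _) _.
apply: (@le_trans _ _ (L * (e / (L + 1)))); first by apply: ler_wpM2l => //; exact: tP.
by rewrite mulrCA -[leRHS]mulr1 ler_pM2l// ler_pdivrMr; lra.
Qed.

Lemma quotient_bound : \forall t \near (0 : R)^', forall x,
  frame_norm (M x) (t^-1 *: triv_diff A t Ds x) <= c.
Proof.
have Bc' : \forall t \near (0 : R)^', forall x, frame_norm (M x) (triv_diff A t Ds x) <= c * `|t|.
  exact: nbhs_dnbhs Bc.
have neq : \forall t \near (0 : R)^', t != 0 by exact: nbhs_dnbhs_neq.
apply: filterS2 Bc' neq => t tc t0 x; rewrite frame_normZ normfV.
by rewrite mulrC ler_pdivrMr ?normr_gt0.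
Qed.

Lemma deriv_bound : bounded_by M A'V c.
Proof.
move=> x; apply/ler_addgt0Pr => e e0.
have [t [t1 t2]] := filter_ex (filterI (triv_diff_quotient_cvg x 0 e0) quotient_bound).
have := t1 0; rewrite oppr0 lexx gflow0 => /(_ isT) tx.
have -> : A'V x = t^-1 *: triv_diff A t Ds x - (t^-1 *: triv_diff A t Ds x - A'V x) by rewrite subKr.
apply: le_trans (frame_normB _ _ _) _; exact: lerD.
Qed.

(** The quotients converge uniformly on orbit segments only, but stay bounded by [c] everywhere; [a]
    is chosen so that domination makes the contribution of the tails negligible. *)
Lemma integrator_quotient_cvg x (e : R) : 0 < e -> \forall t \near (0 : R)^',
  frame_norm (M x) (t^-1 *: integrator (@gflow R) p (triv_diff A t Ds) x -
    integrator (@gflow R) p A'V x) <= e.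
Proof.
move=> e0; pose I := 2 * int_const d n.+1 b C.
have I0 : 0 <= I by apply: mulr_ge0 => //; exact: (int_const_ge0 H).
pose e' := e / (I + 1).
have e'0 : 0 < e' by rewrite divr_gt0//; lra.
have Ie : I * e' <= e by rewrite mulrCA -[leRHS]mulr1 ler_pM2l// ler_pdivrMr; lra.
have b0 := bf_rate H; have b2 : 0 < b / 2 by rewrite divr_gt0.
have [a ae] : exists a, 2 * c * expR (- (b / 2) * a) <= e'.
  have lim0 : 2 * c * expR (- (b / 2) * s) @[s --> +oo] --> (0 : R).
    by rewrite -(mulr0 (2 * c)); apply: cvgM; [exact: cvg_cst|exact: cvg_expRN].
  have lt : \forall s \near +oo, 2 * c * expR (- (b / 2) * s) < e' by exact: (cvgr_lt 0 lim0).
  by have [a aP] := filter_ex lt; exists a; exact: ltW.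
have te : \forall t \near (0 : R)^', `|t| < eps by apply: nbhs_dnbhs; exact: near0_lt.
have tec : \forall t \near (0 : R)^', `|t| < eps /\ bounded_by M (triv_diff A t Ds) (c * `|t|).
  by apply: filterS2 te (nbhs_dnbhs Bc) => t; split.
apply: filterS3 tec (triv_diff_quotient_cvg x a e'0) quotient_bound => t [teps tc] t1 t2.
have qC : orbit_continuous (@gflow R) (fun y => t^-1 *: triv_diff A t Ds y).
  by move=> y s; apply: cvgZr; exact: (orbit_continuous_triv_diff teps).
have dc := deriv_bound.
have E1 : integrator (@gflow R) p (fun y => t^-1 *: triv_diff A t Ds y - A'V y) x =
    t^-1 *: integrator (@gflow R) p (triv_diff A t Ds) x - integrator (@gflow R) p A'V x.
  rewrite (integratorB H x qC t2 orbit_continuous_deriv dc).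
  by rewrite (integratorZ H _ _ (orbit_continuous_triv_diff teps) tc).
rewrite -E1; apply: le_trans Ie.
have fC : orbit_continuous (@gflow R) (fun y => t^-1 *: triv_diff A t Ds y - A'V y).
  by move=> y s; apply: cvgB; [exact: qC|exact: orbit_continuous_deriv].
have fc : bounded_by M (fun y => t^-1 *: triv_diff A t Ds y - A'V y) (2 * c).
  by move=> y; apply: le_trans (frame_normB _ _ _) _; have := t2 y; have := dc y; lra.
have c2 : 0 <= 2 * c by exact: mulr_ge0.
exact: (integrator_small H fC fc c2 t1 ae).
Qed.

(** The fixed points are chosen for each [t] separately. Their derivative at 0 comes from
    [Z = 1 + integrator B + O(t^2)] and from the convergence of the quotients of the integrator. *)
Lemma perturbed_family : exists Z : R -> UH2 R -> 'M[R]_d,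
  [/\ forall x, Z 0 x = 1%:M,
      forall x, is_derive (0 : R) (1 : R) (fun t => Z t x) (integrator (@gflow R) p A'V x) &
      \forall t \near (0 : R), forall x, Z t x \in unitmx /\ forall a, proj K (A t) h a x =
        invmx (triv_ratio A t x) *m
        (Z t x *m partial_sum (p x) (fun i => (i <= a)%N) *m invmx (Z t x)) *m triv_ratio A t x].
Proof.
pose q1 := int_const d n.+1 b C * pert_const d n.+1 kappa.
have q10 : 0 <= q1 by apply: mulr_ge0; [exact: int_const_ge0 H|exact: pert_const_ge0].
have C0 := bf_C H; have b0 := bf_rate H.
pose q2 := d%:R * (2 * C * (diag_const n.+1 kappa * (c * (d%:R + 1)))).
have dc0 : 0 <= diag_const n.+1 kappa by exact: diag_const_ge0.
have q20 : 0 <= q2.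
  apply: mulr_ge0 => //; apply: mulr_ge0; first exact: mulr_ge0.
  by apply: mulr_ge0 => //; apply: mulr_ge0 => //; exact: addr_ge0.
pose good t := [/\ `|t| < eps, bounded_by M (triv_diff A t Ds) (c * `|t|),
  int_const d n.+1 b C * pert_const d n.+1 kappa * (c * `|t|) <= 4^-1 &
  d%:R * (2 * C * (diag_const n.+1 kappa * ((c * `|t|) * (d%:R + 1)))) <= b / 4].
have goodt : \forall t \near (0 : R), good t.
  have s1 : \forall t \near (0 : R), q1 * c * `|t| <= 4^-1.
    by apply: near0_mul_le; [exact: mulr_ge0|rewrite invr_gt0].
  have s2 : \forall t \near (0 : R), q2 * `|t| <= b / 4.
    by apply: near0_mul_le => //; rewrite divr_gt0.
  have s3 : \forall t \near (0 : R), `|t| < eps /\ bounded_by M (triv_diff A t Ds) (c * `|t|).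
    by apply: filterS2 (near0_lt eps0) Bc => t; split.
  apply: filterS3 s1 s2 s3 => t t1 t2 [t3 t4]; split => //.
    by rewrite mulrA.
  by move: t2; rewrite /q2; congr (_ <= _); ring.
have good0 : good 0 := nbhs_singleton goodt.
have ct (t : R) : 0 <= c * `|t| by exact: mulr_ge0.
(* For the other parameters the value is arbitrary, since only the germ at 0 matters. *)
have ex t : exists Z : UH2 R -> 'M[R]_d, good t ->
    near_id n.+1 (@gflow R) M b C kappa (c * `|t|) Z /\
    forall x, Z x = picard (@gflow R) p (triv_diff A t Ds) Z x.
  have [[te tB s1 s2]|ng] := pselect (good t); last by exists (fun=> 1%:M).
  have [Z ZP] := picard_fixed_point H (orbit_continuous_triv_diff te) tB s1 (ct t).
  by exists Z.
have [Z ZP] := choice ex.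
(* At [t = 0] the distance allowed by [near_id] is 0. *)
have Z0 x : Z 0 x = 1%:M.
  have [[_ /(_ x)]] := ZP 0 good0; rewrite normr0 !mulr0 => z0 _.
  by apply/eqP; rewrite -subr_eq0; apply/eqP; exact: frame_norm_eq0 z0.
exists Z; split => //; last first.
  apply: filterS goodt => t gt x; have [te tB s1 s2] := gt; have [Zn ZE] := ZP t gt; split.
    by have [] := near_id_inv H s1 Zn x.
  move=> a; exact: (perturbed_proj eps0 AT hF H ES Ep te (ct t) (orbit_continuous_triv_diff te) tB s1 s2 Zn ZE).
move=> x; apply/is_deriveP/cvgrPdist_le => e e0.
pose L := d%:R * `|M x| * `|invmx (M x)|.
have L0 : 0 <= L by apply: mulr_ge0 => //; exact: mulr_ge0.
pose e' := e / (L + 1).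
have e'0 : 0 < e' by rewrite divr_gt0//; lra.
have Le : L * e' <= e by rewrite mulrCA -[leRHS]mulr1 ler_pM2l// ler_pdivrMr; lra.
have e2 : 0 < e' / 2 by rewrite divr_gt0.
pose k := int_const d n.+1 b C * (int_const d n.+1 b C * pert_const d n.+1 kappa *
  (1 + diag_const n.+1 kappa * (d%:R + 1))).
have k0 : 0 <= k.
  apply: mulr_ge0; first exact: int_const_ge0 H.
  by apply: mulr_ge0 => //; apply: addr_ge0 => //; apply: mulr_ge0 => //; exact: addr_ge0.
have kc0 : 0 <= k * c ^+ 2 by apply: mulr_ge0 => //; exact: sqr_ge0.
have n1 : \forall t \near (0 : R)^', good t /\ k * c ^+ 2 * `|t| <= e' / 2.
  apply: nbhs_dnbhs; apply: filterS2 goodt (near0_mul_le kc0 e2) => t; split => //.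
have n2 : \forall t \near (0 : R)^', t != 0 by exact: nbhs_dnbhs_neq.
apply: filterS3 n1 n2 (integrator_quotient_cvg x e2) => t [gt kt] t0 it.
rewrite addr0 Z0 distrC; apply: le_trans (norm_le_frame_norm _ (Mu x)) _.
apply: le_trans Le; apply: ler_wpM2l => //.
have [te tB s1 s2] := gt; have [Zn ZE] := ZP t gt.
have so := picard_second_order H (orbit_continuous_triv_diff te) tB s1 (ct t) x Zn ZE.
move: it so; move: (integrator _ p (triv_diff A t Ds) x) (integrator _ p A'V x) => I J it so.
have -> : t^-1 *: (Z t x - 1%:M) - J = t^-1 *: (Z t x - 1%:M - I) + (t^-1 *: I - J).
  by rewrite addrA -scalerDr subrK.
apply: le_trans (frame_normD _ _ _) _; rewrite (splitr e'); apply: lerD => //.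
rewrite frame_normZ normfV mulrC ler_pdivrMr ?normr_gt0//; apply: le_trans so _.
rewrite -/k (_ : k * (c * `|t|) ^+ 2 = k * c ^+ 2 * `|t| * `|t|); last by ring.
exact: ler_wpM2r.
Qed.

End Deformation.

(** * Traces of cyclic products *)

HB.instance Definition _ (R : pzRingType) (n : nat) := Monoid.isLaw.Build 'M[R]_n 1%:M
  (@mulmx R n n n) (@mulmxA R n n n n) (@mul1mx R n n) (@mulmx1 R n n).

Section CyclicProducts.
Variables (R : realType) (d m : nat).
Implicit Types (X : 'I_m.+1 -> 'M[R]_d).

Definition cyclic_coproduct X i : 'M[R]_d := \big[mulmx/1%:M]_(1 <= j < m.+1) X (i - inZp j).

Lemma is_derive_bigmul N (F : nat -> R -> 'M[R]_d) D (s : R) :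
  (forall k, is_derive s (1 : R) (F k) (D k)) ->
  is_derive s (1 : R) (fun t => \big[mulmx/1%:M]_(0 <= k < N) F k t)
    (\sum_(0 <= j < N) (\big[mulmx/1%:M]_(0 <= k < j) F k s) *m D j *m
      (\big[mulmx/1%:M]_(j.+1 <= k < N) F k s)).
Proof.
move=> FD; elim: N => [|N IH].
  rewrite big_nil (_ : (fun t => _) = cst 1%:M); first exact: is_derive_cst.
  by apply: funext => t; rewrite big_nil.
rewrite (_ : (fun t => _) = (fun t => (\big[mulmx/1%:M]_(0 <= k < N) F k t) *m F N t)); last first.
  by apply: funext => t; rewrite big_nat_recr.
refine (is_derive_eq (is_derive_mulmx IH (FD N)) _).
rewrite [RHS]big_nat_recr//= [X in _ = _ + _ *m X]big_geq// mulmx1 mulmx_suml; congr (_ + _).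
apply: eq_big_nat => j /andP[_ jN]; rewrite [in RHS]big_nat_recr//.
by rewrite mulmxA.
Qed.

(** Cutting the decreasing product at its factor of rank [j], whose index is [m - j], and exchanging
    the two pieces yields the cyclic product of the other factors. *)
Lemma split_cyclic_coproduct X (j : 'I_m.+1) :
  (\big[mulmx/1%:M]_(j.+1 <= k < m.+1) X (inZp (m - k))) *m
  (\big[mulmx/1%:M]_(0 <= k < j) X (inZp (m - k))) = cyclic_coproduct X (rev_ord j).
Proof.
have jm : (j <= m)%N by rewrite -ltnS.
rewrite /cyclic_coproduct [RHS](@big_cat_nat _ _ _ (m - j).+1)//=; last by rewrite ltnS leq_subr.
congr (_ *m _).
  rewrite -add1n big_addn subSn//; apply: eq_big_nat => l /andP[_ lj]; congr X.
  apply/esym/eqP; rewrite subr_eq; apply/eqP/val_inj => /=.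
  by rewrite subSS modnDm -[in LHS](@modn_small (m - j) m.+1) ?ltnS ?leq_subr//; congr (_ %% _)%N; lia.
rewrite -[(m - j).+1]add0n big_addn subSS subKn//; apply: eq_big_nat => k /andP[_ kj]; congr X.
apply/esym/eqP; rewrite subr_eq; apply/eqP/val_inj => /=.
rewrite subSS modnDm -[in LHS](@modn_small (m - j) m.+1) ?ltnS ?leq_subr//.
have -> : (m - k + (k + (m - j).+1) = m.+1 + (m - j))%N by lia.
by rewrite modnDl.
Qed.

(** The Leibniz rule; cyclicity of the trace brings the differentiated factor to the front. *)
Lemma is_derive_trace_prod (F : 'I_m.+1 -> R -> 'M[R]_d) D (s : R) :
  (forall i, is_derive s (1 : R) (F i) (D i)) ->
  is_derive s (1 : R) (fun t => \tr (\big[mulmx/1%:M]_(j < m.+1) F (rev_ord j) t))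
    (\sum_i \tr (D i *m cyclic_coproduct (F^~ s) i)).
Proof.
move=> FD; have revE (j : 'I_m.+1) : rev_ord j = inZp (m - j).
  by apply: val_inj => /=; rewrite subSS modn_small// ltnS leq_subr.
rewrite (_ : (fun t => _) = fun t => \tr (\big[mulmx/1%:M]_(0 <= k < m.+1) F (inZp (m - k)) t)); last first.
  by apply: funext => t; rewrite big_mkord; congr (\tr _); apply: eq_bigr => j _; rewrite revE.
refine (is_derive_eq (is_derive_mxtrace (is_derive_bigmul m.+1 (fun k => FD (inZp (m - k))))) _).
rewrite raddf_sum /= big_mkord [RHS](reindex_inj rev_ord_inj) /=; apply: eq_bigr => j _.
by rewrite -split_cyclic_coproduct -revE mxtrace_mulC mulmxA mxtrace_mulC.
Qed.

(** The infinitesimal invariance of the trace under simultaneous conjugation. With [full i] the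
    cyclic product starting at [X i], the summand is the trace of [c *m full i] minus that of
    [c *m full (i - 1)], and the sum cancels around the cycle. *)
Lemma sum_trace_comm (c : 'M[R]_d) X :
  \sum_i \tr ((c *m X i - X i *m c) *m cyclic_coproduct X i) = 0.
Proof.
pose full i := \big[mulmx/1%:M]_(0 <= l < m.+1) X (i - inZp l).
have left i : X i *m cyclic_coproduct X i = full i.
  rewrite /full big_ltn//; congr (X _ *m _); apply/eqP; rewrite eq_sym subr_eq.
  by apply/eqP/val_inj; rewrite /= mod0n addn0 modn_small.
have right i : cyclic_coproduct X i *m X i = full (i - inZp 1).
  have -> : X i = X (i - inZp m.+1).
    congr X; apply/esym/eqP; rewrite subr_eq; apply/eqP/val_inj => /=.
    by rewrite modnn addn0 modn_small.
  rewrite /cyclic_coproduct -big_nat_recr//= big_add1 /=; apply: eq_big_nat => l _; congr X.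
  rewrite -addrA -opprD; congr (_ - _); apply: val_inj => /=.
  by rewrite modnDm add1n.
have E i : \tr ((c *m X i - X i *m c) *m cyclic_coproduct X i) =
    \tr (c *m full i) - \tr (c *m full (i - inZp 1)).
  rewrite mulmxBl linearB /= -[c *m X i *m _]mulmxA left -[X i *m c *m _]mulmxA.
  by rewrite [\tr (X i *m _)]mxtrace_mulC -mulmxA right.
rewrite (eq_bigr _ (fun i _ => E i)).
rewrite big_split /= sumrN [X in X - _](reindex_inj (addIr (- inZp 1))) /=.
by rewrite subrr.
Qed.

End CyclicProducts.

(** * Ghost integration *)

Section PartialSums.
Variables (R : realType) (d n : nat) (p : 'I_n -> 'M[R]_d).
Hypothesis pP : block_family p.
Implicit Types (S : pred 'I_n) (Y : 'M[R]_d).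

Lemma mul_partial_sum S i : p i *m partial_sum p S = if S i then p i else 0.
Proof.
rewrite /partial_sum mulmx_sumr; have [Si|Si] := boolP (S i).
  rewrite (bigD1 i)//= block_mul// eqxx big1 ?addr0// => j /andP[_ ji].
  by rewrite block_mul// eq_sym (negbTE ji).
rewrite big1// => j Sj; rewrite block_mul//; case: eqP => // ij.
by rewrite ij Sj in Si.
Qed.

Lemma partial_sum_block S1 S2 i j Y : ~~ (S1 i && S2 j) ->
  partial_sum p S1 *m (p i *m Y *m p j) *m partial_sum p S2 = 0.
Proof.
rewrite negb_and !mulmxA partial_sum_mul// => /orP[/negbTE->|/negbTE S2j].
  by rewrite !mul0mx.
by rewrite -!mulmxA mul_partial_sum// S2j !mulmx0.
Qed.

Lemma partial_sum_pair S1 S2 (Q : 'I_n -> 'I_n -> bool) Y :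
  (forall i j, Q i j -> ~~ (S1 i && S2 j)) ->
  partial_sum p S1 *m (\sum_(i < n) \sum_(j < n | Q i j) p i *m Y *m p j) *m partial_sum p S2 = 0.
Proof.
move=> QS; have z i j : Q i j -> partial_sum p S1 *m (p i *m Y *m p j) *m partial_sum p S2 = 0.
  by move=> /QS; exact: partial_sum_block.
move: (partial_sum p S1) (partial_sum p S2) z => U V z.
rewrite mulmx_sumr mulmx_suml big1// => i _.
by rewrite mulmx_sumr mulmx_suml big1// => j /z.
Qed.

Lemma partial_sum_diag S Y :
  partial_sum p S *m diag_part p Y *m partial_sum p (fun i => ~~ S i) = 0 /\
  partial_sum p (fun i => ~~ S i) *m diag_part p Y *m partial_sum p S = 0.
Proof.
have z S1 S2 : (forall i, ~~ (S1 i && S2 i)) ->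
    partial_sum p S1 *m diag_part p Y *m partial_sum p S2 = 0.
  move=> S12; have z i : partial_sum p S1 *m (p i *m Y *m p i) *m partial_sum p S2 = 0.
    exact: partial_sum_block.
  move: (partial_sum p S1) (partial_sum p S2) z => U V z.
  by rewrite mulmx_sumr mulmx_suml big1.
by split; apply: z => i; case: (S i).
Qed.

Variable a : nat.
Local Notation P := (partial_sum p (fun i => (i <= a)%N)).
Local Notation Q := (partial_sum p (fun i => ~~ (i <= a)%N)).

(** Between [Q] on the left and [P] on the right only the blocks with [j <= a < i] survive, all of
    them below the diagonal. *)
Lemma lower_part_flag Y : Q *m lower_part p Y *m P = Q *m Y *m P /\
  P *m lower_part p Y *m Q = 0.
Proof.
have u0 : Q *m upper_part p Y *m P = 0.
  by apply: partial_sum_pair => i j /= ij; rewrite -ltnNge; lia.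
split; last by apply: partial_sum_pair => i j /= ij; rewrite -ltnNge; lia.
rewrite [in RHS](block_decomposition pP Y) !mulmxDr !mulmxDl u0 addr0.
by rewrite (partial_sum_diag _ Y).2 add0r.
Qed.

Lemma upper_part_flag Y : P *m upper_part p Y *m Q = P *m Y *m Q /\
  Q *m upper_part p Y *m P = 0.
Proof.
have u0 : P *m lower_part p Y *m Q = 0.
  by apply: partial_sum_pair => i j /= ij; rewrite -ltnNge; lia.
split; last by apply: partial_sum_pair => i j /= ij; rewrite -ltnNge; lia.
rewrite [in RHS](block_decomposition pP Y) !mulmxDr !mulmxDl u0 addr0.
by rewrite (partial_sum_diag _ Y).1 add0r.
Qed.

Lemma commM_flag Y : commM Y P = Q *m Y *m P - P *m Y *m Q.
Proof.
rewrite partial_sumC//; move: (partial_sum _ _) => U.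
rewrite /commM !mulmxBl !mulmxBr !mul1mx !mulmx1.
by move: (Y *m U) (U *m Y *m U) (U *m Y) => u v w; apply/matrixP => i j; rewrite !mxE; ring.
Qed.

(** Multiplication by [P] on one side isolates one corner of the commutator; this lemma and the next
    one identify the integrands of [Jint]. *)
Lemma commM_flag_mulr Y : commM Y P *m P = Q *m Y *m P.
Proof.
have PP : P *m P = P.
  by rewrite partial_sum_mul_sum//; apply: eq_bigl => i; exact: andbb.
rewrite partial_sumC//; move: (partial_sum _ _) PP => U UU.
by rewrite /commM mulmxBl -(mulmxA Y) UU !mulmxBl mul1mx.
Qed.

Lemma commM_flag_mull Y : P *m commM Y P = - (P *m Y *m Q).
Proof.
have PP : P *m P = P.
  by rewrite partial_sum_mul_sum//; apply: eq_bigl => i; exact: andbb.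
rewrite partial_sumC//; move: (partial_sum _ _) PP => U UU.
by rewrite /commM !mulmxBr !mulmxA UU mulmx1 opprB.
Qed.

End PartialSums.

Lemma mxtrace_norm (R : realType) (d : nat) (Y : 'M[R]_d) : `|\tr Y| <= d%:R * `|Y|.
Proof.
apply: le_trans (ler_norm_sum _ _ _) _.
apply: (@le_trans _ _ (\sum_(i < d) `|Y|)); last by rewrite sumr_const card_ord mulr_natl.
by apply: ler_sum => i _; exact: entry_le_norm.
Qed.

Lemma mint0 (R : realType) m n : mint (fun=> 0 : 'M[R]_(m, n)) = 0.
Proof.
have e : expdec 1 0 (fun=> 0 : 'M[R]_(m, n)).
  by split => [|s _]; [exact: cst_continuous|rewrite normr0 mul0r].
by apply/eqP; rewrite -normr_le0; have := mint_norm ltr01 e; rewrite mul0r.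
Qed.

Section Commutator.
Variables (R : realType) (d n : nat) (X : Type) (phi : R -> X -> X).
Variables (M : X -> 'M[R]_d) (p : X -> 'I_n -> 'M[R]_d) (b C kappa c : R).
Hypothesis H : block_flow phi M p b C kappa.
Variables (f : X -> 'M[R]_d) (x : X) (a : nat).
Hypotheses (fC : orbit_continuous phi f) (fc : bounded_by M f c).
Local Notation P := (partial_sum (p x) (fun i => (i <= a)%N)).
Local Notation Q := (partial_sum (p x) (fun i => ~~ (i <= a)%N)).
Let b0 := bf_rate H.
Let pP := bf_block H x.

(** [integrator] is [L - U] with [L] strictly lower and [U] strictly upper, so its commutator with
    [P] is [Q L P + P U Q]. These corners are the integrals of [[f, P] P] over the future and of [-
    P [f, P]] over the past. *)
Lemma commM_integrator (T : 'M[R]_d) : \tr (commM (integrator phi p f x) P *m T) =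
  \int[lebesgue_measure]_(s in `[0, +oo[) \tr (T *m (commM (f (phi s x)) P *m P))
  - \int[lebesgue_measure]_(s in `]-oo, 0]) \tr (T *m (P *m commM (f (phi s x)) P)).
Proof.
have [[C1 e1] _] := lower_expdec H x fC fc.
have [[C2 e2] _] := upper_expdec H x fC fc.
have l1 : Q *m mint (fun s => lower_part (p x) (f (phi s x))) *m P =
    mint (fun s => Q *m f (phi s x) *m P).
  rewrite -(mint_sandwich _ _ b0 e1); congr mint; apply: funext => s.
  by have [] := lower_part_flag pP a (f (phi s x)).
have l2 : P *m mint (fun s => lower_part (p x) (f (phi s x))) *m Q = 0.
  rewrite -(mint_sandwich _ _ b0 e1) -[RHS]mint0; congr mint; apply: funext => s.
  by have [] := lower_part_flag pP a (f (phi s x)).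
have u1 : P *m mint (fun s => upper_part (p x) (f (phi (- s) x))) *m Q =
    mint (fun s => P *m f (phi (- s) x) *m Q).
  rewrite -(mint_sandwich _ _ b0 e2); congr mint; apply: funext => s.
  by have [] := upper_part_flag pP a (f (phi (- s) x)).
have u2 : Q *m mint (fun s => upper_part (p x) (f (phi (- s) x))) *m P = 0.
  rewrite -(mint_sandwich _ _ b0 e2) -[RHS]mint0; congr mint; apply: funext => s.
  by have [] := upper_part_flag pP a (f (phi (- s) x)).
have E1 : (fun s => Q *m f (phi s x) *m P) = fun s => Q *m lower_part (p x) (f (phi s x)) *m P.
  by apply: funext => s; have [] := lower_part_flag pP a (f (phi s x)).
have E2 : (fun s => P *m f (phi (- s) x) *m Q) =
    fun s => P *m upper_part (p x) (f (phi (- s) x)) *m Q.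
  by apply: funext => s; have [] := upper_part_flag pP a (f (phi (- s) x)).
have ex1 := expdec_sandwich Q P e1; rewrite -E1 in ex1.
have ex2 := expdec_sandwich P Q e2; rewrite -E2 in ex2.
rewrite commM_flag// /integrator.
have sumE (q p' L U W1 W2 : 'M[R]_d) : q *m L *m p' = W1 -> p' *m L *m q = 0 ->
    p' *m U *m q = W2 -> q *m U *m p' = 0 -> q *m (L - U) *m p' - p' *m (L - U) *m q = W1 + W2.
  by move=> <- h1 <- h2; rewrite !mulmxBr !mulmxBl h1 h2 subr0 sub0r opprK.
rewrite (sumE _ _ _ _ _ _ l1 l2 u1 u2).
rewrite mxtrace_mulC mulmxDr linearD /= -(iint_trace T b0 ex1) -(iint_trace T b0 ex2).
congr (_ + _).
  by rewrite /iint; congr Rintegral; apply: funext => s; rewrite commM_flag_mulr.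
have gE : (fun s => \tr (T *m (P *m commM (f (phi s x)) P))) =
    fun s => - \tr (T *m (P *m f (phi s x) *m Q)).
  by apply: funext => s; rewrite commM_flag_mull// mulmxN linearN.
rewrite gE; have [_ bnd] := ex2.
rewrite (iint_opp b0 (C := d%:R * (d%:R * `|T| * (d%:R * `|P| * d%:R * `|Q| * C2)))).
- rewrite (iint_trace T b0 ex2).
  have -> : (fun s => - \tr (T *m (P *m f (phi s x) *m Q))) \o -%R =
      fun s => \tr ((- T) *m (P *m f (phi (- s) x) *m Q)).
    by apply: funext => s; rewrite /= mulNmx linearN.
  by rewrite (iint_trace _ b0 ex2) mulNmx linearN /= opprK.
- move=> s; apply: cvgN; apply: cvg_mxtrace; apply: cvg_mulmx; first exact: cvg_cst.
  apply: cvg_mulmx; last exact: cvg_cst.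
  by apply: cvg_mulmx; [exact: cvg_cst|exact: fC].
move=> s s0; rewrite normrN; apply: le_trans (mxtrace_norm _) _.
rewrite -[leRHS]mulrA; apply: ler_wpM2l => //; apply: le_trans (mx_norm_mul _ _) _.
rewrite -[leRHS]mulrA; apply: ler_wpM2l; first exact: mulr_ge0.
exact: bnd.
Qed.

End Commutator.

Lemma bigmul_conj (R : realType) (d N : nat) (S : 'M[R]_d) (F : 'I_N -> 'M[R]_d) : S \in unitmx ->
  \big[mulmx/1%:M]_(j < N) (invmx S *m F j *m S) = invmx S *m (\big[mulmx/1%:M]_(j < N) F j) *m S.
Proof.
move=> Su; elim/big_rec2: _ => [|j y1 y2 _ ->]; first by rewrite mulmx1 mulVmx.
by rewrite !mulmxA mulmxK.
Qed.

Lemma commMD (R : realType) (d : nat) (X Y P : 'M[R]_d) :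
  commM (X + Y) P = commM X P + commM Y P.
Proof. by rewrite /commM mulmxDl mulmxDr opprD addrACA. Qed.

Lemma commM_addKB (R : realType) (d : nat) (X Y Z P : 'M[R]_d) :
  commM (X + Z) P - commM (Y + Z) P = (X - Y) *m P - P *m (X - Y).
Proof.
rewrite !commMD /commM mulmxBl mulmxBr.
move: (X *m P) (P *m X) (Y *m P) (P *m Y) (Z *m P - P *m Z) => b1 b2 b3 b4 b5.
by apply/matrixP => k l; rewrite !mxE; ring.
Qed.

(** Outside the neighbourhood the non-invertible values are replaced by the identity, which brings
    the claim back to [is_derive_invmx]. *)
Lemma is_derive_invmx_near (R : realType) (d : nat) (F : R -> 'M[R]_d) (s : R) f :
  (\forall t \near s, F t \in unitmx) -> is_derive (s : R) (1 : R) F f ->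
  is_derive (s : R) (1 : R) (fun t => invmx (F t)) (- (invmx (F s) *m f *m invmx (F s))).
Proof.
move=> Fu Ff; pose F' t := if F t \in unitmx then F t else 1%:M.
have F'u t : F' t \in unitmx by rewrite /F'; case: ifP => // _; exact: unitmx1.
have FF' : \forall t \near s, F t = F' t by apply: filterS Fu => t; rewrite /F' => ->.
have Fs : F' s = F s by rewrite -(nbhs_singleton FF').
have := is_derive_invmx F'u (near_eq_is_derive FF' Ff); rewrite Fs.
by apply: near_eq_is_derive; apply: filterS FF' => t ->.
Qed.

Section Final.
Variables (R : realType) (d n : nat) (K : 'I_n -> nat) (eps : R) (A : R -> oneform R d).
Variables (A' : oneform R d) (h : UH2 R -> 'M[R]_d) (E : UH2 R -> 'I_n.+1 -> {vspace 'cV[R]_d}).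
Variables (p : UH2 R -> 'I_n.+1 -> 'M[R]_d) (b C kappa c : R).
Hypotheses (eps0 : 0 < eps) (AT : forall t, `|t| < eps -> trivializable_connection (A t)).
Hypotheses (A'D : derivative_at0 A A') (hF : is_frame h).
Hypothesis H : block_flow (@gflow R) (flat_frame (A 0) h) p b C kappa.
Hypothesis ES : theta_splitting K (A 0) h E.
Hypothesis Ep : forall x i, E x i = fix_space (triv (A 0) x *m p x i *m invmx (triv (A 0) x)).
Hypothesis c_ge0 : 0 <= c.
Hypothesis Bc : \forall t \near (0 : R), forall x,
  frame_norm (flat_frame (A 0) h x) (triv_diff A t Ds x) <= c * `|t|.
Local Notation A'V := (trivialized (A 0) A' Ds).
Local Notation P x a := (partial_sum (p x) (fun i => (i <= a)%N)).

Lemma proj0_partial_sum x (a : 'I_n) : proj K (A 0) h a x = P x a.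
Proof.
have AT0 : trivializable_connection (A 0) by apply: AT; rewrite normr0.
exact: (proj_block_family AT0 hF a ES (bf_block H x) (Ep x)).
Qed.

(** [S] gathers the irregular part of the trivializations; it depends on [t] alone and is common to
    all labels and geodesics, so it disappears from the trace of a product. What remains, [F], is
    differentiable at 0. *)
Lemma normalized_proj : exists (beta : UH2 R -> 'M[R]_d) (F : 'I_n -> UH2 R -> R -> 'M[R]_d),
  [/\ primitive (A 0) A' beta,
      forall a x, F a x 0 = P x a,
      forall a x, is_derive (0 : R) (1 : R) (F a x)
        (commM (beta x + integrator (@gflow R) p A'V x) (P x a)) &
      \forall t \near (0 : R), exists2 S, S \in unitmx &
        forall a x, proj K (A t) h a x = invmx S *m F a x t *m S].
Proof.
have [beta [betaD betaP]] := primitive_exists eps0 AT A'D.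
have [Z [Z0 ZD ZP]] := perturbed_family eps0 AT A'D hF H ES Ep c_ge0 Bc.
pose N t x := normalized_ratio A t x.
have N0 x : N 0 x = 1%:M by exact: (normalized_ratio0 eps0 AT).
exists beta, (fun a x t => invmx (N t x) *m (Z t x *m P x a *m invmx (Z t x)) *m N t x); split.
- exact: betaP.
- by move=> a x; rewrite N0 Z0 !invmx1 !mulmx1 !mul1mx.
- move=> a x.
  have Zi : is_derive (0 : R) (1 : R) (fun t => invmx (Z t x)) (- integrator (@gflow R) p A'V x).
    refine (is_derive_eq (is_derive_invmx_near _ (ZD x)) _).
      by apply: filterS ZP => t /(_ x)[].
    by rewrite Z0 invmx1 mul1mx mulmx1.
  have Ni : is_derive (0 : R) (1 : R) (fun t => invmx (N t x)) (beta x).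
    refine (is_derive_eq (is_derive_invmx_near _ (betaD x)) _).
      by apply: filterS (near0_lt eps0) => t te; exact: (normalized_ratio_unit eps0 AT).
    by rewrite -/(N 0 x) N0 invmx1 mul1mx mulmx1 opprK.
  refine (is_derive_eq (is_derive_mulmx (is_derive_mulmx Ni
    (is_derive_mulmx (is_derive_mulmxr _ (ZD x)) Zi)) (betaD x)) _).
  rewrite -/(N 0 x) N0 Z0 !invmx1 !mulmx1 !mul1mx /commM.
  move: (integrator _ _ _ _) (P x a) (beta x) => J U B.
  rewrite mulmxDl mulmxDr !mulmxN.
  by move: (B *m U) (J *m U) (U *m B) (U *m J) => b1 b2 b3 b4; apply/matrixP => i j; rewrite !mxE; ring.
- apply: filterS2 (near0_lt eps0) ZP => t te tZ.
exists (triv_ratio A t (base_point R)); first exact: (triv_ratio_unit eps0 AT).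
move=> a x; have [Zu ->] := tZ x.
have wu := triv_ratio_unit eps0 AT x te; have ru := triv_ratio_unit eps0 AT (base_point R) te.
rewrite /N /normalized_ratio.
move: (triv_ratio A t x) (triv_ratio A t (base_point R)) wu ru => w r wu ru.
move: (Z t x *m _ *m _) => U.
rewrite invmx_mulmx ?unitmx_inv// invmxK !mulmxA mulVmx// mul1mx.
by rewrite mulmxKV.
Qed.

Variable G : ghost_polygon R n.

Lemma Jint_integrator beta x (a : 'I_n) Q : Jint (A 0) A' beta x (P x a) Q =
  \tr (commM (beta x + integrator (@gflow R) p A'V x) (P x a) *m Q).
Proof.
have AT0 : trivializable_connection (A 0) by apply: AT; rewrite normr0.
have fC := orbit_continuous_deriv eps0 AT A'D.
have fc := deriv_bound eps0 AT A'D H Bc.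
by rewrite commMD mulmxDl linearD /= (commM_integrator H x a fC fc Q) /Jint addrA.
Qed.

Lemma is_derive_ghost_trace :
  is_derive (0 : R) (1 : R) (fun t => ghost_trace K (A t) h G) (ghost_integral K (A 0) h G A').
Proof.
have [beta [F [betaP F0 FD FP]]] := normalized_proj.
have near_eq : \forall t \near (0 : R), \tr (\big[mulmx/1%:M]_(j < (sides G).+1)
    F (label (rev_ord j)) (geod (rev_ord j)) t) = ghost_trace K (A t) h G.
  apply: filterS FP => t [S Su tS].
  rewrite /ghost_trace /gproj.
  under [in RHS]eq_bigr do rewrite tS.
  by rewrite bigmul_conj// mxtrace_mulC mulmxA mulmxV// mul1mx.
apply: near_eq_is_derive near_eq _.
refine (is_derive_eq (is_derive_trace_prod (fun i => FD (label i) (geod i))) _).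
rewrite /ghost_integral; set beta' := xget _ _.
have beta'P : primitive (A 0) A' beta' by apply: xgetPex; exists beta.
have gE i : gproj K (A 0) h (G := G) i = P (geod i) (label i) by exact: proj0_partial_sum.
have cE i : gcoproj K (A 0) h (G := G) i = cyclic_coproduct (fun j => F (label j) (geod j) 0) i.
  by apply: eq_bigr => j _; rewrite gE F0.
under [RHS]eq_bigr => i _ do rewrite gE cE Jint_integrator.
apply/eqP; rewrite -subr_eq0 -sumrB; apply/eqP.
(* The primitive picked in [ghost_integral] differs from this one by a constant matrix, whose
   contributions cancel around the cycle. *)
have z := sum_trace_comm (beta (base_point R) - beta' (base_point R))
  (fun j : 'I_(sides G).+1 => F (label j) (geod j) 0).
rewrite -[RHS]z.
apply: eq_bigr => i _.
rewrite -linearB /= -mulmxBl F0 -(primitive_unique (geod i) betaP beta'P).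
congr (\tr (_ *m _)).
exact: commM_addKB.
Qed.

End Final.

Theorem proposition5p6p1 (R : realType) (d n : nat) (K : 'I_n -> nat)
    (k : nat) (eps : R) (nabla : R -> oneform R d) (h : UH2 R -> 'M[R]_d)
    (dnabla : oneform R d) (G : ghost_polygon R n)
    (hK : is_theta d K) (hk : (2 <= k)%N)
    (hrho : theta_uniformly_hyperbolic K (nabla 0) h)
    (hvar : bounded_variation_of k eps nabla h)
    (hdot : derivative_at0 nabla dnabla) :
  is_derive (0 : R) (1 : R) (fun t => ghost_trace K (nabla t) h G)
    (ghost_integral K (nabla 0) h G dnabla).
Proof.
have [eps0 AT _ _] := hvar.
have [AT0 hF] : trivializable_connection (nabla 0) /\ is_frame h.
  (* A configuration has at least one side, whose label provides an index at which hyperbolicity can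
     be read. *)
  by case: hrho => E [_ /(_ (label (g := G) ord0))[]].
have [E [p [b [C [kappa [H ES Ep]]]]]] := theta_block_flow AT0 hF hrho.
have [c [c_ge0 Bc]] := variation_bound (ltnW hk) hvar hF.
apply: (is_derive_ghost_trace eps0 AT hdot hF H ES Ep c_ge0).
apply: filterS Bc => t tc x; apply: le_trans (tc x).
have Tu := triv_unit x AT0; have hu : h x \in unitmx by case: hF.
(* Passing from [E_x] to the parallel sections conjugates the form and multiplies the frame by the
   same matrix, which leaves the norm unchanged. *)
rewrite -(@frame_norm_conj _ _ (invmx (triv (nabla 0) x)) (h x)) ?unitmx_inv// invmxK.
exact: lexx.
Qed.
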